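(* Let $G$ be a finite simple biconnected graph which is complete intersection. Then $G$ satisfies the odd cycle condition, and consequently the edge ring $K[G]$ is normal.
   Context: A graph is biconnected if it is connected and has no cut vertex. For a finite simple graph $G$ with edges $e_1,\dots,e_m$ and a field $K$, the toric ideal $I_G\subseteq K[e_1,\dots,e_m]$ is the kernel of the $K$-algebra map $e_i=\{v_j,v_k\}\mapsto v_jv_k$; $G$ is complete intersection if $I_G$ is generated by $\operatorname{ht}(I_G)$ elements. The edge ring $K[G]$ is the subalgebra of $K[v_1,\dots,v_n]$ generated by the monomials $v_iv_j$ with $\{v_i,v_j\}\in E(G)$. A cycle is chordless if no edge of $G$ joins two of its vertices other than its own edges. $G$ satisfies the odd cycle condition if for any two odd chordless cycles $c_1,c_2$ of $G$, either $c_1$ and $c_2$ have a common vertex or some edge of $G$ joins a vertex of $c_1$ to a vertex of $c_2$. *)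

(* Defs.v *)
From HB Require Import structures.
From mathcomp Require Import all_boot all_order all_algebra fraction.
Set Implicit Arguments. Unset Strict Implicit. Unset Printing Implicit Defensive.
Import Order.TTheory GRing.Theory Num.Theory.
Local Open Scope ring_scope.

(* ---------- Multivariate polynomials K[x_0,...,x_{n-1}] as iterated
   univariate polynomials: mpoly K n.+1 = (mpoly K n)[x_n]. ---------- *)
Fixpoint mpoly (K : fieldType) (n : nat) : idomainType :=
  match n with
  | 0 => K
  | n'.+1 => ({poly mpoly K n'} : idomainType)
  end.

(* the variable x_k of mpoly K n (for k < n) *)
Fixpoint mX (K : fieldType) (n k : nat) : mpoly K n :=
  match n return mpoly K n with
  | 0 => 0
  | n'.+1 => if k == n' then ('X : {poly mpoly K n'}) else (mX K n' k)%:P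
  end.

Arguments mX : clear implicits.

Fixpoint mC (K : fieldType) (n : nat) (c : K) : mpoly K n :=
  match n return mpoly K n with
  | 0 => c
  | n'.+1 => (mC n' c)%:P
  end.

Arguments mC : clear implicits.

Fixpoint meval (K : fieldType) (S : comNzRingType) (cst : K -> S)
    (a : nat -> S) (m : nat) : mpoly K m -> S :=
  match m return mpoly K m -> S with
  | 0 => fun p => cst p
  | m'.+1 => fun p : {poly mpoly K m'} =>
      \sum_(i < size p) meval cst a p`_i * a m' ^+ i
  end.

Definition is_ideal (R : comNzRingType) (I : R -> Prop) : Prop :=
  [/\ I 0, (forall x y, I x -> I y -> I (x + y)) &
      (forall r x, I x -> I (r * x))].

Definition is_prime_ideal (R : comNzRingType) (P : R -> Prop) : Prop :=
  [/\ is_ideal P, ~ P 1 & (forall x y, P (x * y) -> P x \/ P y)].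

Definition strict_incl (R : Type) (A B : R -> Prop) : Prop :=
  (forall x, A x -> B x) /\ (exists x, B x /\ ~ A x).

Definition prime_chain_to (R : comNzRingType) (P : R -> Prop) (h : nat) : Prop :=
  exists Q : nat -> R -> Prop,
    [/\ (forall i, (i <= h)%N -> is_prime_ideal (Q i)),
        (forall i, (i < h)%N -> strict_incl (Q i) (Q i.+1)) &
        (forall x, Q h x <-> P x)].

(* ht(I) = h : every prime containing I has height >= h, and some prime
   containing I has height exactly h (i.e. not >= h+1). *)
Definition ideal_height (R : comNzRingType) (I : R -> Prop) (h : nat) : Prop :=
  (forall P, is_prime_ideal P -> (forall x, I x -> P x) -> prime_chain_to P h)
  /\ (exists P, [/\ is_prime_ideal P, (forall x, I x -> P x) &
                    ~ prime_chain_to P h.+1]).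

Definition generated_by (R : comNzRingType) (I : R -> Prop) (gs : seq R) : Prop :=
  forall f, I f <-> exists cs : seq R,
      size cs = size gs /\ f = \sum_(i < size gs) cs`_i * gs`_i.

Definition complete_intersection_ideal (R : comNzRingType) (I : R -> Prop) : Prop :=
  exists h, ideal_height I h /\ exists gs : seq R, size gs = h /\ generated_by I gs.

Definition simple_graph (T : finType) (e : rel T) : Prop :=
  symmetric e /\ irreflexive e.

Definition connected_graph (T : finType) (e : rel T) : Prop :=
  forall x y, connect e x y.

Definition del_vertex (T : finType) (e : rel T) (v : T) : rel T :=
  fun x y => [&& e x y, x != v & y != v].

Definition cut_vertex (T : finType) (e : rel T) (v : T) : Prop :=
  exists x y, [/\ x != v, y != v & ~~ connect (del_vertex e v) x y].

Definition biconnected (T : finType) (e : rel T) : Prop :=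
  connected_graph e /\ forall v, ~ cut_vertex e v.

Definition edge_set (T : finType) (e : rel T) : {set {set T}} :=
  [set [set x; y] | x in T, y in T & e x y].

Definition nth_edge (T : finType) (e : rel T) (k : nat) : option {set T} :=
  match @insub nat (fun k => (k < #|edge_set e|)%N) _ k with
  | Some i => Some (@enum_val _ (mem (edge_set e)) i)
  | None => None
  end.

Definition vvar (K : fieldType) (T : finType) (v : T) : mpoly K #|T| :=
  mX K #|T| (enum_rank v).

Arguments vvar K {T} v.

Definition edge_mon (K : fieldType) (T : finType) (e : rel T) (k : nat)
  : mpoly K #|T| :=
  match nth_edge e k with
  | Some s => \prod_(v in s) vvar K v
  | None => 0
  end.

Arguments edge_mon K {T} e k.

Definition edge_map (K : fieldType) (T : finType) (e : rel T)
  : mpoly K #|edge_set e| -> mpoly K #|T| :=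
  @meval K (mpoly K #|T|) (mC K #|T|) (edge_mon K e) #|edge_set e|.

Arguments edge_map K {T} e _.

Definition toric_ideal (K : fieldType) (T : finType) (e : rel T)
  : mpoly K #|edge_set e| -> Prop :=
  fun f => edge_map K e f = 0.

Arguments toric_ideal K {T} e _.

Definition complete_intersection_graph (K : fieldType) (T : finType) (e : rel T)
  : Prop := complete_intersection_ideal (toric_ideal K e).

Definition edge_ring (K : fieldType) (T : finType) (e : rel T)
  : mpoly K #|T| -> Prop :=
  fun a => exists f, a = edge_map K e f.

Arguments edge_ring K {T} e _.

(* a subring A (given as a predicate) of a domain R is normal: integrally
   closed in its field of fractions, realized inside Frac(R). *)
Definition normal_subring (R : idomainType) (A : R -> Prop) : Prop :=
  forall x : {fraction R},
    (exists a b, [/\ A a, A b, b != 0 & x = FracField.tofrac a / FracField.tofrac b]) ->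
    (exists q : {poly R}, [/\ q \is monic,
        (forall i, A q`_i) & root (map_poly (@FracField.tofrac R) q) x]) ->
    exists a, A a /\ x = FracField.tofrac a.

Definition graph_cycle (T : finType) (e : rel T) (c : seq T) : bool :=
  [&& (3 <= size c)%N, uniq c & cycle e c].

Definition chordless (T : finType) (e : rel T) (c : seq T) : bool :=
  [forall x, forall y, (x \in c) && (y \in c) && e x y ==>
                        (y == next c x) || (x == next c y)].

Definition odd_chordless_cycle (T : finType) (e : rel T) (c : seq T) : bool :=
  [&& graph_cycle e c, chordless e c & odd (size c)].

Definition odd_cycle_condition (T : finType) (e : rel T) : Prop :=
  forall c1 c2, odd_chordless_cycle e c1 -> odd_chordless_cycle e c2 ->
    has (mem c2) c1 \/ exists x y, [/\ x \in c1, y \in c2 & e x y].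

(* Main.v *)
(** Write [A] for the incidence map of the graph and [L] for its lattice of integer
    relations.  A chain of primes of length [h] ending at the toric ideal forces
    [h <= m - rank A], because passing to a strictly larger prime lowers the
    transcendence degree.  Since the ideal is generated by [h] elements, at most [h]
    binomials span it modulo the maximal ideal times itself; they connect all fibres of
    the semigroup and their exponent vectors generate [L].  If [S] is a set of edges and
    at least [#|S|] of these vectors take both signs on [S], then, for a largest such
    [S], the complement of [S] is a proper face of full rank, which is absurd.  Hence
    the sign pattern of the vectors is dominating, and such a pattern splits: some
    vector [b0] and some partition [E1 + E2] of the edges are such that [b0 >= 0] on
    [E1], [b0 <= 0] on [E2], and each other vector lives on one of the two parts.  So
    the degree [alpha] of [b0] is a sum of edges of [E1] and also a sum of edges of [E2],
    and the degree of the [E1]-part of each edge_relation is a multiple of [alpha].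

    Let [c1], [c2] be disjoint chordless odd cycles without connecting edge, which no
    vertex separates.  Applying the last property to the edge_relation carried by [c1], a
    path and [c2], and counting modulo 2, one finds that [c1] and [c2] lie in the
    same part, in which they are still not separated by a vertex: infinite descent.

    For normality, a fraction almost integral over the edge ring is divided out
    monomial by monomial; each leading exponent [u] has even degree and a multiple in the
    edge semigroup.  In a minimal counterexample [u] is the indicator of disjoint odd
    cycles, and the odd cycle condition matches two of them. *)
From HB Require Import structures.
From Stdlib Require Import ClassicalEpsilon FunctionalExtensionality.
From mathcomp Require Import all_boot all_order all_algebra fraction.
From mathcomp Require Import zify ring lra.
From mathcomp.multinomials Require Import mpoly.
Require Import Defs.
Set Implicit Arguments. Unset Strict Implicit. Unset Printing Implicit Defensive.
Import Order.TTheory GRing.Theory Num.Theory.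

(** * Dominating sign patterns *)

(** A part of the edges cut out by a splitting row need not form a biconnected graph, so the descent
    carries only what a part does inherit: domination, which passes to every subset of the rows;
    generation of the relations supported on the part by the rows living there; and the two cycles,
    joined by walks that avoid any prescribed vertex. The counting modulo 2 starts from one fact.
    Alternating signs around an odd closed walk leave the boundary 2 at its base point and 0
    elsewhere. Two odd cycles and a walk between them therefore carry a relation in which the cycles
    enter with coefficients 1 or -1 and the walk with 2 or -2. Modulo 2 the walk disappears, and
    whether an edge of a cycle belongs to [B1] can be read off at the vertices of that cycle. The
    freedom to avoid a vertex serves to kill an unknown multiple of [alpha]: the walk is made to
    miss a vertex where [alpha] is nonzero. *)

Lemma connect_homo (J J' : finType) (R : rel J) (R' : rel J') (f : J -> J') :
  (forall x y, R x y -> connect R' (f x) (f y)) ->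
  forall x y, connect R x y -> connect R' (f x) (f y).
Proof.
move=> h x y /connectP[s + ->] {y}; elim: s x => [|z s IH] x //= /andP[/h xz /IH].
exact: connect_trans.
Qed.

Section SignedRows.
Variables (I J : finType).
Implicit Types (A R : {set I}) (P Q : I -> bool -> {set J}) (S : {set J}).

Definition row_supp P r := \bigcup_b P r b.
Definition mixed P r S := [forall b, P r b :&: S != set0].
Definition mu A P S := #|[set r in A | mixed P r S]|.
(** For a matrix with sign pattern [P]: no square submatrix has both signs in each of its rows. The
    case of a singleton is what makes the two sides of a row disjoint, see [dominating_disjoint]. *)
Definition dominating A P := forall S, S != set0 -> mu A P S < #|S|.
Definition nonempty_sides A P := forall r b, r \in A -> P r b != set0.
Definition row_adj A P : rel J :=
  fun x y => [exists r in A, (x \in row_supp P r) && (y \in row_supp P r)].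
(** Equivalently, the columns can be ordered so that the rows other than [r] are block diagonal with
    two blocks, the positive entries of [r] lying over one block and the negative ones over the
    other. *)
Definition splits A P r :=
  (r \in A) && [forall p in P r true, forall q in P r false,
                  ~~ connect (row_adj (A :\ r) P) p q].
Definition entries A P := \sum_(r in A) (#|P r true| + #|P r false|).

Lemma row_suppP P r x : reflect (exists b, x \in P r b) (x \in row_supp P r).
Proof.
by apply: (iffP bigcupP) => [[b _ h]|[b h]]; exists b.
Qed.

Lemma mem_row_supp P r b x : x \in P r b -> x \in row_supp P r.
Proof. by move=> h; apply/row_suppP; exists b. Qed.

Lemma mixedP P r S : reflect (forall b, exists2 x, x \in P r b & x \in S) (mixed P r S).
Proof.
apply: (iffP forallP) => h b.
  by have /set0Pn[x /setIP[]] := h b; exists x.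
by have [x xP xS] := h b; apply/set0Pn; exists x; rewrite inE xP.
Qed.

Lemma row_adjP A P x y : reflect
  (exists r, [/\ r \in A, x \in row_supp P r & y \in row_supp P r]) (row_adj A P x y).
Proof.
apply: (iffP exists_inP) => [[r rA /andP[]]|[r [rA h1 h2]]]; first by exists r.
by exists r; rewrite ?h1.
Qed.

Lemma row_adj_sym A P : ssrbool.symmetric (row_adj A P).
Proof. by move=> x y; apply/row_adjP/row_adjP => -[r [? ? ?]]; exists r. Qed.

Lemma connect_row_sym A P x y : connect (row_adj A P) x y = connect (row_adj A P) y x.
Proof. by apply: (sym_connect_sym (@row_adj_sym A P)). Qed.

Lemma splitsP A P r : reflect
  (r \in A /\ forall b p q, p \in P r b -> q \in P r (~~ b) ->
     ~~ connect (row_adj (A :\ r) P) p q) (splits A P r).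
Proof.
apply: (iffP andP) => -[rA h]; split=> //.
  move=> [] p q hp hq; first by move/forall_inP/(_ p hp)/forall_inP/(_ q hq): h.
  by move/forall_inP/(_ q hq)/forall_inP/(_ p hp): h; rewrite connect_row_sym.
by apply/forall_inP=> p hp; apply/forall_inP=> q hq; apply: (h true).
Qed.

Lemma mixed_mono P Q r S S' :
  (forall b x, x \in Q r b -> x \in S -> x \in P r b /\ x \in S') ->
  mixed Q r S -> mixed P r S'.
Proof.
move=> h /mixedP m; apply/mixedP => b; have [x x1 x2] := m b.
by have [] := h b x x1 x2; exists x.
Qed.

Lemma mu_sub A P A' Q S S' :
  (forall r, r \in A -> mixed P r S -> r \in A' /\ mixed Q r S') ->
  mu A P S <= mu A' Q S'.
Proof.
move=> h; apply: subset_leq_card; apply/subsetP=> r; rewrite !inE => /andP[rA m].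
by have [-> ->] := h r rA m.
Qed.

Lemma mu_set0 A P : mu A P set0 = 0.
Proof.
apply/eqP; rewrite cards_eq0; apply/eqP/setP=> r; rewrite !inE.
apply/negbTE; rewrite negb_and; apply/orP; right; apply/negP=> /mixedP/(_ true)[x _].
by rewrite inE.
Qed.

Lemma dominating_sub A P A' Q : dominating A P -> A' \subset A ->
  (forall r b, r \in A' -> Q r b \subset P r b) -> dominating A' Q.
Proof.
move=> D sA sP S S0; apply: leq_ltn_trans (D S S0); apply: mu_sub => r rA m.
split; first exact: (subsetP sA).
by apply: mixed_mono m => b x xQ xS; split=> //; apply: (subsetP (sP r b rA)).
Qed.

Lemma dominating_disjoint A P r b x : dominating A P -> r \in A ->
  x \in P r b -> x \in P r (~~ b) -> False.
Proof.
move=> D rA h1 h2.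
have x0 : [set x] != set0 by apply/set0Pn; exists x; rewrite inE.
have := D _ x0; rewrite cards1 ltnS leqn0 cards_eq0 => /eqP/setP/(_ r).
rewrite !inE rA /= => /negP; apply; apply/mixedP=> c; exists x; rewrite ?inE //.
by case: b h1 h2; case: c.
Qed.

Lemma entries_lt A P A' Q r0 : A' \subset A ->
  (forall r b, r \in A' -> #|Q r b| <= #|P r b|) -> r0 \in A ->
  (r0 \in A' -> exists b, #|Q r0 b| < #|P r0 b|) ->
  (r0 \notin A' -> exists b, 0 < #|P r0 b|) ->
  entries A' Q < entries A P.
Proof.
move=> sA le r0A h1 h2; rewrite /entries (bigD1 r0 r0A) /=.
have hle (B : {set I}) : B \subset A :\ r0 -> B \subset A' ->
  \sum_(r in B) (#|Q r true| + #|Q r false|) <=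
  \sum_(r in A | r != r0) (#|P r true| + #|P r false|).
  move=> sB sB'; rewrite [X in _ <= X](bigID (mem B)) /=.
  rewrite (leq_trans _ (leq_addr _ _)) //.
  rewrite [X in _ <= X](eq_bigl (fun r => r \in B)); last first.
    move=> r; case: (boolP (r \in B)) => [rB|]; last by rewrite !andbF.
    by have := subsetP sB r rB; rewrite !inE => /andP[-> ->].
  by apply: leq_sum => r rB; apply: leq_add; apply: le; apply: (subsetP sB').
case: (boolP (r0 \in A')) => r0A'.
  rewrite (bigD1 r0 r0A') /= -addSn; apply: leq_add.
    have [b] := h1 r0A'; have := le r0 true r0A'; have := le r0 false r0A'.
    by case: b; lia.
  have := hle (A' :\ r0); rewrite setSD // subD1set => /(_ isT isT).
  by apply: leq_trans; apply: eq_leq; apply: eq_bigl => r; rewrite !inE andbC.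
have [b hb] := h2 r0A'; rewrite -add1n; apply: leq_add; first by case: b hb; lia.
by apply: hle => //; rewrite subsetD1 sA.
Qed.

(** The smaller instances below arise by mapping columns to columns. A chain of rows avoiding [k] is
    sent to such a chain, so a separation in the image lifts; this turns a splitting row of the
    small instance into one of the counterexample. *)
Lemma splits_pullback A P A' Q k (f : J -> J) : k \in A -> splits A' Q k ->
  (forall r x y, r \in A -> r != k -> x \in row_supp P r -> y \in row_supp P r ->
     connect (row_adj (A' :\ k) Q) (f x) (f y)) ->
  (forall b x, x \in P k b -> f x \in Q k b) -> splits A P k.
Proof.
move=> kA /splitsP[_ h] fadj fk; apply/splitsP; split=> // b p q pP qP.
apply: contra (h b _ _ (fk _ _ pP) (fk _ _ qP)).
apply: (connect_homo (f := f)) => x y /row_adjP[r []]; rewrite !inE => /andP[rk rA] xr yr.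
exact: (fadj r).
Qed.

Lemma connect_row A P r x y : r \in A -> x \in row_supp P r -> y \in row_supp P r ->
  connect (row_adj A P) x y.
Proof. by move=> *; apply: connect1; apply/row_adjP; exists r. Qed.

Lemma connect_row_closed A P r z x y : r \in A -> x \in row_supp P r ->
  y \in row_supp P r -> connect (row_adj A P) z x -> connect (row_adj A P) z y.
Proof. by move=> rA xr yr /connect_trans; apply; apply: connect_row rA xr yr. Qed.

(* In a counterexample with the fewest entries, the columns of a row are connected through
   the other rows (else restrict to a component) and each row has a side with at least two
   entries (else contract the row).  Each entry of such a side lies in exactly one other
   row, of which it is a whole side; counting these entries is contradictory. *)
Section MinimalCounterexample.
Variables (A : {set I}) (P : I -> bool -> {set J}).
Hypothesis D : dominating A P.
Hypothesis ne : nonempty_sides A P.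
Hypothesis IH : forall A' Q, entries A' Q < entries A P -> A' != set0 ->
  nonempty_sides A' Q -> dominating A' Q -> exists r, splits A' Q r.
Hypothesis nosplit : forall r, ~~ splits A P r.

Lemma side_pos r b : r \in A -> 0 < #|P r b|.
Proof. by move=> rA; rewrite card_gt0 ne. Qed.

(** As [i] does not split, some positive column [p] and negative column [q] are joined without [i].
    If their component [X] missed a column of [i], restricting everything to [X] would give a
    smaller dominating instance; its splitting row is not [i], because [p] and [q] are still joined,
    and any other one lifts. *)
Lemma cex_row_connected i x y : i \in A -> x \in row_supp P i -> y \in row_supp P i ->
  connect (row_adj (A :\ i) P) x y.
Proof.
move=> iA; suff [p hp] : exists p, forall x, x \in row_supp P i ->
    connect (row_adj (A :\ i) P) p x.
  by move=> /hp h1 /hp h2; apply: connect_trans h2; rewrite connect_row_sym.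
have [p [q [hpi qi pq]]] : exists p q, [/\ p \in P i true, q \in P i false &
    connect (row_adj (A :\ i) P) p q].
  have := nosplit i; rewrite /splits iA /= negb_forall => /existsP[p].
  rewrite negb_imply => /andP[hpi]; rewrite negb_forall => /existsP[q].
  by rewrite negb_imply negbK => /andP[qi pq]; exists p, q.
exists p => z0; pose X := [set y | connect (row_adj (A :\ i) P) p y].
suff /subsetP sX : row_supp P i \subset X by move/sX; rewrite inE.
apply/negPn/negP => nX {z0 x y}.
have Xcl r x y : r \in A -> r != i -> x \in row_supp P r -> y \in row_supp P r ->
    x \in X -> y \in X.
  by move=> rA ri xr yr; rewrite !inE; apply: (connect_row_closed _ xr yr); rewrite !inE ri.
have pX : p \in X by rewrite inE.
have qX : q \in X by rewrite inE.
pose A' := i |: [set r in A :\ i | row_supp P r \subset X].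
pose Q r b := if r == i then P r b :&: X else P r b.
have sQ r b : Q r b \subset P r b by rewrite /Q; case: eqP => // _; apply: subsetIl.
have sA : A' \subset A.
  by apply/subsetP=> r; rewrite !inE => /orP[/eqP->//|/andP[/andP[]]].
have iA' : i \in A' by rewrite !inE eqxx.
have [k kS] : exists r, splits A' Q r.
  apply: IH.
  - apply: (entries_lt (r0 := i)) => //; first by move=> r b _; apply: subset_leq_card.
    + move=> _; move/subsetPn: nX => [z /row_suppP[b zb] zX]; exists b.
      apply: proper_card; rewrite /Q eqxx properE subsetIl; apply/subsetPn; exists z => //.
      by rewrite inE (negPf zX) andbF.
    + by rewrite iA'.
  - by apply/set0Pn; exists i.
  - move=> r b rA'; rewrite /Q; case: (eqVneq r i) => [->|_]; last by apply: ne; apply: (subsetP sA).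
    by apply/set0Pn; case: b; [exists p|exists q]; rewrite inE ?hpi ?pX ?qi ?qX.
  - exact: dominating_sub D sA _.
have /splitsP[kA' kh] := kS; have kA := subsetP sA _ kA'.
have suppQ r x : r != i -> (x \in row_supp Q r) = (x \in row_supp P r).
  by move=> ri; rewrite /row_supp /Q (negPf ri).
case: (eqVneq k i) => [ki|ki].
  suff : connect (row_adj (A' :\ k) Q) p q.
    by apply/negP; apply: (kh true); rewrite ki /Q eqxx inE ?hpi ?qi.
  move: pq => /connectP[s ps ->].
  elim/last_ind: s ps => [|s y IHs] //; rewrite rcons_path last_rcons => /andP[ps sy].
  apply: (connect_trans (IHs ps)); apply: connect1.
  case/row_adjP: sy => r [rA xr yr]; apply/row_adjP; exists r.
  move: (rA); rewrite !inE ki => /andP[ri rA0]; rewrite !suppQ //; split=> //.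
  rewrite (negPf ri) rA0 /=; apply/subsetP=> z zr; apply: (Xcl r (last p s)) => //.
  by rewrite inE; apply/connectP; exists s.
(* Send all columns outside [X] to [p]: row [i] lands in its restricted support, and a row disjoint
   from [X] becomes a point. *)
suff : splits A P k by apply/negP.
apply: (splits_pullback (f := fun y => if y \in X then y else p) kA kS); last first.
  move=> b x xk; rewrite /Q (negPf ki); suff -> : x \in X by [].
  case/setU1P: kA' => [/eqP|/setIdP[_ /subsetP]]; first by rewrite (negPf ki).
  by apply; apply: mem_row_supp xk.
move=> r x y rA rk xr yr; case: (eqVneq r i) => [ri|ri].
  apply: (connect_row (r := i)); first by rewrite !inE eq_sym ki eqxx.
    case: (boolP (x \in X)) => xX; apply/row_suppP; last by exists true; rewrite /Q eqxx inE hpi.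
    by move: xr; rewrite ri => /row_suppP[b xb]; exists b; rewrite /Q eqxx inE xb.
  case: (boolP (y \in X)) => xX; apply/row_suppP; last by exists true; rewrite /Q eqxx inE hpi.
  by move: yr; rewrite ri => /row_suppP[b xb]; exists b; rewrite /Q eqxx inE xb.
case: (boolP (x \in X)) => xX.
  rewrite (Xcl r x) //; apply: (connect_row (r := r)); rewrite ?suppQ //.
  rewrite !inE rk (negPf ri) rA /=; apply/subsetP=> z zr; exact: (Xcl r x).
case: (boolP (y \in X)) => // yX; case/negP: xX; exact: (Xcl r y).
Qed.

(** A row with sides [[set p]] and [[set q]] can be contracted: drop it and identify [q] with [p].
    Domination survives, since for [S] containing [p] the set [q |: S] has at most one more column
    and gains the mixed row [j]. *)
Lemma cex_big_side j : j \in A -> exists b, 1 < #|P j b|.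
Proof.
move=> jA; case: (ltnP 1 #|P j true|) => [|h1]; first by exists true.
case: (ltnP 1 #|P j false|) => [|h2]; first by exists false.
have /cards1P[p Ep] : #|P j true| == 1 by rewrite eqn_leq h1 side_pos.
have /cards1P[q Eq] : #|P j false| == 1 by rewrite eqn_leq h2 side_pos.
exfalso.
have pj : p \in row_supp P j by apply: (@mem_row_supp _ _ true); rewrite Ep inE.
have qj : q \in row_supp P j by apply: (@mem_row_supp _ _ false); rewrite Eq inE.
have pq : p != q.
  by apply/eqP=> pq; apply: (@dominating_disjoint A P j true p D jA); rewrite ?Ep /= ?Eq -?pq inE.
pose f y := if y == q then p else y.
pose Q r b := f @: P r b.
have [k kS] : exists r, splits (A :\ j) Q r.
  apply: IH.
  - apply: (entries_lt (r0 := j)) => //; first exact: subsetDl.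
    + by move=> r b _; apply: leq_imset_card.
    + by rewrite !inE eqxx.
    + by exists true; apply: side_pos.
  - apply/set0Pn; have := cex_row_connected jA pj qj.
    case/connectP=> -[_ /esym/eqP|z s /= /andP[/row_adjP[r [rA _ _]] _] _].
      by rewrite /= (negPf pq).
    by exists r.
  - move=> r b; rewrite !inE => /andP[_ rA]; have /set0Pn[x xr] := ne b rA.
    by apply/set0Pn; exists (f x); apply: imset_f.
  - move=> S S0; case: (boolP (p \in S)) => pS.
      have lt1 : mu (A :\ j) Q S < mu A P (q |: S).
        apply: proper_card; apply/properP; split.
          apply/subsetP=> r; rewrite !inE => /andP[/andP[rj rA] /mixedP m]; rewrite rA.
          apply/mixedP=> b; have [_ /imsetP[x xr ->] fx] := m b; exists x => //.
          by move: fx; rewrite /f !inE; case: eqP.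
        exists j; rewrite !inE ?eqxx //= jA; apply/mixedP=> -[].
          by exists p; rewrite ?Ep !inE ?eqxx ?pS ?orbT.
        by exists q; rewrite ?Eq !inE ?eqxx.
      have S1 : q |: S != set0 by apply/set0Pn; exists q; rewrite !inE eqxx.
      have := D S1; have := cardsU1 q S; move: lt1; clear; case: (q \notin S); lia.
    apply: leq_ltn_trans (D S0); apply: mu_sub => r; rewrite !inE => /andP[rj rA] /mixedP m.
    split=> //; apply/mixedP=> b; have [_ /imsetP[x xr ->] fx] := m b; exists x => //.
    by move: fx; rewrite /f; case: eqP => // _; rewrite (negPf pS).
have /splitsP[] := kS; rewrite !inE => /andP[kj kA] kh.
suff : splits A P k by apply/negP.
apply: (splits_pullback (f := f) kA kS); last by move=> b x; apply: imset_f.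
move=> r x y rA rk xr yr; case: (eqVneq r j) => [rj|rj].
  suff E z : z \in row_supp P r -> f z = p by rewrite !E.
  rewrite rj /f => /row_suppP[[]]; rewrite ?Ep ?Eq inE => /eqP->; last by rewrite eqxx.
  by rewrite (negPf pq).
apply: (connect_row (r := r)); first by rewrite !inE rk rj.
  by case/row_suppP: xr => b xb; apply/row_suppP; exists b; apply: imset_f.
by case/row_suppP: yr => b xb; apply/row_suppP; exists b; apply: imset_f.
Qed.

Lemma mu_sum A0 Q S : mu A0 Q S = \sum_(r in A0) (mixed Q r S : nat).
Proof. by rewrite /mu -sum1dep_card -big_mkcondr. Qed.

Lemma mu_pair i j R Q S : i != j -> i \notin R -> j \notin R ->
  mu (i |: (j |: R)) Q S = mixed Q i S + (mixed Q j S + mu R Q S).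
Proof. by move=> ij iR jR; rewrite !mu_sum !big_setU1 // !inE negb_or ij. Qed.

Lemma mu_disjU R R' Q S : [disjoint R & R'] -> mu (R :|: R') Q S = mu R Q S + mu R' Q S.
Proof.
by move=> d; rewrite !mu_sum -bigU //=; apply: eq_bigl => r; rewrite !inE.
Qed.

Lemma not_dominating A0 Q : ~ dominating A0 Q -> exists2 S, S != set0 & #|S| <= mu A0 Q S.
Proof.
move=> nD; have /forallPn[S] : ~~ [forall S : {set J}, (S != set0) ==> (mu A0 Q S < #|S|)].
  by apply/negP=> /forallP h; apply: nD => S S0; apply: (implyP (h S)).
by rewrite negb_imply -leqNgt => /andP[]; exists S.
Qed.

Lemma mu_lt_or0 R S : R \subset A -> (S = set0 /\ mu R P S = 0) \/ mu R P S < #|S|.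
Proof.
move=> sR; case: (eqVneq S set0) => [->|S0]; [left|right]; first by rewrite mu_set0.
by apply: leq_ltn_trans (D S0); apply: mu_sub => r /(subsetP sR).
Qed.

(** Delete the entry [p] of row [i]. The smaller pattern splits at some row [j], which did not split
    before; hence the deleted entry was the only link between the component [X] of [p] and the
    component [Y] of the rest of [i], and [j] has one side in each. If no further row lies in [X],
    then [X] is [[set p]] and [j] is as wanted. Otherwise collapsing either [X] or its complement
    gives two smaller instances. Neither can dominate, and their two bad column sets add up to a bad
    set for [A]. *)
Lemma cex_private_entry i b p : i \in A -> p \in P i b -> 1 < #|P i b| ->
  exists j, [/\ j \in A, j != i, exists b', P j b' = [set p] &
    forall r, r \in A -> p \in row_supp P r -> r = i \/ r = j].
Proof.
move=> iA hpi big.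
pose P1 r c := if (r == i) && (c == b) then P r c :\ p else P r c.
have sP1 r c : P1 r c \subset P r c by rewrite /P1; case: ifP => // _; apply: subsetDl.
have [n0 n0i] : exists n, n \in P i (~~ b) by apply/set0Pn; apply: ne.
have nn0 : ~~ b != b by apply/eqP; case: (b).
have pn0 : p != n0.
  by apply/eqP=> E; apply: (dominating_disjoint D iA hpi); rewrite E.
have [j jS] : exists r, splits A P1 r.
  apply: IH.
  - apply: (entries_lt (r0 := i)) => //; first by move=> r c _; apply: subset_leq_card.
      by move=> _; exists b; rewrite /P1 !eqxx /= (cardsD1 p (P i b)) hpi.
    by rewrite iA.
  - by apply/set0Pn; exists i.
  - move=> r c rA; rewrite /P1; case: ifP => [/andP[/eqP-> /eqP->]|_]; last exact: ne.
    by move: big; rewrite (cardsD1 p (P i b)) hpi ltnS card_gt0.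
  - exact: dominating_sub D _ _.
have suppP1 r x : r != i -> (x \in row_supp P1 r) = (x \in row_supp P r).
  by move=> ri; rewrite /row_supp /P1 (negPf ri).
have suppP1i x : (x \in row_supp P1 i) = (x \in row_supp P i) && (x != p).
  apply/row_suppP/andP=> [[c]|[/row_suppP[c xc] xp]].
    rewrite /P1 eqxx /=; case: (eqVneq c b) => [->|cb] => [/setD1P[xp xi]|xi].
      by split=> //; apply: mem_row_supp xi.
    split; first exact: mem_row_supp xi.
    apply/eqP=> xp; apply: (dominating_disjoint D iA hpi).
    by have -> : ~~ b = c; [case: (c) (b) cb => [] []|rewrite -xp].
  by exists c; rewrite /P1 eqxx /=; case: eqP => // _; rewrite !inE xp.
have n0P1 : n0 \in row_supp P1 i.
  by rewrite suppP1i eq_sym pn0 (mem_row_supp n0i).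
have /splitsP[jA jh] := jS.
have ji : j != i.
  apply/eqP=> E; have [p2 /setD1P[p2p p2i]] : exists x, x \in P i b :\ p.
    by apply/set0Pn; move: big; rewrite (cardsD1 p (P i b)) hpi ltnS card_gt0.
  have /negP[] : ~~ connect (row_adj (A :\ j) P1) p2 n0.
    by apply: (jh b); rewrite E /P1 eqxx ?eqxx ?(negPf nn0) //= !inE p2p.
  have := cex_row_connected iA (mem_row_supp p2i) (mem_row_supp n0i); rewrite E.
  apply: (connect_homo (f := id)) => x y /row_adjP[r [/setD1P[ri rA] xr yr]].
  by apply: (connect_row (r := r)); rewrite ?suppP1 // !inE ri.
have P1j c : P1 j c = P j c by rewrite /P1 (negPf ji).
pose H' := row_adj (A :\ j) P1.
have H'sym x y : connect H' x y = connect H' y x by apply: connect_row_sym.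
have jsep c x y : x \in P j c -> y \in P j (~~ c) -> ~~ connect H' x y.
  by rewrite -!P1j; apply: jh.
have jmeet c : exists x, x \in P j c by apply/set0Pn; apply: ne.
have H'i : i \in A :\ j by rewrite !inE eq_sym ji.
have iY z : z \in row_supp P i -> z != p -> connect H' n0 z.
  by move=> zi zp; apply: (connect_row H'i); rewrite // suppP1i zi.
have H'r r x y : r \in A -> r != i -> r != j -> x \in row_supp P r -> y \in row_supp P r ->
    connect H' x y.
  by move=> rA ri rj xr yr; apply: (connect_row (r := r)); rewrite ?suppP1 // !inE rj.
have sep : ~~ connect H' p n0.
  apply/negP=> pn; have [x xj] := jmeet true; have [y yj] := jmeet false.
  case/negP: (jsep _ _ _ xj yj).
  have iz z : z \in row_supp P i -> connect H' n0 z.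
    by move=> zi; case: (eqVneq z p) => [->|/iY]; [rewrite H'sym|apply].
  have := cex_row_connected jA (mem_row_supp xj) (mem_row_supp yj).
  apply: (connect_homo (f := id)) => {xj yj}x {}y /row_adjP[r [/setD1P[rj rA] xr yr]].
  case: (eqVneq r i) => [ri|ri]; last exact: (H'r r).
  by apply: (connect_trans (y := n0)); [rewrite H'sym|]; apply: iz; rewrite -ri.
pose X := [set y | connect H' p y]; pose Y := [set y | connect H' n0 y].
have XY x : x \in X -> x \in Y -> False.
  rewrite !inE => h1; rewrite H'sym => /(connect_trans h1); exact/negP.
have pX : p \in X by rewrite inE.
have n0Y : n0 \in Y by rewrite inE.
have Xcl r x y : r \in A -> r != i -> r != j -> x \in row_supp P r -> y \in row_supp P r ->
    x \in X -> y \in X.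
  by move=> rA ri rj xr yr; rewrite !inE => /connect_trans; apply; apply: H'r xr yr.
have Ycl r x y : r \in A -> r != i -> r != j -> x \in row_supp P r -> y \in row_supp P r ->
    x \in Y -> y \in Y.
  by move=> rA ri rj xr yr; rewrite !inE => /connect_trans; apply; apply: H'r xr yr.
have iXY z : z \in row_supp P i -> z != p -> z \in Y by rewrite inE; apply: iY.
(* Giving [p] back to row [i] merges only [X] with [Y]; a column of [j] outside both would stay
   apart from the other side of [j], against [cex_row_connected]. *)
have jXY c x : x \in P j c -> x \in X \/ x \in Y.
  move=> xj; case: (boolP (x \in X :|: Y)) => [/setUP//|xXY]; exfalso.
  have [y yj] := jmeet (~~ c).
  pose f z := if z \in X :|: Y then n0 else z.
  have : connect H' (f x) (f y).
    have := cex_row_connected jA (mem_row_supp xj) (mem_row_supp yj).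
    apply: (connect_homo (f := f)) => z t /row_adjP[r [/setD1P[rj rA] zr tr]]; rewrite /f.
    case: (eqVneq r i) => [ri|ri].
      have E u : u \in row_supp P r -> u \in X :|: Y.
        rewrite ri => ur; case: (eqVneq u p) => [->|/(iXY _ ur) uY]; first by rewrite inE pX.
        by rewrite inE uY orbT.
      by rewrite !E.
    have E : (z \in X :|: Y) = (t \in X :|: Y).
      by apply/setUP/setUP=> -[h|h]; [left|right|left|right];
        [apply: (Xcl r z)|apply: (Ycl r z)|apply: (Xcl r t)|apply: (Ycl r t)].
    rewrite E; case: ifP => // _; exact: (H'r r).
  rewrite {1}/f (negPf xXY) /f; case: ifP => _ h.
    by case/negP: xXY; rewrite inE; apply/orP; right; rewrite inE H'sym.
  by case/negP: (jsep _ _ _ xj yj).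
have [b' [bX bY]] : exists b', (forall x, x \in P j b' -> x \in X) /\
    (forall x, x \in P j (~~ b') -> x \in Y).
  have [x0 x0j] := jmeet true; have [y0 y0j] := jmeet false.
  have same W : forall x y, x \in [set y | connect H' W y] -> y \in [set y | connect H' W y] -> connect H' x y.
    by move=> x y; rewrite !inE H'sym; apply: connect_trans.
  have [x0X|x0Y] := jXY _ _ x0j.
    have hY x : x \in P j false -> x \in Y.
      move=> xj; have [xX|//] := jXY _ _ xj.
      by case/negP: (jsep true _ _ x0j xj); apply: (same p).
    exists true; split=> // x xj; have [//|xY] := jXY _ _ xj.
    by case/negP: (jsep true _ _ xj y0j); apply: (same n0) => //; apply: hY.
  have hX x : x \in P j false -> x \in X.
    move=> xj; have [//|xY] := jXY _ _ xj.
    by case/negP: (jsep true _ _ x0j xj); apply: (same n0).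
  exists false; split=> // x xj; have [xX|//] := jXY _ _ xj.
  by case/negP: (jsep true _ _ xj y0j); apply: (same p) => //; apply: hX.
pose RX := [set r in A :\ i :\ j | row_supp P r \subset X].
have RXP r x : r \in A -> r != i -> r != j -> x \in row_supp P r -> x \in X -> r \in RX.
  move=> rA ri rj xr xX; rewrite /RX inE; apply/andP; split; first by rewrite !inE rj ri.
  by apply/subsetP=> y yr; apply: (Xcl r x).
have Xconn x : x \in X -> connect (row_adj RX P) p x.
  rewrite inE => /connectP[s ps ->].
  elim/last_ind: s ps => [|s y IHs] //; rewrite rcons_path last_rcons => /andP[ps sy].
  apply: (connect_trans (IHs ps)); case/row_adjP: sy => r [/setD1P[rj rA] xr yr].
  have lX : last p s \in X by rewrite inE; apply/connectP; exists s.
  case: (eqVneq r i) => [ri|ri].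
    by move: xr; rewrite ri suppP1i => /andP[xi xp]; case: (XY _ lX); apply: iXY.
  rewrite !suppP1 // in xr yr.
  by apply: (connect_row (r := r)) => //; apply: RXP xr lX.
exists j; case: (set_0Vmem RX) => [RX0|[r0 r0RX]].
  have Xp x : x \in X -> x = p.
    move/Xconn; rewrite RX0 => /connectP[[|z s] //= /andP[/row_adjP[r []]]].
    by rewrite inE.
  split=> //.
    exists b'; apply/setP=> x; rewrite inE; apply/idP/eqP => [/bX/Xp//|->].
    by have [z zj] := jmeet b'; rewrite -(Xp z) //; apply: bX.
  move=> r rA pr; case: (eqVneq r i) => [->|ri]; first by left.
  case: (eqVneq r j) => [->|rj]; first by right.
  by have := RXP r p rA ri rj pr pX; rewrite RX0 inE.
exfalso.
have [sRXA [iRX jRX]] : RX \subset A /\ i \notin RX /\ j \notin RX.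
  by rewrite !inE eqxx andbF /= eqxx; split=> //; apply/subsetP=> r; rewrite !inE => /andP[/and3P[]].
have RXX r x : r \in RX -> x \in row_supp P r -> x \in X.
  by case/setIdP=> _ /subsetP; apply.
have n0X : n0 \notin X by apply/negP=> /XY/(_ n0Y).
have ij : i != j by rewrite eq_sym.
have piX x : x \in row_supp P i -> x \in X -> x = p.
  by move=> xi xX; apply/eqP/negPn/negP=> /(iXY _ xi); apply: XY.
have piX' x : x \in P i (~~ b) -> x \notin X.
  move=> xi; apply/negP=> /piX xp; apply: (dominating_disjoint D iA hpi).
  by rewrite -xp // (mem_row_supp xi).
have bY' x : x \in P j (~~ b') -> x \notin X by move/bY => xY; apply/negP=> /XY.
(* Instance obtained by collapsing the complement of X to n0. *)
have [TX [TXX pTX jTX muTX]] : exists TX : {set J}, [/\ TX \subset X, p \in TX,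
    (exists2 x, x \in P j b' & x \in TX) & #|TX| <= (mu RX P TX).+1].
  pose Q r c := if r == i then (if c == b then [set p] else [set n0])
    else if r == j then (if c == b' then P j c else [set n0]) else P r c.
  have Qi c : Q i c = if c == b then [set p] else [set n0] by rewrite /Q eqxx.
  have Qj c : Q j c = if c == b' then P j c else [set n0] by rewrite /Q eqxx (negPf ji).
  have QR r c : r \in RX -> Q r c = P r c.
    move=> rR; rewrite /Q; case: eqP => [E|_]; first by rewrite -E rR in iRX.
    by case: eqP => [E|_] //; rewrite -E rR in jRX.
  have suppQ r x : r \in RX -> (x \in row_supp Q r) = (x \in row_supp P r).
    by move=> rR; apply/row_suppP/row_suppP=> -[c]; exists c; rewrite ?QR // -QR.
  have piQ : p \in row_supp Q i by apply: (mem_row_supp (b := b)); rewrite Qi eqxx inE.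
  have niQ : n0 \in row_supp Q i.
    by apply: (mem_row_supp (b := ~~ b)); rewrite Qi (negPf nn0) inE.
  have njQ : n0 \in row_supp Q j.
    by apply: (mem_row_supp (b := ~~ b')); rewrite Qj; case: (b'); rewrite inE.
  pose A' := i |: (j |: RX).
  have RXA' k x y : k \notin RX -> connect (row_adj RX P) x y -> connect (row_adj (A' :\ k) Q) x y.
    move=> kR; apply: (connect_homo (f := id)) => {}x {}y /row_adjP[r [rR xr yr]].
    apply: (connect_row (r := r)); rewrite ?suppQ // in_setD1 !in_setU1 rR !orbT andbT.
    by apply: contraNneq kR => <-.
  have nD : ~ dominating A' Q.
    move=> DQ; have [k kS] : exists r, splits A' Q r.
      apply: IH => //.
      - apply: (entries_lt (r0 := i)) => //.
        + by rewrite !subUset !sub1set iA jA sRXA.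
        + move=> r c /setU1P[->|/setU1P[->|rR]]; last by rewrite QR.
            by rewrite Qi; case: ifP => _; rewrite cards1 side_pos.
          by rewrite Qj; case: ifP => _ //; rewrite cards1 side_pos.
        + by move=> _; exists b; rewrite Qi eqxx cards1.
        + by rewrite !inE eqxx.
      - by apply/set0Pn; exists i; rewrite !inE eqxx.
      - have s0 (x : J) : [set x] != set0 by apply/set0Pn; exists x; rewrite inE.
        move=> r c /setU1P[->|/setU1P[->|rR]].
        + by rewrite Qi; case: ifP.
        + by rewrite Qj; case: ifP => _ //; apply: ne.
        + by rewrite QR //; apply: ne; apply: (subsetP sRXA).
    have /splitsP[kA' kh] := kS; have [x xj] := jmeet b'; have xX := bX x xj.
    have xjQ : x \in row_supp Q j by apply: (mem_row_supp (b := b')); rewrite Qj eqxx.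
    case: (eqVneq k i) => [ki|ki].
      have /negP[] : ~~ connect (row_adj (A' :\ k) Q) p n0.
        by apply: (kh b); rewrite ki Qi ?eqxx ?(negPf nn0) inE.
      apply: (connect_trans (y := x)); first by apply: RXA'; rewrite ?ki //; apply: Xconn.
      by apply: (connect_row (r := j)) => //; rewrite !inE ki ji eqxx orbT.
    case: (eqVneq k j) => [kj|kj].
      have /negP[] : ~~ connect (row_adj (A' :\ k) Q) x n0.
        apply: (kh b'); rewrite kj Qj ?eqxx //.
        by case: (b'); rewrite inE.
      apply: (connect_trans (y := p)); last first.
        by apply: (connect_row (r := i)) => //; rewrite !inE kj ij eqxx.
      by rewrite connect_row_sym; apply: RXA'; rewrite ?kj //; apply: Xconn.
    have kR : k \in RX by case/setU1P: kA' => [/eqP|/setU1P[/eqP|//]]; rewrite ?(negPf ki) ?(negPf kj).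
    suff : splits A P k by apply/negP.
    apply: (splits_pullback (f := fun y => if y \in X then y else n0) (subsetP sRXA _ kR) kS); last first.
      by move=> c y yk; rewrite (RXX k) ?QR // (mem_row_supp yk).
    move=> r y z rA rk yr zr; case: (eqVneq r i) => [ri|ri].
      have E u : u \in row_supp P r -> (if u \in X then u else n0) \in row_supp Q i.
        by rewrite ri; case: ifP => // uX /piX ->.
      by apply: (connect_row (r := i)); rewrite ?E // !inE eq_sym ki eqxx.
    case: (eqVneq r j) => [rj|rj].
      have E u : u \in row_supp P r -> (if u \in X then u else n0) \in row_supp Q j.
        rewrite rj; case: ifP => // uX /row_suppP[c uc]; apply/row_suppP; exists c; rewrite Qj.
        case: eqP => // /eqP cb; have /bY' : u \in P j (~~ b') by case: (c) (b') cb uc => [] [].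
        by rewrite uX.
      by apply: (connect_row (r := j)); rewrite ?E // !inE eq_sym kj eqxx orbT.
    case: (boolP (r \in RX)) => rR.
      rewrite !(RXX r) //; apply: (connect_row (r := r)); rewrite ?suppQ //.
      by rewrite in_setD1 !in_setU1 rR rk !orbT.
    have E u : u \in row_supp P r -> (if u \in X then u else n0) = n0.
      by move=> ur; case: ifP => // uX; rewrite (RXP r u) in rR.
    by rewrite !E.
  have [S S0 Smu] := not_dominating nD; exists (S :&: X).
  have le1 : mu RX Q S <= mu RX P (S :&: X).
    apply: mu_sub => r rR m; split=> //; apply: mixed_mono m => c x; rewrite QR // => xr xS.
    by split=> //; rewrite inE xS (RXX r) // (mem_row_supp xr).
  have mi : mixed Q i S -> p \in S /\ n0 \in S.
    move=> /mixedP m; have [x] := m b; rewrite Qi eqxx inE => /eqP-> pS.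
    by have [y] := m (~~ b); rewrite Qi (negPf nn0) inE => /eqP->.
  have mj : mixed Q j S -> n0 \in S /\ exists2 x, x \in P j b' & x \in S.
    move=> /mixedP m; have [x] := m b'; rewrite Qj eqxx => xj xS; split; last by exists x.
    by have [y] := m (~~ b'); rewrite Qj; case: (b'); rewrite inE => /eqP->.
  move: Smu; rewrite mu_pair // => Smu.
  have n0SX : n0 \notin S :&: X by rewrite inE (negPf n0X) andbF.
  have leS : (n0 \in S) + #|S :&: X| <= #|S|.
    case: (boolP (n0 \in S)) => n0S; last by apply: subset_leq_card; apply: subsetIl.
    by have := cardsU1 n0 (S :&: X); rewrite n0SX => <-; apply: subset_leq_card;
      rewrite subUset sub1set n0S subsetIl.
  have Spos : 0 < #|S| by rewrite card_gt0.
  (* The rows of [RX] alone fall short of [#|S :&: X|], and mixing [i] or [j] costs the extra column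
     [n0]; so both must be mixed and the deficit is at most one. *)
  have key : mixed Q i S && mixed Q j S && (#|S :&: X| <= (mu RX P (S :&: X)).+1).
    have [[E0 E1]|lt] := mu_lt_or0 (S :&: X) sRXA.
      have ni : ~~ mixed Q i S.
        by apply/negP=> /mi[pS _]; have := in_set0 p; rewrite -E0 inE pS pX.
      have nj : ~~ mixed Q j S.
        apply/negP=> /mj[_ [x xj xS]]; have := in_set0 x; rewrite -E0 inE xS /=.
        by rewrite bX.
      by rewrite (negPf ni) (negPf nj) in Smu; move: Smu le1 E1 Spos; clear; lia.
    case: (boolP (n0 \in S)) leS => n0S leS.
      by move: Smu le1 lt leS; clear; case: (mixed Q i S); case: (mixed Q j S); lia.
    have ni : ~~ mixed Q i S by apply/negP=> /mi[_]; apply/negP.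
    have nj : ~~ mixed Q j S by apply/negP=> /mj[]; rewrite (negPf n0S).
    by rewrite (negPf ni) (negPf nj) in Smu; move: Smu le1 lt leS; clear; lia.
  case/andP: key => /andP[/mi[pS _] /mj[_ [x xj xS]]] leT; split=> //.
  - exact: subsetIr.
  - by rewrite inE pS.
  - by exists x => //; rewrite inE xS bX.
(* Instance obtained by collapsing X to p. *)
pose RO := A :\: RX :\ i :\ j.
have ROP r : r \in RO -> [/\ r \in A, r \notin RX, r != i & r != j].
  by case/setD1P=> rj /setD1P[ri /setDP[]].
have [iRO jRO] : i \notin RO /\ j \notin RO by rewrite !inE !eqxx /= andbF.
have sROA : RO \subset A by apply/subsetP=> r /ROP[].
have EA : A = i |: (j |: (RX :|: RO)).
  apply/setP=> r; apply/idP/idP => [rA|].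
    rewrite in_setU1; case: (eqVneq r i) => //= ri; rewrite in_setU1.
    case: (eqVneq r j) => //= rj; rewrite in_setU; case: (boolP (r \in RX)) => //= rR.
    by rewrite /RO !in_setD1 ri rj in_setD rR.
  by case/setU1P=> [->//|/setU1P[->//|/setUP[/(subsetP sRXA)//|/(subsetP sROA)]]].
have ROX r x : r \in RO -> x \in row_supp P r -> x \notin X.
  by case/ROP=> rA rR ri rj xr; apply: contra rR; apply: RXP xr.
have [TO [TOX iTO jTO muTO]] : exists TO : {set J}, [/\ forall x, x \in TO -> x \notin X,
    (exists2 x, x \in P i (~~ b) & x \in TO), (exists2 x, x \in P j (~~ b') & x \in TO)
    & #|TO| <= (mu RO P TO).+1].
  pose Q r c := if (r == j) && (c == b') then [set p] else P r c.
  pose A' := i |: (j |: RO).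
  have sA' : A' \subset A by rewrite !subUset !sub1set iA jA.
  have bb' : ~~ b' != b' by case: (b').
  have Qr r c : r != j -> Q r c = P r c by rewrite /Q => /negPf->.
  have QR r c : r \in RO -> Q r c = P r c by case/ROP=> *; rewrite Qr.
  have Qj : Q j b' = [set p] by rewrite /Q !eqxx.
  have Qj' : Q j (~~ b') = P j (~~ b') by rewrite /Q (negPf bb') andbF.
  have suppQ r x : r != j -> (x \in row_supp Q r) = (x \in row_supp P r).
    by move=> rj; apply/row_suppP/row_suppP=> -[c]; exists c; rewrite ?Qr // -(Qr r).
  have nD : ~ dominating A' Q.
    move=> DQ; have [k kS] : exists r, splits A' Q r.
      apply: IH => //.
      - apply: (entries_lt (r0 := r0)) => //.
        + move=> r c rA'; rewrite /Q; case: ifP => // _.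
          by rewrite cards1 side_pos //; apply: (subsetP sA').
        + exact: (subsetP sRXA).
        + case/setU1P=> [E|/setU1P[E|/ROP[_]]]; last by rewrite r0RX.
            by rewrite -E r0RX in iRX.
          by rewrite -E r0RX in jRX.
        + by exists true; apply: side_pos; apply: (subsetP sRXA).
      - by apply/set0Pn; exists i; rewrite !inE eqxx.
      - move=> r c rA'; rewrite /Q; case: ifP => // _; last by apply: ne; apply: (subsetP sA').
        by apply/set0Pn; exists p; rewrite inE.
    have /splitsP[kA' kh] := kS; have kA := subsetP sA' _ kA'.
    have fQ r c x : r \in A' -> x \in P r c -> (if x \in X then p else x) \in Q r c.
      move=> /setU1P[->|/setU1P[->|rR]] xr.
      - by rewrite Qr //; case: ifP => // /piX E; rewrite -E // (mem_row_supp xr).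
      - case: (eqVneq c b') xr => [->|cb] xr; first by rewrite (bX _ xr) Qj inE.
        have E : c = ~~ b' by case: (c) (b') cb => [] [].
        by rewrite E in xr *; rewrite (negPf (bY' _ xr)) Qj'.
      - by rewrite QR // (negPf (ROX _ _ rR (mem_row_supp xr))).
    suff : splits A P k by apply/negP.
    apply: (splits_pullback (f := fun y => if y \in X then p else y) kA kS); last first.
      by move=> c x; apply: fQ.
    move=> r x y rA rk xr yr; case: (boolP (r \in RX)) => rR; first by rewrite !(RXX r).
    have rA' : r \in A'.
      by have := rA; rewrite EA => /setU1P[->|/setU1P[->|/setUP[|h]]]; rewrite ?(negPf rR) //;
        rewrite ?in_setU1 ?eqxx ?orbT // h !orbT.
    apply: (connect_row (r := r)); first by rewrite in_setD1 rk.
      by case/row_suppP: xr => c xc; apply/row_suppP; exists c; apply: fQ.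
    by case/row_suppP: yr => c xc; apply/row_suppP; exists c; apply: fQ.
  have [S S0 Smu] := not_dominating nD; exists (S :\: X).
  have le1 : mu RO Q S <= mu RO P (S :\: X).
    apply: mu_sub => r rR m; split=> //; apply: mixed_mono m => c x; rewrite QR // => xr xS.
    by split=> //; rewrite in_setD xS (ROX r) // (mem_row_supp xr).
  have mi : mixed Q i S -> exists2 x, x \in P i (~~ b) & x \in S :\: X.
    move=> /mixedP m; have [x] := m (~~ b); rewrite Qr // => xi xS; exists x => //.
    by rewrite in_setD xS piX'.
  have mj : mixed Q j S -> p \in S /\ exists2 x, x \in P j (~~ b') & x \in S :\: X.
    move=> /mixedP m; have [x] := m b'; rewrite Qj inE => /eqP-> pS; split=> //.
    have [y] := m (~~ b'); rewrite Qj' => yj yS; exists y => //.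
    by rewrite in_setD yS bY'.
  move: Smu; rewrite mu_pair // => Smu.
  have leS : (p \in S) + #|S :\: X| <= #|S|.
    have := cardsID X S; rewrite addnC => <-; rewrite addnC leq_add2l.
    by case: (boolP (p \in S)) => // pS; rewrite card_gt0; apply/set0Pn; exists p; rewrite inE pS.
  have Spos : 0 < #|S| by rewrite card_gt0.
  have key : mixed Q i S && mixed Q j S && (#|S :\: X| <= (mu RO P (S :\: X)).+1).
    have [[E0 E1]|lt] := mu_lt_or0 (S :\: X) sROA.
      have ni : ~~ mixed Q i S by apply/negP=> /mi[x _]; rewrite E0 inE.
      have nj : ~~ mixed Q j S by apply/negP=> /mj[_ [x _]]; rewrite E0 inE.
      by rewrite (negPf ni) (negPf nj) in Smu; move: Smu le1 E1 Spos; clear; lia.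
    case: (boolP (p \in S)) leS => pS leS.
      by move: Smu le1 lt leS; clear; case: (mixed Q i S); case: (mixed Q j S); lia.
    have nj : ~~ mixed Q j S by apply/negP=> /mj[]; rewrite (negPf pS).
    rewrite (negPf nj) in Smu; exfalso.
    have sub : mixed Q i S + mu RO Q S <= mu (i |: RO) P (S :\: X).
      have <- : mu (i |: RO) Q S = mixed Q i S + mu RO Q S by rewrite !mu_sum big_setU1.
      apply: mu_sub => r rR m; split=> //; apply: mixed_mono m => c x xr xS.
      case/setU1P: rR => [ri|rR].
        move: xr; rewrite ri Qr // => xr; split=> //; rewrite in_setD xS andbT.
        by apply/negP=> /(piX _ (mem_row_supp xr)) E; rewrite -E xS in pS.
      move: xr; rewrite QR // => xr; split=> //; rewrite in_setD xS.
      by rewrite (ROX _ _ rR (mem_row_supp xr)).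
    have sA1 : i |: RO \subset A by rewrite subUset sub1set iA.
    have [[E0 E1]|lt1] := mu_lt_or0 (S :\: X) sA1; [move: E1|move: lt1];
      move: Smu sub leS Spos; clear; lia.
  by case/andP: key => /andP[/mi iT /mj[_ jT]] leT; split=> // x; rewrite in_setD => /andP[].
have T0 : TX :|: TO != set0 by apply/set0Pn; exists p; rewrite inE pTX.
have dT : [disjoint TX & TO].
  apply/pred0P=> x /=; apply/negbTE/negP=> /andP[/(subsetP TXX) xX /TOX].
  by rewrite xX.
(* Each of [TX] and [TO] lacks at most one mixed row. On the union [i] and [j] are mixed as well and
   make up for both. *)
have := D T0; rewrite {1}EA mu_pair //; last 2 first.
- by rewrite in_setU (negPf iRX).
- by rewrite in_setU (negPf jRX).
have -> : mixed P i (TX :|: TO).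
  apply/mixedP=> c; case: (eqVneq c b) => [->|cb]; first by exists p; rewrite // inE pTX.
  have -> : c = ~~ b by case: (c) (b) cb => [] [].
  by have [x x1 x2] := iTO; exists x; rewrite // inE x2 orbT.
have -> : mixed P j (TX :|: TO).
  apply/mixedP=> c; case: (eqVneq c b') => [->|cb].
    by have [x x1 x2] := jTX; exists x; rewrite // inE x2.
  have -> : c = ~~ b' by case: (c) (b') cb => [] [].
  by have [x x1 x2] := jTO; exists x; rewrite // inE x2 orbT.
rewrite mu_disjU; last first.
  by apply/pred0P=> r /=; apply/negbTE/negP=> /andP[rX /ROP[_]]; rewrite rX.
have E : #|TX :|: TO| = #|TX| + #|TO|
  by rewrite cardsU (eqP (_ : TX :&: TO == set0)) ?cards0 ?subn0 // setI_eq0.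
have l1 : mu RX P TX <= mu RX P (TX :|: TO).
  by apply: mu_sub => r rR m; split=> //; apply: mixed_mono m => c x; rewrite in_setU => -> ->.
have l2 : mu RO P TO <= mu RO P (TX :|: TO).
  by apply: mu_sub => r rR m; split=> //; apply: mixed_mono m => c x; rewrite in_setU => -> ->;
    rewrite orbT.
move: muTX muTO l1 l2; rewrite E /=; clear; lia.
Qed.


Lemma cex_empty : A = set0.
Proof.
have /fin_all_exists[side sideP] i : exists b, i \in A -> 1 < #|P i b|.
  case: (boolP (i \in A)) => [iA|_]; last by exists true.
  by have [b] := cex_big_side iA; exists b.
pose W := [set u : I * J | (u.1 \in A) && (u.2 \in P u.1 (side u.1))].
pose owner_ok (u : I * J) j := [&& j \in A, j != u.1 & [exists b, P j b == [set u.2]]].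
pose phi (u : I * J) := odflt u.1 [pick j | owner_ok u j].
have phiP u : u \in W -> owner_ok u (phi u) /\
    forall r, r \in A -> u.2 \in row_supp P r -> r = u.1 \/ r = phi u.
  rewrite inE => /andP[uA uP].
  have [j [jA ji [b' jb] jr]] := cex_private_entry uA uP (sideP _ uA).
  rewrite /phi; case: pickP => [k kok|/(_ j)] /=; last first.
    by rewrite /owner_ok jA ji /= => /existsP[]; exists b'; rewrite jb.
  split=> // r rA rp; have [->|->] := jr r rA rp; first by left.
  case/and3P: kok => kA ki /existsP[c /eqP kc].
  have uk : u.2 \in row_supp P k by apply: (mem_row_supp (b := c)); rewrite kc inE.
  by have [E|->] := jr k kA uk; [rewrite E eqxx in ki|right].
(* A row [j] recovers the pair sent to it: its one-element side must be opposite to [side j], which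
   fixes the column, and that column lies in only one row besides [j]. This bounds [#|W|] by [#|A|],
   while every chosen side contributes at least two pairs. *)
have injphi : {in W &, injective phi}.
  move=> u v uW vW E; have [/and3P[jA ju /existsP[c /eqP jc]] ur] := phiP u uW.
  have [/and3P[_ jv /existsP[d /eqP jd]] vr] := phiP v vW.
  rewrite -E in jv jd vr.
  have big := sideP _ jA.
  have cd : c = d.
    have small x y : P (phi u) x = [set y] -> x = ~~ side (phi u).
      move=> h; case: (eqVneq x (side (phi u))) => [xs|]; first by rewrite -xs h cards1 in big.
      by case: (x); case: (side _).
    by rewrite (small _ _ jc) (small _ _ jd).
  have E2 : u.2 = v.2 by apply: set1_inj; rewrite -jc -jd cd.
  have : v.1 = u.1 \/ v.1 = phi u.
    move: vW; rewrite inE => /andP[vA vP]; apply: ur => //.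
    by rewrite E2; apply: mem_row_supp vP.
  case=> [E1|E1]; first by rewrite [u]surjective_pairing [v]surjective_pairing E1 E2.
  by rewrite E1 eqxx in jv.
have leW : #|W| <= #|A|.
  rewrite -(card_in_imset injphi); apply: subset_leq_card; apply/subsetP=> _ /imsetP[u uW ->].
  by have [/and3P[]] := phiP u uW.
have : 2 * #|A| <= #|W|.
  have -> : #|W| = \sum_(i in A) #|P i (side i)|.
    transitivity (\sum_(i in A) \sum_(x in P i (side i)) 1).
      by rewrite pair_big_dep /= sum1dep_card.
    by apply: eq_bigr => i _; rewrite sum1_card.
  by rewrite mulnC -sum_nat_const; apply: leq_sum => i /sideP.
by move=> le2; apply/eqP; rewrite -cards_eq0; move: le2 leW; clear; lia.
Qed.

End MinimalCounterexample.

Theorem dominating_splits A P : A != set0 -> nonempty_sides A P -> dominating A P ->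
  exists r, splits A P r.
Proof.
have [n] := ubnP (entries A P); elim: n A P => // n IHn A P; rewrite ltnS => le A0 ne D.
have [/existsP//|/existsPn ns] := boolP [exists r, splits A P r].
case/eqP: A0; apply: cex_empty D ne _ ns => A' Q lt.
by apply: IHn; apply: leq_trans le.
Qed.

End SignedRows.

Local Open Scope ring_scope.

(** * Edge vectors and gluing *)

Section EdgeVectors.
Variables (T F : finType) (E : F -> {set T}).
Hypothesis Einj : injective E.
Hypothesis Ecard : forall f, #|E f| = 2.

Implicit Types (B C : {set F}) (w : F -> int) (v : T).

Definition erel (B : {set F}) : rel T := fun x y => [exists f in B, E f == [set x; y]].

(** The unsigned incidence map, applied to the part of [w] on [B]. For [B] the full set its kernel
    is the lattice of relations. *)
Definition bd (B : {set F}) (w : F -> int) (v : T) : int :=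
  \sum_(f in B | v \in E f) w f.

Lemma bdE B w v : bd B w v = \sum_(f in B | v \in E f) w f.
Proof. by []. Qed.

(** Signs alternate along the walk because incidence is unsigned: this is what cancels the boundary
    at interior vertices. *)
Fixpoint wv (x : T) (s : seq T) (f : F) : int :=
  if s is y :: s' then (E f == [set x; y])%:R - wv y s' f else 0.

Lemma erelP B x y : reflect (exists2 f, f \in B & E f = [set x; y]) (erel B x y).
Proof. by apply: (iffP exists_inP) => -[f fB /eqP]; exists f; rewrite // => ->. Qed.

Lemma erel_sym B : ssrbool.symmetric (erel B).
Proof. by move=> x y; apply/erelP/erelP=> -[f fB h]; exists f; rewrite // setUC. Qed.

Lemma erel_neq B x y : erel B x y -> x != y.
Proof.
case/erelP=> f _ h; have := Ecard f; rewrite h cards2.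
by case: eqP.
Qed.

Lemma erelU B B' x y : erel (B :|: B') x y = erel B x y || erel B' x y.
Proof.
apply/erelP/orP=> [[f /setUP[h|h] e]|[]/erelP[f h e]]; last 2 first.
- by exists f; rewrite // inE h.
- by exists f; rewrite // inE h orbT.
- by left; apply/erelP; exists f.
- by right; apply/erelP; exists f.
Qed.

Lemma erel_disjoint B B' x y : [disjoint B & B'] -> erel B x y -> erel B' x y = false.
Proof.
move=> d /erelP[f fB e]; apply/negbTE/negP=> /erelP[g gB e'].
have fg : f = g by apply: Einj; rewrite e.
by have := disjointFr d fB; rewrite fg gB.
Qed.

Lemma bdD B w w' v : bd B (fun f => w f + w' f) v = bd B w v + bd B w' v.
Proof. exact: big_split. Qed.

Lemma bdZ B k w v : bd B (fun f => k * w f) v = k * bd B w v.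
Proof. by rewrite /bd mulr_sumr. Qed.

Lemma bdB B w w' v : bd B (fun f => w f - w' f) v = bd B w v - bd B w' v.
Proof. by rewrite /bd sumrB. Qed.

Lemma eq_bd B w w' v : w =1 w' -> bd B w v = bd B w' v.
Proof. by move=> h; apply: eq_bigr. Qed.

Lemma bdU B B' w v : [disjoint B & B'] -> bd (B :|: B') w v = bd B w v + bd B' w v.
Proof.
move=> d; rewrite /bd !big_mkcondr /= -bigU //=.
by apply: eq_bigl => f; rewrite !inE.
Qed.

Lemma bd_supp B w v : (forall f, f \notin B -> w f = 0) -> bd setT w v = bd B w v.
Proof.
move=> h; rewrite /bd big_mkcond [RHS]big_mkcond; apply: eq_bigr => f _.
by rewrite inE; case: (boolP (f \in B)) => //= /h ->; case: ifP.
Qed.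

Lemma bd_sum (I : finType) (A : {set I}) B (c : I -> int) (b : I -> F -> int) v :
  bd B (fun f => \sum_(r in A) c r * b r f) v = \sum_(r in A) c r * bd B (b r) v.
Proof.
by rewrite /bd exchange_big /=; apply: eq_bigr => r _; rewrite mulr_sumr.
Qed.

Lemma sum_bd (U : {set T}) B w :
  \sum_(v in U) bd B w v = \sum_(f in B) w f * #|E f :&: U|%:R.
Proof.
rewrite /bd (exchange_big_dep (mem B)) /=; last by move=> v f _ /andP[].
apply: eq_bigr => f fB; rewrite -sum1_card natr_sum mulr_sumr.
by apply: eq_big => [v|v _]; rewrite ?mulr1 // !inE fB andbC.
Qed.

Lemma bd_edge B x y v :
  bd B (fun f => (E f == [set x; y])%:R) v = (erel B x y && (v \in [set x; y]))%:R.
Proof.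
rewrite /bd; case: (boolP (erel B x y)) => [/erelP[f fB e]|ne] /=.
  case: (boolP (v \in _)) => vxy; last first.
    by apply: big1 => g /andP[_ vg]; case: eqP vg vxy => [-> ->|].
  rewrite (bigD1 f) /=; last by rewrite fB e.
  rewrite e eqxx big1 ?addr0 // => g /andP[_ gf]; case: eqP => // eg.
  by case/eqP: gf; apply: Einj; rewrite e.
apply: big1 => g /andP[gB _]; case: eqP => // eg.
by case/negP: ne; apply/erelP; exists g.
Qed.

Lemma bd_wv_cons B x y s v :
  bd B (wv x (y :: s)) v = (erel B x y && (v \in [set x; y]))%:R - bd B (wv y s) v.
Proof. by rewrite -bd_edge -bdB. Qed.

Lemma bd_wv_nil B x v : bd B (wv x [::]) v = 0.
Proof. exact: big1. Qed.

Lemma bd_wv_notin B x s v : v \notin x :: s -> bd B (wv x s) v = 0.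
Proof.
elim: s x => [|y s IH] x; first by rewrite bd_wv_nil.
rewrite inE negb_or => /andP[vx vs]; rewrite bd_wv_cons IH // !inE (negPf vx).
by move: vs; rewrite inE negb_or => /andP[/negPf-> _]; rewrite andbF subr0.
Qed.

Lemma bd_wv_path B x s v : path (erel B) x s ->
  bd B (wv x s) v = (v == x)%:R - (-1) ^+ size s * (v == last x s)%:R.
Proof.
elim: s x => [|y s IH] x /=; first by rewrite bd_wv_nil; case: (v == x).
case/andP=> xy ps; rewrite bd_wv_cons xy IH // !inE exprS.
have := erel_neq xy; case: (eqVneq v x) => [->|vx]; case: (eqVneq _ y) => //= _ _; ring.
Qed.

Lemma bd_wv_disjoint B B' x s v : [disjoint B & B'] -> path (erel B') x s ->
  bd B (wv x s) v = 0.
Proof.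
move=> d; elim: s x => [|y s IH] x /=; first by rewrite bd_wv_nil.
case/andP=> xy ps; rewrite bd_wv_cons IH // subr0.
by rewrite (erel_disjoint _ xy) // disjoint_sym.
Qed.

Lemma wv_cat x s t f : wv x (s ++ t) f = wv x s f + (-1) ^+ size s * wv (last x s) t f.
Proof.
elim: s x => [|y s IH] x /=; first by rewrite add0r expr0 mul1r.
by rewrite IH exprS; ring.
Qed.

Lemma wv_supp B x s f : path (erel B) x s -> f \notin B -> wv x s f = 0.
Proof.
move=> + fB; elim: s x => [|y s IH] x //= /andP[/erelP[g gB e] /IH ->].
rewrite subr0; case: eqP => // e'; case/negP: fB.
by have -> : f = g by apply: Einj; rewrite e.
Qed.

Lemma sum_set2 (U : {set T}) x y : x != y ->
  \sum_(v in U) ((v \in [set x; y])%:R : int) = (x \in U)%:R + (y \in U)%:R.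
Proof.
move=> xy; have e1 z : \sum_(v in U) ((v == z)%:R : int) = (z \in U)%:R.
  case: (boolP (z \in U)) => zU; last first.
    by apply: big1 => v vU; case: eqP => // E0; rewrite -E0 vU in zU.
  rewrite (bigD1 z) //= eqxx big1 ?addr0 // => v /andP[_ /negPf->] //.
rewrite -!e1 -big_split /=; apply: eq_bigr => v _; rewrite !inE.
by case: (eqVneq v x) => [->|] //=; [rewrite (negPf xy) addr0|rewrite add0r].
Qed.

Lemma sum_bd_wv_cons (U : {set T}) B x y s : x != y ->
  \sum_(v in U) bd B (wv x (y :: s)) v =
  (erel B x y)%:R * ((x \in U)%:R + (y \in U)%:R) - \sum_(v in U) bd B (wv y s) v.
Proof.
move=> xy; rewrite -sum_set2 // mulr_sumr -sumrB; apply: eq_bigr => v _.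
by rewrite bd_wv_cons; case: (erel B x y); rewrite ?mul1r ?mul0r.
Qed.

(* Modulo 2, the edges of a walk lying outside B never leave U, so only
   the edges in B account for the passage from x to the last vertex. *)
Lemma walk_crossing (U : {set T}) B B' x s : path (erel (B :|: B')) x s ->
  [disjoint B & B'] ->
  (forall a b, a \in x :: s -> b \in x :: s -> erel B' a b -> (a \in U) = (b \in U)) ->
  (2 %| \sum_(v in U) bd B (wv x s) v - (x \in U)%:R - (last x s \in U)%:R)%Z.
Proof.
move=> + d; elim: s x => [|y s IH] x /=.
  by move=> _ _; rewrite big1 ?sub0r => [|v _]; rewrite ?bd_wv_nil //; case: (x \in U).
case/andP=> xy ps cl; rewrite sum_bd_wv_cons ?(erel_neq xy) //.
have {IH}h : (2 %| \sum_(v in U) bd B (wv y s) v - (y \in U)%:R - (last y s \in U)%:R)%Z.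
  by apply: IH => // a b ha hb; apply: cl; rewrite inE ?ha ?hb orbT.
have : ~~ erel B x y -> (x \in U) = (y \in U).
  move: xy; rewrite erelU => /orP[->//|xy _].
  by apply: cl; rewrite ?inE ?eqxx ?orbT.
move: (\sum_(v in U) bd B (wv y s) v) h => z h.
case: (erel B x y) => [_|/(_ isT) ->] /=; move: h;
  case: (y \in U); case: (last y s \in U); case: (x \in U); lia.
Qed.

Lemma walk_even (U : {set T}) B C x s : path (erel C) x s ->
  (forall a b, erel B a b -> (a \in U) = (b \in U)) ->
  (2 %| \sum_(v in U) bd B (wv x s) v)%Z.
Proof.
move=> + cl; elim: s x => [|y s IH] x /=.
  by move=> _; rewrite big1 // => v _; rewrite bd_wv_nil.
case/andP=> xy ps; rewrite sum_bd_wv_cons ?(erel_neq xy) //.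
have := IH _ ps; move: (\sum_(v in U) bd B (wv y s) v) => z.
case: (boolP (erel B x y)) => [/cl ->|_] /=; case: (y \in U); case: (x \in U); lia.
Qed.

(** At an interior vertex only the two neighbouring steps contribute, each by 1 or -1 if in [B] and
    by 0 otherwise. An even boundary thus means that both steps are in [B] or neither is, and the
    alternative propagates along the walk. *)
Lemma monochromatic_arc B x s z : uniq s -> x \notin s -> z \notin s ->
  (forall v, v \in s -> (2 %| bd B (wv x (rcons s z)) v)%Z) ->
  path (erel B) x (rcons s z) \/ path (fun a b => ~~ erel B a b) x (rcons s z).
Proof.
elim: s x => [|y s IH] x /=; first by case: (erel B x z); [left|right].
case/andP=> ys us; rewrite !inE !negb_or => /andP[xy xs] /andP[zy zs] h.
have {}IH := IH y us ys zs.
have /IH{IH} : forall v, v \in s -> (2 %| bd B (wv y (rcons s z)) v)%Z.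
  move=> v vs; have := h v; rewrite inE vs orbT bd_wv_cons => /(_ isT).
  have -> : v \in [set x; y] = false.
    by rewrite !inE; apply/negbTE; rewrite negb_or; apply/andP; split; apply: contraTneq vs => ->.
  by rewrite andbF; move: (bd B (wv y (rcons s z)) v) => u; clear; lia.
have := h y; rewrite inE eqxx => /(_ isT).
rewrite bd_wv_cons !inE eqxx orbT andbT.
set u := head z s; set t := behead (rcons s z).
have E0 : rcons s z = u :: t by rewrite /u /t; case: (s).
have yu : y != u.
  rewrite /u; case: (s) ys => [|a s'] /=; first by rewrite eq_sym.
  by rewrite inE negb_or => /andP[].
have yt : y \notin u :: t.
  by rewrite -E0 mem_rcons inE negb_or eq_sym zy.
rewrite E0 bd_wv_cons bd_wv_notin // !inE eqxx /= subr0.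
by case: (erel B x y); case: (erel B y u) => //= h1 [] //= h2; (try by left); (try by right); lia.
Qed.

End EdgeVectors.

Lemma one_not_even (x : int) : 2 - 2 * x = 0 -> ~ (2 %| x)%Z.
Proof. lia. Qed.

(** * Odd cycles in an edge set glued from two parts along one degree *)

Section Gluing.
Variables (T F : finType) (E : F -> {set T}).
Hypothesis Einj : injective E.
Hypothesis Ecard : forall f, #|E f| = 2.
Local Notation erel := (erel E).
Local Notation bd := (bd E).
Local Notation wv := (wv E).

Definition chordless_in (c : seq T) := forall x y f, x \in c -> y \in c ->
  E f = [set x; y] -> y = next c x \/ x = next c y.

(** The part of biconnectivity that survives the descent. The end points of the walk must differ
    from [v] too, which is possible as [v] cannot exhaust a cycle. *)
Definition avoiding_walks (C : {set F}) (c1 c2 : seq T) := forall v, exists x s,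
  [/\ x \in c1, path (erel C) x s, last x s \in c2 & v \notin x :: s].

Definition two_linked (C : {set F}) (c1 c2 : seq T) :=
  [/\ cycle (erel C) c1, cycle (erel C) c2 & avoiding_walks C c1 c2].

(** The first odd loop has boundary 2 at [p]; the doubled walk [Q] transports it to [last p Q], up
    to a sign given by the parity of [Q], and the second odd loop cancels it there. *)
Definition loops_join p s1 Q s2 (f : F) : int :=
  wv p (rcons s1 p) f - 2 * wv p Q f
  - (-1) ^+ size Q * wv (last p Q) (rcons s2 (last p Q)) f.

Lemma bd_loops_join B p s1 Q s2 v : bd B (loops_join p s1 Q s2) v =
  bd B (wv p (rcons s1 p)) v - 2 * bd B (wv p Q) v
  - (-1) ^+ size Q * bd B (wv (last p Q) (rcons s2 (last p Q))) v.
Proof. by rewrite /loops_join bdB bdB !bdZ. Qed.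

Lemma bd_odd_loop B p s v : path (erel B) p (rcons s p) -> odd (size (p :: s)) ->
  bd B (wv p (rcons s p)) v = 2 * (v == p)%:R.
Proof.
move=> ps /= os; rewrite bd_wv_path // last_rcons size_rcons exprS -signr_odd.
by rewrite (negPf os) expr0; ring.
Qed.

Lemma bd_loops_join_closed B p s1 Q s2 v :
  path (erel B) p (rcons s1 p) -> path (erel B) p Q ->
  path (erel B) (last p Q) (rcons s2 (last p Q)) ->
  odd (size (p :: s1)) -> odd (size (last p Q :: s2)) ->
  bd B (loops_join p s1 Q s2) v = 0.
Proof.
move=> p1 pQ p2 o1 o2; rewrite bd_loops_join !bd_odd_loop // bd_wv_path //.
by rewrite -signr_odd; case: (v == p); case: (v == last p Q); case: (odd (size Q)).
Qed.

Lemma cycle_closed (c : seq T) (R : rel T) (S : {set T}) z :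
  cycle R c -> z \in c -> z \in S ->
  (forall x y, x \in S -> R x y -> y \in S) -> forall x, x \in c -> x \in S.
Proof.
move=> cyc zc zS cl x xc.
have [i s Ei] := rot_to zc; move: cyc xc; rewrite -(rot_cycle i) -(mem_rot i) Ei /=.
rewrite rcons_path inE => /andP[ps _] /orP[/eqP->//|].
by elim: s z zS ps {zc Ei} => //= y s IH z zS /andP[/(cl _ _ zS) yS /IH]; rewrite inE => h /orP[/eqP->//|]; apply: h.
Qed.

Lemma next_map (c : seq T) : uniq c -> perm_eq (map (next c) c) c.
Proof.
move=> uc; apply: uniq_perm => //.
  by rewrite map_inj_in_uniq // => x y _ _; apply: (can_inj (prev_next uc)).
move=> x; apply/mapP/idP => [[y yc ->]|xc]; first by rewrite mem_next.
by exists (prev c x); rewrite ?mem_prev // next_prev.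
Qed.

Lemma odd_cycle_not_alternating (c : seq T) (chi : pred T) : uniq c -> odd (size c) ->
  ~ (forall x, x \in c -> chi (next c x) = ~~ chi x).
Proof.
move=> uc oc h; have := count_predC chi c.
have -> : count chi c = count (predC chi) c.
  rewrite -(permP (next_map uc) chi) count_map.
  by apply: eq_in_count => x /h /= ->.
by rewrite addnn => E0; rewrite -E0 odd_double in oc.
Qed.

Section Step.
Variables (B1 B2 : {set F}) (a1 a2 : F -> int) (c1 c2 : seq T).
Hypothesis dB : [disjoint B1 & B2].
Hypothesis a1_ge0 : forall f, 0 <= a1 f.
Hypothesis a2_ge0 : forall f, 0 <= a2 f.
Hypothesis glue_eq : forall v, bd B1 a1 v = bd B2 a2 v.
Hypothesis glue_neq0 : exists v, bd B1 a1 v != 0.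
Local Notation C := (B1 :|: B2).
Hypothesis glue_gen : forall w : F -> int, (forall f, f \notin C -> w f = 0) ->
  (forall v, bd setT w v = 0) -> exists k : int, forall v, bd B1 w v = k * bd B1 a1 v.
Hypotheses (uc1 : uniq c1) (uc2 : uniq c2) (oc1 : odd (size c1)) (oc2 : odd (size c2)).
Hypothesis dc : forall x, x \in c1 -> x \in c2 -> False.
Hypotheses (ch1 : chordless_in c1) (ch2 : chordless_in c2).
Hypothesis nocross : forall x y f, x \in c1 -> y \in c2 -> E f <> [set x; y].
Hypothesis link : two_linked C c1 c2.

Lemma pos_bd_edge B a z : (forall f, 0 <= a f) -> bd B a z != 0 ->
  exists f, [/\ f \in B, z \in E f & forall u, u \in E f -> bd B a u != 0].
Proof.
move=> a0 hz; have /existsP[f /and3P[fB zf af]] : [exists f, [&& f \in B, z \in E f & a f != 0]].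
  apply: contraNT hz => /existsPn h; apply/eqP; apply: big1 => f /andP[fB zf].
  by have := h f; rewrite fB zf /= negbK => /eqP.
exists f; split=> // u uf; rewrite bdE (bigD1 f) /=; last by rewrite fB.
rewrite gt_eqF // ltr_pwDl //; first by rewrite lt_neqAle eq_sym af a0.
by apply: sumr_ge0.
Qed.

Lemma glue_edge1 z : bd B1 a1 z != 0 ->
  exists z' f, [/\ f \in B1, E f = [set z; z'] & bd B1 a1 z' != 0].
Proof.
move/(pos_bd_edge a1_ge0) => [f [fB zf h]].
have /eqP/cards2P[x [y [xy Exy]]] := Ecard f.
move: zf; rewrite Exy !inE => /orP[]/eqP->.
  by exists y, f; split=> //; apply: h; rewrite Exy !inE eqxx orbT.
by exists x, f; split=> //; [rewrite setUC|apply: h; rewrite Exy !inE eqxx].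
Qed.

Lemma glue_edge2 z : bd B1 a1 z != 0 ->
  exists z' f, [/\ f \in B2, E f = [set z; z'] & bd B1 a1 z' != 0].
Proof.
rewrite glue_eq => /(pos_bd_edge a2_ge0) [f [fB zf h]].
have /eqP/cards2P[x [y [xy Exy]]] := Ecard f.
move: zf; rewrite Exy !inE => /orP[]/eqP->.
  by exists y, f; split=> //; rewrite glue_eq; apply: h; rewrite Exy !inE eqxx orbT.
exists x, f; split=> //; first by rewrite setUC.
by rewrite glue_eq; apply: h; rewrite Exy !inE eqxx.
Qed.

(* Inside an isolated chordless odd cycle, each vertex of the support of the glued
   degree carries one edge of each colour, so the colours would alternate. *)
Lemma glue_support_cycle (c c' : seq T) z : uniq c -> odd (size c) -> chordless_in c ->
  (forall x y f, x \in c -> y \in c' -> E f <> [set x; y]) ->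
  (forall x, bd B1 a1 x != 0 -> x \in c \/ x \in c') ->
  z \in c -> bd B1 a1 z != 0 -> False.
Proof.
move=> uc oc ch nc supp zc hz.
have step x : x \in c -> bd B1 a1 x != 0 ->
    bd B1 a1 (next c x) != 0 /\ erel B1 x (next c x) = ~~ erel B1 (prev c x) x.
  move=> xc hx; have [y [f [fB Ef hy]]] := glue_edge1 hx.
  have [t [g [gB Eg ht]]] := glue_edge2 hx.
  have yc : y \in c by have [//|yc'] := supp _ hy; case: (nc x y f).
  have tc : t \in c by have [//|tc'] := supp _ ht; case: (nc x t g).
  have ty : t != y.
    apply/eqP=> ty; have fg : f = g by apply: Einj; rewrite Ef Eg ty.
    by have := disjointFr dB fB; rewrite fg gB.
  have exy : erel B1 x y by apply/erelP; exists f.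
  have ext : erel B2 x t by apply/erelP; exists g.
  have ext1 : erel B1 x t = false.
    by apply: (erel_disjoint Einj _ ext); rewrite disjoint_sym.
  have pN u : x = next c u -> u \in c -> u = prev c x by move=> -> uc'; rewrite prev_next.
  have [yE|yE] := ch _ _ _ xc yc Ef; have [tE|tE] := ch _ _ _ xc tc Eg.
  - by rewrite yE tE eqxx in ty.
  - split; first by rewrite -yE.
    by rewrite -(pN _ tE tc) -yE exy erel_sym ext1.
  - split; first by rewrite -tE.
    by rewrite -(pN _ yE yc) -tE ext1 erel_sym exy.
  - by rewrite (pN _ yE yc) (pN _ tE tc) eqxx in ty.
have all_c : forall x, x \in c -> x \in [set y | bd B1 a1 y != 0 & y \in c].
  apply: (cycle_closed (cycle_next uc) zc); first by rewrite inE hz.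
  move=> x y; rewrite !inE => /andP[hx xc] /eqP <-; rewrite mem_next xc andbT.
  by have [] := step x xc hx.
apply: (odd_cycle_not_alternating (chi := fun x => erel B1 (prev c x) x) uc oc) => x xc.
have := all_c x xc; rewrite inE => /andP[hx _].
by rewrite prev_next //; have [_ ->] := step x xc hx.
Qed.

(** By [glue_support_cycle] the common degree [bd B1 a1] is nonzero at some [z] off both cycles.
    With a walk avoiding [z] the whole join misses [z], so the multiple of [bd B1 a1] provided by
    [glue_gen] vanishes at [z] and is therefore the zero multiple. *)
Lemma exists_null_join : exists p s1 Q s2, [/\ exists i, rot i c1 = p :: s1,
  exists j, rot j c2 = last p Q :: s2, path (erel C) p Q &
  forall v, bd B1 (loops_join p s1 Q s2) v = 0].
Proof.
have [cy1 cy2 av] := link.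
have [/existsP[z /and3P[hz z1 z2]]|] :=
    boolP [exists z, [&& bd B1 a1 z != 0, z \notin c1 & z \notin c2]]; last first.
  move=> /existsPn h; exfalso; have [z hz] := glue_neq0.
  have supp x : bd B1 a1 x != 0 -> x \in c1 \/ x \in c2.
    move=> hx; have := h x; rewrite hx /= negb_and !negbK => /orP[]; by [left|right].
  have [z1|z2] := supp z hz.
    exact: (glue_support_cycle uc1 oc1 ch1 nocross supp z1 hz).
  apply: (glue_support_cycle uc2 oc2 ch2 _ _ z2 hz (c' := c1)).
    by move=> x y f xc yc; rewrite setUC; apply: nocross.
  by move=> x /supp []; [right|left].
have [p [Q [pc pQ qc zQ]]] := av z.
have [i s1 Ei] := rot_to pc; have [j s2 Ej] := rot_to qc.
exists p, s1, Q, s2; split; [by exists i|by exists j|by []|].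
have p1 : path (erel C) p (rcons s1 p) by move: cy1; rewrite -(rot_cycle i) Ei.
have p2 : path (erel C) (last p Q) (rcons s2 (last p Q)) by move: cy2; rewrite -(rot_cycle j) Ej.
have zn : bd B1 (loops_join p s1 Q s2) z = 0.
  rewrite bd_loops_join !bd_wv_notin ?mulr0 ?subrr //.
    by rewrite inE mem_rcons orbA orbb -[_ || _]/(z \in last p Q :: s2) -Ej mem_rot.
  by rewrite inE mem_rcons orbA orbb -[_ || _]/(z \in p :: s1) -Ei mem_rot.
have [k hk] : exists k, forall v, bd B1 (loops_join p s1 Q s2) v = k * bd B1 a1 v.
  apply: glue_gen => [f fC|v].
    by rewrite /loops_join !(wv_supp Einj _ fC) // !mulr0 !subr0.
  have supp f : f \notin C -> loops_join p s1 Q s2 f = 0.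
    by move=> fC; rewrite /loops_join !(wv_supp Einj _ fC) // !mulr0 !subr0.
  rewrite (bd_supp _ _ supp) bd_loops_join_closed //; first by rewrite -Ei size_rot.
  by rewrite -Ej size_rot.
move=> v; rewrite hk; move/eqP: zn; rewrite hk mulf_eq0 (negPf hz) orbF => /eqP->.
by rewrite mul0r.
Qed.

Lemma rot_loop_path (R : rel T) i (c : seq T) p s : rot i c = p :: s ->
  path R p (rcons s p) = cycle R c.
Proof. by move=> Ei; rewrite -(rot_cycle i) Ei. Qed.

Lemma colour_of_cycle c p s i : uniq c -> cycle (erel C) c -> rot i c = p :: s ->
  (forall v, v \in s -> (2 %| bd B1 (wv p (rcons s p)) v)%Z) ->
  cycle (erel B1) c \/ cycle (erel B2) c.
Proof.
move=> uc cyc Ei h.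
have /andP[ps us] : uniq (p :: s) by rewrite -Ei rot_uniq.
have [m|m] := monochromatic_arc Einj us ps ps h.
  by left; rewrite -(rot_loop_path _ Ei).
right; rewrite -(rot_loop_path _ Ei).
have : path (erel C) p (rcons s p) by rewrite (rot_loop_path _ Ei).
suff gen t x : path (fun a b => ~~ erel B1 a b) x t -> path (erel C) x t -> path (erel B2) x t.
  exact: gen.
elim: t x => //= y t IH x /andP[n1 n2]; rewrite erelU (negPf n1) /=.
by case/andP=> -> /(IH _ n2).
Qed.

Lemma rot_disj i j p s1 q s2 : rot i c1 = p :: s1 -> rot j c2 = q :: s2 ->
  (forall v, v \in p :: s1 -> v \notin q :: rcons s2 q) /\
  (forall v, v \in q :: s2 -> v \notin p :: rcons s1 p).
Proof.
move=> E1 E2; split=> v; rewrite !inE mem_rcons orbA orbb.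
  by rewrite -in_cons -E1 -in_cons -E2 !mem_rot => h; apply/negP; apply: dc.
by rewrite -in_cons -E2 -in_cons -E1 !mem_rot => h; apply/negP=> h'; apply: (dc h').
Qed.

(** At a vertex of [c1] the second loop is absent, so the [B1]-boundary of the first loop equals
    twice that of the walk. It is even, and the cycle is monochromatic. *)
Lemma glue_colour1 : cycle (erel B1) c1 \/ cycle (erel B2) c1.
Proof.
have [p [s1 [Q [s2 [[i Ei] [j Ej] pQ h]]]]] := exists_null_join; have [cy1 _ _] := link.
apply: (colour_of_cycle uc1 cy1 Ei) => v vs.
have v2 : v \notin last p Q :: rcons s2 (last p Q).
  by apply: (rot_disj Ei Ej).1; rewrite inE vs orbT.
have := h v; rewrite bd_loops_join (bd_wv_notin Einj B1 v2) mulr0 subr0;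
by move: (bd B1 _ v) (bd B1 _ v) => x y; clear; lia.
Qed.

Lemma glue_colour2 : cycle (erel B1) c2 \/ cycle (erel B2) c2.
Proof.
have [p [s1 [Q [s2 [[i Ei] [j Ej] pQ h]]]]] := exists_null_join; have [_ cy2 _] := link.
apply: (colour_of_cycle uc2 cy2 Ej) => v vs.
have v2 : v \notin p :: rcons s1 p.
  by apply: (rot_disj Ei Ej).2; rewrite inE vs orbT.
have := h v; rewrite bd_loops_join (bd_wv_notin Einj B1 v2) -signr_odd.
set u := bd B1 (wv (last p Q) _) v; move: u (bd B1 (wv p Q) v) => u x.
by case: (odd _); rewrite ?expr0 ?expr1; clear; lia.
Qed.

(** Sum the zero boundary of a null join over the [B1]-component [U] of [p]. The first loop gives 2
    and the doubled walk a multiple of 4, so the second loop has to contribute: it lies in [B1] and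
    its base point in [U]. *)
Lemma glue_connected : cycle (erel B1) c1 -> cycle (erel B1) c2 /\
  exists p q, [/\ p \in c1, q \in c2 & connect (erel B1) p q].
Proof.
move=> m1.
have [p [s1 [Q [s2 [[i Ei] [j Ej] pQ h]]]]] := exists_null_join; have [cy1 cy2 _] := link.
pose q := last p Q.
pose U := [set v | connect (erel B1) p v].
have pU : p \in U by rewrite inE.
have Ucl a b : erel B1 a b -> (a \in U) = (b \in U).
  move=> ab; rewrite !inE; apply/idP/idP => /connect_trans; apply; apply: connect1 => //.
  by rewrite erel_sym.
have o1 : odd (size (p :: s1)) by rewrite -Ei size_rot.
have o2 : odd (size (q :: s2)) by rewrite -Ej size_rot.
have := walk_even Einj Ecard pQ Ucl.
have sum0 : \sum_(v in U) bd B1 (loops_join p s1 Q s2) v = 0 by apply: big1.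
move: sum0; under eq_bigr => v _ do rewrite bd_loops_join.
rewrite sumrB sumrB -!mulr_sumr.
have sumd z : \sum_(v in U) ((v == z)%:R : int) = (z \in U)%:R.
  case: (boolP (z \in U)) => zU; last first.
    by apply: big1 => v vU; case: eqP => // E0; rewrite -E0 vU in zU.
  by rewrite (bigD1 z) //= eqxx big1 ?addr0 // => v /andP[_ /negPf->].
have -> : \sum_(v in U) bd B1 (wv p (rcons s1 p)) v = 2.
  under eq_bigr => v _ do rewrite (bd_odd_loop _ _ o1) ?(rot_loop_path _ Ei) //.
  by rewrite -mulr_sumr sumd pU.
have [m2|m2] := glue_colour2.
  have [qU _ _|qU] := boolP (q \in U).
    split=> //; exists p, q; split; last by rewrite inE in qU.
      by rewrite -(mem_rot i) Ei inE eqxx.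
    by rewrite -(mem_rot j) Ej inE eqxx.
  have -> : \sum_(v in U) bd B1 (wv (last p Q) (rcons s2 (last p Q))) v = 0.
    under eq_bigr => v _ do rewrite (bd_odd_loop _ _ o2) ?(rot_loop_path _ Ej) //.
    by rewrite -mulr_sumr sumd (negPf qU).
  by rewrite mulr0 subr0 => /one_not_even.
have -> : \sum_(v in U) bd B1 (wv (last p Q) (rcons s2 (last p Q))) v = 0.
  apply: big1 => v _; apply: (bd_wv_disjoint Einj _ dB).
  by rewrite (rot_loop_path _ Ej).
by rewrite mulr0 subr0 => /one_not_even.
Qed.

Lemma cycle_connected c x y : cycle (erel B1) c -> x \in c -> y \in c ->
  connect (erel B1) x y.
Proof.
move=> cyc xc yc; suff : y \in [set y | connect (erel B1) x y] by rewrite inE.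
apply: (cycle_closed cyc xc) => //; first by rewrite inE.
by move=> a b; rewrite !inE => h /connect1; apply: connect_trans.
Qed.

(** Take a walk in [C] avoiding [z], with vertex set [V]. If its ends are joined by [B1]-edges
    inside [V], that connection avoids [z]. If not, close the walk up inside [B1] to a relation; its
    [B2]-boundary is then a multiple of [alpha = bd B1 a1] whose sum over the component [U] of [x]
    in [V] is odd, whereas [alpha], being a sum of [B1]-edges within [V], has an even sum over
    [U]. *)
Lemma glue_two_linked : cycle (erel B1) c1 -> two_linked B1 c1 c2.
Proof.
move=> m1; have [m2 [p [q [pc qc pq]]]] := glue_connected m1.
have [_ _ av] := link; split=> // z.
have [x [s [xc ps lc zs]]] := av z.
pose V := x :: s; pose R a b := [&& erel B1 a b, a \in V & b \in V].
have Rsym : ssrbool.symmetric R by move=> a b; rewrite /R erel_sym [(a \in _) && _]andbC.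
have csym : connect_sym R by apply: sym_connect_sym.
pose U := [set u | connect R x u].
have [|lU] := boolP (last x s \in U).
  rewrite inE => /connectP[t pt lt]; exists x, t; split=> //.
  - by apply: sub_path pt => a b /and3P[].
  - by rewrite -lt.
  - have : all (mem V) t.
      by elim: t (x) pt {lt} => //= b t IH a /andP[/and3P[_ _ ->] /IH].
    move/allP=> tV; rewrite inE negb_or; apply/andP; split.
      by move: zs; rewrite inE negb_or => /andP[].
    by apply: contra zs => /tV.
exfalso.
have [t pt lt] : exists2 t, path (erel B1) (last x s) t & last (last x s) t = x.
  have : connect (erel B1) (last x s) x.
    apply: connect_trans (cycle_connected m2 lc qc) _.
    apply: connect_trans (cycle_connected m1 pc xc).
    by rewrite (sym_connect_sym (@erel_sym _ _ E B1)).
  by case/connectP=> t; exists t.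
(* Only a closed walk of even length has boundary zero; one more turn around the odd cycle [c1]
   corrects the parity without leaving [B1]. *)
have [t' pt' [lt' ev]] : exists2 t', path (erel B1) (last x s) t' &
    last (last x s) t' = x /\ ~~ odd (size (s ++ t')).
  have [o|o] := boolP (odd (size (s ++ t))); last by exists t.
  have [i s1 Ei] := rot_to xc; exists (t ++ rcons s1 x).
    by rewrite cat_path pt lt (rot_loop_path _ Ei).
  split; first by rewrite last_cat last_rcons.
  have os : odd (size (x :: s1)) by rewrite -Ei size_rot.
  by rewrite catA size_cat oddD o size_rcons -[(size s1).+1]/(size (x :: s1)) os.
pose w := wv x (s ++ t').
have ptC : path (erel C) (last x s) t'.
  by apply: sub_path pt' => a b; rewrite erelU => ->.
have pw : path (erel C) x (s ++ t') by rewrite cat_path ps.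
have wsupp f : f \notin C -> w f = 0 by apply: wv_supp pw.
have wcl v : bd C w v = 0.
  rewrite bd_wv_path // last_cat lt' -signr_odd (negPf ev) expr0 mul1r subrr //.
have [k hk] : exists k, forall v, bd B1 w v = k * bd B1 a1 v.
  by apply: glue_gen => // v; rewrite (bd_supp _ _ wsupp).
have b2 v : bd B2 (wv x s) v = - k * bd B1 a1 v.
  have := wcl v; rewrite bdU // hk.
  have -> : bd B2 w v = bd B2 (wv x s) v.
    rewrite (eq_bd _ _ _ (wv_cat _ _ _ _)) bdD bdZ [X in _ * X](bd_wv_disjoint Einj _ _ pt').
      by rewrite mulr0 addr0.
    by rewrite disjoint_sym.
  by rewrite mulNr => /eqP; rewrite addrC addr_eq0 => /eqP.
have UclV a b : a \in V -> b \in V -> erel B1 a b -> (a \in U) = (b \in U).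
  move=> aV bV ab; have rab : R a b by rewrite /R ab aV.
  rewrite !inE; apply/idP/idP => /connect_trans; apply; apply: connect1 => //.
  by rewrite Rsym.
have cross : (2 %| \sum_(v in U) bd B2 (wv x s) v - (x \in U)%:R - (last x s \in U)%:R)%Z.
  by apply: (@walk_crossing _ _ _ Einj Ecard U B2 B1) => //; rewrite 1?setUC // disjoint_sym.
rewrite (negPf lU) inE connect0 in cross.
move: cross; under eq_bigr => v _ do rewrite b2.
rewrite -mulr_sumr => cross.
have k0 : k != 0 by apply: contraTneq cross => ->; rewrite oppr0 mul0r.
(* The return walk lies in [B1], so the [B2]-boundary comes from [x :: s] alone and vanishes off
   [V]; as [k] is nonzero, so does [alpha]. *)
have suppV u : bd B1 a1 u != 0 -> u \in V.
  apply: contraNT => uV; have := bd_wv_notin Einj B2 uV; rewrite b2 mulNr => /eqP.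
  by rewrite oppr_eq0 mulf_eq0 (negPf k0).
have : (2 %| \sum_(v in U) bd B1 a1 v)%Z.
  rewrite sum_bd; apply: rpred_sum => f fB.
  have [->|af] := eqVneq (a1 f) 0; first by rewrite mul0r.
  suff : (2 %| (#|E f :&: U|%:R : int))%Z by move=> h; apply: dvdz_mull.
  have fsupp u : u \in E f -> u \in V.
    move=> uf; apply: suppV; rewrite bdE (bigD1 f) /=; last by rewrite fB.
    rewrite gt_eqF // ltr_pwDl //; first by rewrite lt_neqAle eq_sym af a1_ge0.
    by apply: sumr_ge0.
  have /eqP/cards2P[a [b [ab Eab]]] := Ecard f.
  have rab : erel B1 a b by apply/erelP; exists f.
  have abU : (a \in U) = (b \in U).
    by apply: UclV => //; apply: fsupp; rewrite Eab !inE eqxx ?orbT.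
  rewrite Eab.
  have [aU|aU] := boolP (a \in U).
    have -> : [set a; b] :&: U = [set a; b].
      by apply/setIidPl; rewrite subUset !sub1set -abU aU.
    by rewrite cards2 ab.
  have -> : [set a; b] :&: U = set0; last by rewrite cards0.
  by apply/eqP; rewrite setI_eq0 disjoints_subset subUset !sub1set !in_setC -abU aU.
move/(dvdz_mull (- k)) => h2.
have : (2 %| (- k * \sum_(v in U) bd B1 a1 v) -
     (- k * \sum_(v in U) bd B1 a1 v - true%:R - false%:R))%Z by apply: rpredB.
by rewrite subr0 opprB addrC subrK.
Qed.

End Step.
End Gluing.

(** * Infinite descent through splitting rows *)

Section Descent.
Variables (T F I : finType) (E : F -> {set T}).
Hypothesis Einj : injective E.
Hypothesis Ecard : forall f, #|E f| = 2.
Local Notation erel := (erel E).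
Local Notation bd := (bd E).
Local Notation wv := (wv E).
Variable b : I -> F -> int.

Definition sign_side r (c : bool) := [set f | if c then 0 < b r f else b r f < 0].

Definition rows_generate (B : {set F}) (A : {set I}) :=
  (forall r f, r \in A -> f \notin B -> b r f = 0) /\
  (forall w : F -> int, (forall f, f \notin B -> w f = 0) -> (forall v, bd setT w v = 0) ->
     exists c : I -> int, forall f, w f = \sum_(r in A) c r * b r f).

Hypothesis rows_bd : forall r v, bd setT (b r) v = 0.
Hypothesis rows_sides : nonempty_sides setT sign_side.
Hypothesis rows_dom : dominating setT sign_side.
Variables (c1 c2 : seq T).
Hypotheses (uc1 : uniq c1) (uc2 : uniq c2) (oc1 : odd (size c1)) (oc2 : odd (size c2)).
Hypothesis sc1 : (2 < size c1)%N.
Hypothesis dc : forall x, x \in c1 -> x \in c2 -> False.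
Hypotheses (ch1 : chordless_in E c1) (ch2 : chordless_in E c2).
Hypothesis nocross : forall x y f, x \in c1 -> y \in c2 -> E f <> [set x; y].

Lemma row_supp_sign r f : (f \in row_supp sign_side r) = (b r f != 0).
Proof.
apply/row_suppP/idP => [[[]]|h]; rewrite ?inE; [by move/gt_eqF->|by move/lt_eqF->|].
by case: (ltgtP (b r f) 0) h => // h _; [exists false|exists true]; rewrite inE.
Qed.

(** Without rows the join of the two cycles would be the zero vector. Its restriction to a single
    edge [f] of [c1] then makes the parity test of [monochromatic_arc] apply with [[set f]] in place
    of [B]: all edges of [c1] would equal [f], or none. *)
Lemma rows_generate_neq0 B A : rows_generate B A -> two_linked E B c1 c2 -> A != set0.
Proof.
move=> [_ gen] [cy1 cy2 av]; apply/eqP=> A0.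
have [z [p' [s' Ec1]]] : exists z p s', c1 = z :: p :: s'.
  by case: (c1) sc1 => [|x [|y s]] // _; exists x, y, s.
have [p [Q [pc pQ qc _]]] := av z.
have [i s1 Ei] := rot_to pc; have [j s2 Ej] := rot_to qc.
have p1 : path (erel B) p (rcons s1 p) by rewrite (rot_loop_path _ Ei).
have p2 : path (erel B) (last p Q) (rcons s2 (last p Q)) by rewrite (rot_loop_path _ Ej).
have supp f : f \notin B -> loops_join E p s1 Q s2 f = 0.
  by move=> fC; rewrite /loops_join !(wv_supp Einj _ fC) // !mulr0 !subr0.
have w0 f : loops_join E p s1 Q s2 f = 0.
  have o1 : odd (size (p :: s1)) by rewrite -Ei size_rot.
  have o2 : odd (size (last p Q :: s2)) by rewrite -Ej size_rot.
  have [c ->] := gen _ supp (fun v => etrans (bd_supp E v supp)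
    (bd_loops_join_closed Einj Ecard v p1 pQ p2 o1 o2)).
  by rewrite A0 big_set0.
have us : uniq (p :: s1) by rewrite -Ei rot_uniq.
have ss : (2 < size (p :: s1))%N by rewrite -Ei size_rot.
case: s1 us ss Ei p1 w0 {supp} => [|y [|y' s1]] // us _ Ei /= /and3P[/erelP[f fB Ef] _ _] w0.
have h v : v \in y :: y' :: s1 ->
    (2 %| bd [set f] (wv p (rcons (y :: y' :: s1) p)) v)%Z.
  move=> vs; have v2 : v \notin last p Q :: rcons s2 (last p Q).
    by apply: (rot_disj dc Ei Ej).1; rewrite inE vs orbT.
  have : bd [set f] (loops_join E p (y :: y' :: s1) Q s2) v = 0 by apply: big1.
  rewrite bd_loops_join (bd_wv_notin Einj _ v2) mulr0 subr0 => /eqP; rewrite subr_eq0 => /eqP->.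
  exact: dvdz_mulr.
have [pn un] : p \notin y :: y' :: s1 /\ uniq (y :: y' :: s1).
  by move: us; rewrite cons_uniq => /andP[].
have [|] := monochromatic_arc Einj un pn pn h.
  case/and3P=> _ /erelP[g + Eg] _; rewrite inE => /eqP gf.
  have : p \in E g by rewrite gf Ef !inE eqxx.
  by rewrite Eg; apply/negP; move: pn; rewrite !inE !negb_or => /and3P[-> ->].
by case/and3P=> /negP[]; apply/erelP; exists f; rewrite // inE.
Qed.

Theorem not_two_linked B A : rows_generate B A -> two_linked E B c1 c2 -> False.
Proof.
have [n] := ubnP #|B|; elim: n B A => // n IHn B A; rewrite ltnS => leB gen link.
have A0 := rows_generate_neq0 gen link; have [suppA genA] := gen.
have [r0 r0S] : exists r, splits A sign_side r.
  apply: dominating_splits => //; first by move=> r c _; apply: rows_sides.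
  exact: dominating_sub rows_dom (subsetT _) _.
have /splitsP[r0A r0h] := r0S.
pose adj := row_adj (A :\ r0) sign_side.
(* [B1] is what the other rows reach from the positive side of [r0]. Edges reached from neither side
   go to [B2]; [r0] vanishes on them, so the sign conditions still hold. *)
pose B1 := [set f in B | [exists p in sign_side r0 true, connect adj p f]].
pose B2 := B :\: B1.
have dB : [disjoint B1 & B2] by rewrite -setI_eq0 /B2 setDE setICA setICr setI0.
have BE : B1 :|: B2 = B.
  by apply/setP=> f; rewrite !inE; case: (f \in B) => //=; rewrite ?andbT ?orbN.
have B1cl r f g : r \in A -> r != r0 -> b r f != 0 -> b r g != 0 -> f \in B1 -> g \in B1.
  move=> rA rr; rewrite -!row_supp_sign => hf hg; rewrite !inE => /andP[fB /existsP[p /andP[pp pf]]].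
  apply/andP; split.
    by apply: contraLR hg => gB; rewrite row_supp_sign suppA ?eqxx.
  apply/existsP; exists p; rewrite pp; apply: (connect_row_closed _ hf hg pf).
  by rewrite !inE rr.
have r0pos f : f \in B1 -> 0 <= b r0 f.
  rewrite inE => /andP[_ /existsP[p /andP[pp pf]]]; rewrite leNgt; apply/negP=> lt.
  have fs : f \in sign_side r0 false by rewrite inE.
  by case/negP: (r0h true p f pp fs).
have r0neg f : f \in B2 -> b r0 f <= 0.
  rewrite !inE => /andP[nf fB]; rewrite leNgt; apply/negP=> lt; case/negP: nf.
  by rewrite fB; apply/existsP; exists f; rewrite inE lt connect0.
have r0B f : f \notin B -> b r0 f = 0 by apply: suppA.
pose a1 f := if f \in B1 then b r0 f else 0.
pose a2 f := if f \in B2 then - b r0 f else 0.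
have a1ge f : 0 <= a1 f by rewrite /a1; case: ifP => // /r0pos.
have a2ge f : 0 <= a2 f by rewrite /a2; case: ifP => // /r0neg; rewrite oppr_ge0.
have bd1 v : bd B1 a1 v = bd B1 (b r0) v.
  by apply: eq_bigr => f /andP[fB _]; rewrite /a1 fB.
have bd2 v : bd B2 a2 v = - bd B2 (b r0) v.
  by rewrite !bdE -sumrN; apply: eq_bigr => f /andP[fB _]; rewrite /a2 fB.
have r0sum v : bd B1 (b r0) v = - bd B2 (b r0) v.
  by apply/eqP; rewrite -addr_eq0 -bdU // BE -(bd_supp E v r0B) rows_bd.
have gl v : bd B1 a1 v = bd B2 a2 v by rewrite bd1 bd2 r0sum.
have in1 f : f \in sign_side r0 true -> f \in B1.
  move=> ff; rewrite inE; apply/andP; split.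
    by apply: contraLR ff => /r0B h; rewrite inE h ltxx.
  by apply/existsP; exists f; rewrite ff connect0.
have [f1 f1s] : exists f, f \in sign_side r0 true by apply/set0Pn; apply: rows_sides.
have [f2 f2s] : exists f, f \in sign_side r0 false by apply/set0Pn; apply: rows_sides.
have f2B : f2 \in B2.
  rewrite inE; apply/andP; split.
    by apply/negP=> /r0pos; rewrite inE in f2s; rewrite leNgt f2s.
  by apply: contraLR f2s => /r0B h; rewrite inE h ltxx.
have f1B := in1 _ f1s.
have gl0 : exists v, bd B1 a1 v != 0.
  have /eqP/cards2P[x [y [xy Exy]]] := Ecard f1.
  exists x; rewrite bdE (bigD1 f1) /=; last by rewrite f1B Exy !inE eqxx.
  rewrite gt_eqF // ltr_pwDl //; last by apply: sumr_ge0.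
  by rewrite /a1 f1B; rewrite inE in f1s.
have rows_part r f g : r \in A -> r != r0 -> b r f != 0 -> b r g != 0 -> (f \in B1) = (g \in B1).
  by move=> rA rr hf hg; apply/idP/idP; [apply: (B1cl r)|apply: (B1cl r)].
(* Each row other than r0 lies in one of the two parts, so its restriction to B1 has
   boundary zero. *)
have bdrow r v : r \in A -> r != r0 -> bd B1 (b r) v = 0.
  move=> rA rr; have [/existsP[f /andP[fB1 hf]]|/existsPn h] := boolP [exists f, (f \in B1) && (b r f != 0)].
    rewrite -(bd_supp E v) ?rows_bd // => g; apply: contraNeq => hg.
    by rewrite -(rows_part r f g).
  by apply: big1 => f /andP[fB1 _]; have := h f; rewrite fB1 negbK => /eqP.
have split_sum c f : \sum_(r in A) c r * b r f =
    c r0 * b r0 f + \sum_(r in A :\ r0) c r * b r f by rewrite (big_setD1 r0).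
have gg w : (forall f, f \notin B1 :|: B2 -> w f = 0) -> (forall v, bd setT w v = 0) ->
    exists k : int, forall v, bd B1 w v = k * bd B1 a1 v.
  rewrite BE => w1 w2; have [c hc] := genA w w1 w2; exists (c r0) => v.
  rewrite (eq_bd _ _ _ hc) bd_sum (big_setD1 r0) //= big1 ?addr0 ?bd1 // => r /setD1P[rr rA].
  by rewrite bdrow // mulr0.
have gg' w : (forall f, f \notin B2 :|: B1 -> w f = 0) -> (forall v, bd setT w v = 0) ->
    exists k : int, forall v, bd B2 w v = k * bd B2 a2 v.
  rewrite setUC => w1 w2; have [k hk] := gg w w1 w2; exists (- k) => v.
  have := w2 v; rewrite (bd_supp E v w1) bdU // hk -gl => /eqP; rewrite addrC addr_eq0 => /eqP->.
  by rewrite mulNr.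
have dB' : [disjoint B2 & B1] by rewrite disjoint_sym.
have gl' v : bd B2 a2 v = bd B1 a1 v by rewrite gl.
have gl0' : exists v, bd B2 a2 v != 0 by have [v hv] := gl0; exists v; rewrite -gl.
(* Taking the boundary of the B1-part shows that r0 has coefficient 0 in a vector of the
   lattice supported on one part. *)
have sub_gen (B' : {set F}) : (B' = B1) \/ (B' = B2) ->
    rows_generate B' [set r in A :\ r0 | [forall f, (b r f != 0) ==> (f \in B')]].
  move=> B'E; split=> [r f|w w1 w2].
    rewrite inE => /andP[_ /forallP/(_ f)/implyP h]; apply: contraNeq; exact: h.
  have B'B : B' \subset B by case: B'E => ->; rewrite -BE ?subsetUl ?subsetUr.
  have w1B f : f \notin B -> w f = 0.
    by move=> fB; apply: w1; apply: contra fB; apply: (subsetP B'B).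
  have [c hc] := genA w w1B w2.
  have cr0 : c r0 = 0.
    have [v hv] := gl0; have bw : bd B1 w v = 0.
      case: B'E => B'E; first by rewrite -(bd_supp E v) ?w2 // -B'E.
      by apply: big1 => f /andP[fB1 _]; apply: w1; rewrite B'E; rewrite (disjointFr dB fB1).
    move: bw; rewrite (eq_bd _ _ _ hc) bd_sum (big_setD1 r0) //= big1 ?addr0 => [|r /setD1P[rr rA]].
      by rewrite -bd1 => /eqP; rewrite mulf_eq0 (negPf hv) orbF => /eqP.
    by rewrite bdrow // mulr0.
  exists c => f; have [fB'|fB'] := boolP (f \in B'); last first.
    rewrite w1 // big1 // => r; rewrite inE => /andP[_ /forallP/(_ f)].
    by rewrite (negPf fB') implybF negbK => /eqP->; rewrite mulr0.
  rewrite hc split_sum cr0 mul0r add0r big_mkcond [RHS]big_mkcond /=; apply: eq_bigr => r _.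
  rewrite [r \in [set _ in _ | _]]inE; case: (boolP (r \in A :\ r0)) => //= /setD1P[rr rA].
  case: (boolP [forall _, _]) => // /forallPn[g]; rewrite negb_imply => /andP[hg gB'].
  have [->|hf] := eqVneq (b r f) 0; first by rewrite mulr0.
  have E1 := rows_part r f g rA rr hf hg.
  have gB : g \in B by apply: contraNT hg => /suppA ->.
  case/negP: gB'; case: B'E => B'E; rewrite B'E in fB' *; first by rewrite -E1.
  by move: fB'; rewrite !in_setD -E1 gB => /andP[->].
have sizeB : #|B| = (#|B1| + #|B2|)%N.
  by rewrite -BE cardsU (eqP (_ : B1 :&: B2 == set0)) ?cards0 ?subn0 // setI_eq0.
have B1pos : (0 < #|B1|)%N by rewrite card_gt0; apply/set0Pn; exists f1.
have B2pos : (0 < #|B2|)%N by rewrite card_gt0; apply/set0Pn; exists f2.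
have [lt1 lt2] : (#|B1| < n)%N /\ (#|B2| < n)%N.
  by move: leB sizeB B1pos B2pos; clear; lia.
have link' : two_linked E (B1 :|: B2) c1 c2 by rewrite BE.
have link'' : two_linked E (B2 :|: B1) c1 c2 by rewrite setUC.
have [m|m] := glue_colour1 Einj Ecard dB a1ge a2ge gl gl0 gg uc1 uc2 oc1 oc2 dc ch1 ch2 nocross link'.
  apply: (IHn B1 _ lt1 (sub_gen B1 (or_introl erefl))).
  exact: (glue_two_linked Einj Ecard dB a1ge a2ge gl gl0 gg uc1 uc2 oc1 oc2 dc ch1 ch2 nocross link' m).
apply: (IHn B2 _ lt2 (sub_gen B2 (or_intror erefl))).
exact: (glue_two_linked Einj Ecard dB' a2ge a1ge gl' gl0' gg' uc1 uc2 oc1 oc2 dc ch1 ch2 nocross link'' m).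
Qed.

End Descent.

(** * Saturation of the edge semigroup *)

Lemma linear_dependency (K : fieldType) (X Y : finType) (M : X -> Y -> K) :
  (#|Y| < #|X|)%N ->
  exists c : X -> K, (exists x, c x != 0) /\ forall y, \sum_x c x * M x y = 0.
Proof.
move=> lt; pose A := \matrix_(i < #|X|, j < #|Y|) M (enum_val i) (enum_val j).
have : kermx A != 0.
  rewrite kermx_eq0 /row_free; apply/eqP=> E; have := rank_leq_col A.
  by rewrite E leqNgt lt.
case/rowV0Pn=> v /sub_kermxP vA v0; exists (fun x => v 0 (enum_rank x)); split.
  have /rV0Pn[j vj] := v0; exists (enum_val j); by rewrite enum_valK.
move=> y; have := congr1 (fun B : 'rV_ _ => B 0 (enum_rank y)) vA; rewrite mxE [RHS]mxE => vy.
rewrite -[RHS]vy [LHS](reindex (@enum_val X (mem X))) /=; last first.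
  by exists enum_rank => x _; rewrite ?enum_valK ?enum_rankK.
by apply: eq_bigr => i _; rewrite enum_valK mxE enum_rankK.
Qed.

(** Prolong a simple path at its head [x] by a neighbour other than the next vertex. When the
    neighbour already occurs in the path, it closes a cycle of length at least 3; the number of
    vertices bounds the number of prolongations. *)
Lemma exists_cycle (T : finType) (R : rel T) (W : {set T}) :
  ssrbool.symmetric R -> irreflexive R -> W != set0 ->
  (forall x y, x \in W -> exists z, [/\ z \in W, R x z & z != y]) ->
  exists c, [/\ uniq c, (2 < size c)%N, cycle R c & {subset c <= W}].
Proof.
move=> Rsym Rirr /set0Pn[x0 x0W] nb.
suff gen n : forall x s, (#|T| < n + size (x :: s))%N -> uniq (x :: s) -> path R x s ->
    {subset x :: s <= W} -> exists c, [/\ uniq c, (2 < size c)%N, cycle R c & {subset c <= W}].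
  apply: (gen #|T| x0 [::]) => //; first by rewrite addn1.
  by move=> y; rewrite inE => /eqP->.
elim: n => [|n IH] x s;
  first by move=> + us; rewrite ltnNge -(card_uniqP us) add0n max_card.
move=> lt us ps sW; have xW : x \in W by apply: sW; rewrite inE eqxx.
have [z [zW xz zy]] := nb x (head x s) xW.
have [zs|zs] := boolP (z \in x :: s); last first.
  apply: (IH z (x :: s)); rewrite ?cons_uniq ?zs //; first by rewrite /= addnS -addSn.
    by rewrite /= Rsym xz.
  by move=> t; rewrite inE => /orP[/eqP->//|/sW].
have zx : z != x by apply: contraTneq xz => ->; rewrite Rirr.
move: zs; rewrite inE (negPf zx) /= => zs.
case/splitPr: zs us ps sW zy {lt} => s1 s2 us ps sW zy.
exists (x :: rcons s1 z); split.
- by move: us; rewrite -cat_rcons -cat_cons cat_uniq => /andP[].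
- by rewrite /= size_rcons; case: (s1) zy => //=; rewrite eqxx.
- rewrite /= rcons_path last_rcons [R z x]Rsym xz andbT.
  by move: ps; rewrite -cat_rcons cat_path => /andP[].
- by move=> t ts; apply: sW; rewrite -cat_rcons -cat_cons mem_cat ts.
Qed.

Section EdgeSemigroup.
Variables (T F : finType) (E : F -> {set T}).
Hypothesis Einj : injective E.
Hypothesis Ecard : forall f, #|E f| = 2.
Local Notation e := (erel E setT).

Definition semi (u : T -> nat) := exists w : F -> nat, forall v, u v = (\sum_(f | v \in E f) w f)%N.
Definition qsemi (u : T -> rat) := exists q : F -> rat, (forall f, 0 <= q f) /\
  forall v, u v = \sum_(f | v \in E f) q f.
Definition tot (u : T -> nat) := (\sum_v u v)%N.

Lemma eq_semi u u' : u =1 u' -> semi u -> semi u'.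
Proof. by move=> h [w hw]; exists w => v; rewrite -h. Qed.

Lemma eq_qsemi u u' : u =1 u' -> qsemi u -> qsemi u'.
Proof. by move=> h [w [w0 hw]]; exists w; split=> // v; rewrite -h. Qed.

Lemma semiD u u' : semi u -> semi u' -> semi (fun v => u v + u' v)%N.
Proof. by move=> [w hw] [w' hw']; exists (fun f => w f + w' f)%N => v; rewrite hw hw' big_split. Qed.

Lemma qsemiD u u' : qsemi u -> qsemi u' -> qsemi (fun v => u v + u' v).
Proof.
move=> [w [w0 hw]] [w' [w0' hw']]; exists (fun f => w f + w' f); split=> [f|v].
  exact: addr_ge0.
by rewrite hw hw' big_split.
Qed.

Lemma qsemi_semi u : semi u -> qsemi (fun v => (u v)%:R).
Proof.
move=> [w hw]; exists (fun f => (w f)%:R); split=> [f|v]; first exact: ler0n.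
by rewrite hw natr_sum.
Qed.

Lemma qsemiZ a u : 0 <= a -> qsemi u -> qsemi (fun v => a * u v).
Proof.
move=> a0 [w [w0 hw]]; exists (fun f => a * w f); split=> [f|v]; first exact: mulr_ge0.
by rewrite hw mulr_sumr.
Qed.

Lemma semi_edge f : semi (fun v => (v \in E f) : nat).
Proof.
exists (fun g => (g == f) : nat) => v; rewrite big_mkcond (bigD1 f) //= eqxx big1.
  by case: (v \in E f).
by move=> g /negPf->; case: ifP.
Qed.

Lemma semi_pair x y : e x y -> semi (fun v => (v == x) + (v == y))%N.
Proof.
move=> xy; have := erel_neq Ecard xy => xny; case/erelP: xy => f _ Ef.
apply: eq_semi (semi_edge f) => v; rewrite Ef !inE.
by case: eqP => [->|] //=; rewrite (negPf xny).
Qed.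

Lemma semi_tot_even u : semi u -> ~~ odd (tot u).
Proof.
move=> [w hw]; have -> : tot u = (\sum_f w f * 2)%N.
  rewrite /tot; under eq_bigr => v _ do rewrite hw.
  rewrite (exchange_big_dep predT) //=; apply: eq_bigr => f _.
  by rewrite sum_nat_const Ecard mulnC.
by rewrite -big_distrl /= oddM andbF.
Qed.

(** Every other edge of the path gives a matching of its evenly many vertices. *)
Lemma semi_path x s : path e x s -> odd (size s) -> semi (fun v => count_mem v (x :: s)).
Proof.
have [l] := ubnP (size s); elim: l x s => // l IH x [|y [|z s]] //= lt /andP[xy ps] os.
  by apply: eq_semi (semi_pair xy) => v; rewrite addn0 !(eq_sym v).
case/andP: ps => yz ps; rewrite negbK in os.
have lt' : (size s < l)%N by move: lt; clear; lia.
apply: eq_semi (semiD (semi_pair xy) (IH z s lt' ps os)) => v /=.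
by rewrite -addnA !(eq_sym v).
Qed.

(** Weight one half on each edge. The halves missing at the two ends are supplied when the path is
    closed to a cycle. *)
Lemma qsemi_path x s : path e x s -> qsemi (fun v => (count_mem v (x :: s))%:R
  - 2^-1 * (v == x)%:R - 2^-1 * (v == last x s)%:R).
Proof.
elim: s x => [|y s IH] x /=.
  move=> _; exists (fun _ => 0); split=> // v; rewrite big1 // addn0 (eq_sym v).
  by case: (x == v); lra.
case/andP=> xy /IH h.
have half : 0 <= 2^-1 :> rat by [].
apply: eq_qsemi (qsemiD (qsemiZ half (qsemi_semi (semi_pair xy))) h) => v /=.
by rewrite !natrD !(eq_sym v); lra.
Qed.

Lemma qsemi_cycle c : cycle e c -> qsemi (fun v => (count_mem v c)%:R).
Proof.
case: c => [_|x s]; first by exists (fun _ => 0); split=> // v; rewrite big1.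
move=> /qsemi_path; apply: eq_qsemi => v; rewrite last_rcons /= -cats1 count_cat /=.
by rewrite addn0 !natrD !(eq_sym v); lra.
Qed.

Section SmallSupport.
Variables (u : T -> nat) (q : F -> rat).
Hypothesis q0 : forall f, 0 <= q f.
Hypothesis q1 : forall f, q f < 1.
Hypothesis qu : forall v, (u v)%:R = \sum_(f | v \in E f) q f.
Definition qsupp := [set f | q f != 0].
Hypothesis no_rel : forall w : F -> rat, (forall f, f \notin qsupp -> w f = 0) ->
  (forall v, \sum_(f | v \in E f) w f = 0) -> forall f, w f = 0.

Definition usupp := [set v | u v != 0%N].

Lemma qsupp_gt0 f : f \in qsupp -> 0 < q f.
Proof. by rewrite inE lt0r => ->; rewrite q0. Qed.

Lemma usupp_edge f v : f \in qsupp -> v \in E f -> v \in usupp.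
Proof.
move=> fq vf; rewrite inE -(pnatr_eq0 rat) qu (bigD1 f) //= gt_eqF //.
by apply: ltr_pwDl; rewrite ?qsupp_gt0 // sumr_ge0.
Qed.

Definition qdeg v := #|[set f in qsupp | v \in E f]|.

Lemma u_qsum v : (u v)%:R = \sum_(f in [set f in qsupp | v \in E f]) q f.
Proof.
rewrite qu big_mkcond [RHS]big_mkcond; apply: eq_bigr => f _; rewrite !inE.
by case: (eqVneq (q f) 0) => [->|] //=; case: ifP.
Qed.

Lemma qdeg_ge2 v : v \in usupp -> (2 <= qdeg v)%N.
Proof.
rewrite inE => uv; rewrite leqNgt; apply/negP; rewrite ltnS => le1.
have : (u v)%:R < 1 :> rat.
  rewrite u_qsum; move: le1; rewrite leq_eqVlt ltnS leqn0 => /orP[/cards1P[f ->]|].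
    by rewrite big_set1.
  by rewrite cards_eq0 => /eqP->; rewrite big_set0.
by rewrite ltrn1; case: (u v) uv.
Qed.

Lemma card_qsupp_le : (#|qsupp| <= #|usupp|)%N.
Proof.
rewrite leqNgt; apply/negP=> lt.
have lt' : (#|{: {v | v \in usupp}}| < #|{: {f | f \in qsupp}}|)%N by rewrite !card_sig.
have [c [[x0 cx0] hc]] := linear_dependency
  (fun (x : {f | f \in qsupp}) (y : {v | v \in usupp}) => ((val y \in E (val x))%:R : rat)) lt'.
pose w f := if insub f is Some x then c x else 0.
have wE (x : {f | f \in qsupp}) : w (val x) = c x by rewrite /w valK.
have w0 f : f \notin qsupp -> w f = 0 by move=> fq; rewrite /w insubN.
case/eqP: cx0; rewrite -wE; apply: no_rel => // v.
have -> : \sum_(f | v \in E f) w f = \sum_(x : {f | f \in qsupp}) c x * (v \in E (val x))%:R.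
  rewrite big_mkcond /= (bigID (mem qsupp)) /= [X in _ + X]big1 ?addr0; last first.
    by move=> f /w0->; case: ifP.
  rewrite (reindex_omap (val : {f | f \in qsupp} -> F) insub) /=; last first.
    by move=> f fq; rewrite insubT.
  apply: eq_big => [x|x _]; first by rewrite valK eqxx (valP x).
  by rewrite wE; case: ifP; rewrite ?mulr1 ?mulr0.
case: (boolP (v \in usupp)) => vu; first by rewrite -[RHS](hc (Sub v vu)).
apply: big1 => x _; case: (boolP (v \in E (val x))) => vx; last by rewrite mulr0.
by case/negP: vu; apply: usupp_edge vx; apply: (valP x).
Qed.

(** Weights below 1 force at least two edges at each vertex of [usupp], while independence of the
    edges in [qsupp] gives [#|qsupp| <= #|usupp|]. Counting incidences leaves no room for a third
    edge, so the support is a disjoint union of cycles. *)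
Lemma qdeg2 v : v \in usupp -> qdeg v = 2.
Proof.
move=> vu; have sumE : (\sum_(v in usupp) qdeg v = #|qsupp| * 2)%N.
  rewrite /qdeg; under eq_bigr => x _ do rewrite -sum1_card.
  rewrite (exchange_big_dep (mem qsupp)) /=; last by move=> x f _; rewrite inE => /andP[].
  rewrite -sum_nat_const; apply: eq_bigr => f fq; rewrite -[RHS](Ecard f) -sum1_card.
  apply: eq_bigl => x; rewrite [f \in _]inE fq /= andbC; case: (boolP (x \in E f)) => //= xf.
  by rewrite (usupp_edge fq xf).
have := card_qsupp_le; rewrite -(leq_pmul2r (isT : 0 < 2)%N) -sumE.
rewrite -sum_nat_const => le.
apply/eqP; rewrite eqn_leq qdeg_ge2 // andbT leqNgt; apply/negP=> gt.
move: le; rewrite leqNgt => /negP[]; rewrite (bigD1 v) //= [X in (_ < X)%N](bigD1 v) //=.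
rewrite -addSn; apply: leq_add => //; apply: leq_sum => x /andP[xu _].
exact: qdeg_ge2.
Qed.

Lemma u_eq1 v : v \in usupp -> u v = 1%N.
Proof.
move=> vu; have /eqP/cards2P[f [g [fg S]]] := qdeg2 vu.
have : (u v)%:R < 2%:R :> rat.
  by rewrite u_qsum S big_setU1 ?inE //= big_set1; have := q1 f; have := q1 g; lra.
by rewrite ltr_nat; move: vu; rewrite inE; case: (u v) => [|[]].
Qed.

Local Notation h := (erel E qsupp).

Lemma qrel_nb x y : x \in usupp -> exists z, [/\ z \in usupp, h x z & z != y].
Proof.
move=> xu; have /eqP/cards2P[f [g [fg S]]] := qdeg2 xu.
have other k : k \in [set f in qsupp | x \in E f] -> exists z, [/\ z \in usupp, h x z & E k = [set x; z]].
  rewrite inE => /andP[kq xk]; have /eqP/cards2P[a [b [ab Eab]]] := Ecard k.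
  have fin c : E k = [set x; c] -> exists z, [/\ z \in usupp, h x z & E k = [set x; z]].
    move=> Ec; exists c; split=> //; last by apply/erelP; exists k.
    by apply: (usupp_edge kq); rewrite Ec !inE eqxx orbT.
  have : x \in [set a; b] by rewrite -Eab.
  by rewrite !inE => /orP[]/eqP E0; [apply: (fin b)|apply: (fin a)]; rewrite Eab E0 // setUC.
have [a [au xa Ea]] : exists z, [/\ z \in usupp, h x z & E f = [set x; z]].
  by apply: other; rewrite S !inE eqxx.
have [b [bu xb Eb]] : exists z, [/\ z \in usupp, h x z & E g = [set x; z]].
  by apply: other; rewrite S !inE eqxx orbT.
have [ay|ay] := eqVneq a y; last by exists a.
exists b; split=> //; apply: contra fg => /eqP by_; apply/eqP/Einj.
by rewrite Ea Eb ay by_.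
Qed.

Lemma qcycle_closed c x f : uniq c -> (2 < size c)%N -> cycle h c -> {subset c <= usupp} ->
  f \in qsupp -> x \in c -> x \in E f -> {subset E f <= c}.
Proof.
move=> uc sc cyc cW fq xc xf.
have [i s Ei] := rot_to xc.
have us : uniq (x :: s) by rewrite -Ei rot_uniq.
have ss : (2 < size (x :: s))%N by rewrite -Ei size_rot.
have cs : cycle h (x :: s) by rewrite -Ei rot_cycle.
have sub t : t \in x :: s -> t \in c by rewrite -Ei mem_rot.
case: s us ss cs sub {Ei} => [|y s] //=.
case/lastP: s => [|s z] //; rewrite rcons_path !last_rcons.
move=> us _ /and3P[/erelP[f1 f1q E1] _ /erelP[f2 f2q E2]] sub.
have f12 : f1 != f2.
  apply/eqP=> E12; have : y \in E f2 by rewrite -E12 E1 !inE eqxx orbT.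
  rewrite E2 !inE; case/and3P: us => xn yn _.
  apply/negP; rewrite negb_or; apply/andP; split.
    by apply: contra yn => /eqP->; rewrite mem_rcons inE eqxx.
  by apply: contra xn => /eqP<-; rewrite inE eqxx.
have /eqP/cards2P[g1 [g2 [g12 S]]] := qdeg2 (cW _ xc).
have in_S k : k \in qsupp -> x \in E k -> k = g1 \/ k = g2.
  move=> kq xk; have : k \in [set f in qsupp | x \in E f] by rewrite inE kq.
  by rewrite S !inE => /orP[]/eqP; [left|right].
have : f = f1 \/ f = f2.
  have h1 := in_S f1 f1q; have h2 := in_S f2 f2q.
  have [->|->] := in_S f fq xf;
  have [e1|e1] := h1 (ltac:(by rewrite E1 !inE eqxx));
  have [e2|e2] := h2 (ltac:(by rewrite E2 !inE eqxx orbT));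
  rewrite e1 e2 ?eqxx in f12 *; by [|left|right].
by case=> ->; rewrite ?E1 ?E2 => t; rewrite !inE => /orP[]/eqP->; apply: sub;
  rewrite ?inE ?mem_rcons ?inE ?eqxx ?orbT.
Qed.

Lemma qsemi_sub d : uniq d -> {subset d <= usupp} ->
  (forall f x, f \in qsupp -> x \in d -> x \in E f -> {subset E f <= d}) ->
  qsemi (fun v => (u v)%:R - (count_mem v d)%:R).
Proof.
move=> ud dW cl; exists (fun f => if [exists x in E f, x \in d] then 0 else q f).
split=> [f|v]; first by case: ifP.
rewrite count_uniq_mem //; case: (boolP (v \in d)) => vd.
  rewrite u_eq1 ?dW // subrr big1 // => f vf; case: ifP => // /existsP[].
  by exists v; rewrite vf.
rewrite subr0 qu; apply: eq_bigr => f vf; case: ifP => // /existsP[x /andP[xf xd]].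
apply/eqP/negPn/negP => qf; case/negP: vd; apply: (cl f x) vf => //.
by rewrite inE.
Qed.

Lemma count_le_u d : uniq d -> {subset d <= usupp} -> forall v, (count_mem v d <= u v)%N.
Proof.
move=> ud dW v; rewrite count_uniq_mem //; case: (boolP (v \in d)) => // vd.
by rewrite u_eq1 // dW.
Qed.

Lemma h_sub x y : h x y -> e x y.
Proof. by case/erelP=> f _ Ef; apply/erelP; exists f; rewrite ?inE. Qed.

Hypothesis smaller : forall u' : T -> nat, (tot u' < tot u)%N ->
  qsemi (fun v => (u' v)%:R) -> ~~ odd (tot u') -> semi u'.
Hypothesis even_u : ~~ odd (tot u).
Hypothesis occ : odd_cycle_condition e.

(** Minimality of [u] in usable form: an integral piece can be split off as soon as the rest stays
    in the rational cone, for the piece has even total and the parity of the rest is unchanged. *)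
Lemma semi_reduce (z : T -> nat) : (forall v, z v <= u v)%N -> (exists v, z v != 0%N) ->
  semi z -> qsemi (fun v => (u v)%:R - (z v)%:R) -> semi u.
Proof.
move=> zu [v0 zv0] sz qz; pose u' v := (u v - z v)%N.
have uE : u =1 (fun v => u' v + z v)%N by move=> v; rewrite subnK.
have totE : tot u = (tot u' + tot z)%N by rewrite /tot -big_split; apply: eq_bigr.
have su' : semi u'.
  apply: smaller.
  - rewrite totE -addn1 leq_add2l /tot (bigD1 v0) //= addn_gt0 lt0n zv0 //.
  - by apply: eq_qsemi qz => v; rewrite natrB.
  - by move: even_u; rewrite totE oddD (negPf (semi_tot_even sz)) addbF.
by apply: eq_semi (semiD su' sz) => v; rewrite -uE.
Qed.

Lemma count_sub (d d1 : seq T) : (forall v, count_mem v d1 <= count_mem v d)%N -> uniq d ->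
  {subset d <= usupp} -> forall v, (count_mem v d1 <= u v)%N.
Proof. by move=> le ud dW v; apply: leq_trans (le v) (count_le_u ud dW v). Qed.

(** An even cycle would be split off by a matching. In an odd cycle with a chord, one of the two
    open arcs has evenly many vertices; it is split off by a matching, and the chord closes the
    remaining vertices to a cycle, which is in the rational cone. *)
Lemma qcycle_odd_chordless c : uniq c -> (2 < size c)%N -> cycle h c -> {subset c <= usupp} ->
  ~ semi u -> odd_chordless_cycle e c.
Proof.
move=> uc sc cyc cW nsu.
have cyce : cycle e c by apply: sub_cycle cyc => x y; apply: h_sub.
have cl f x : f \in qsupp -> x \in c -> x \in E f -> {subset E f <= c}.
  exact: qcycle_closed.
have qc := qsemi_sub uc cW cl.
have oc : odd (size c).
  apply: contra_notT nsu => ec; case: c uc sc cyc cW cyce cl qc ec => [|x s] // uc sc cyc cW cyce cl qc ec.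
  apply: (semi_reduce (count_le_u uc cW)) => //; first by exists x; rewrite /= eqxx.
  apply: semi_path; first by move: cyce; rewrite /= rcons_path => /andP[].
  by move: ec; rewrite /= negbK.
apply/and3P; split=> //; first by apply/and3P.
apply/forallP=> x; apply/forallP=> y; apply/implyP=> /andP[/andP[xc yc] xy].
apply: contra_notT nsu; rewrite negb_or => /andP[yn xn].
have xny := erel_neq Ecard xy.
have [i s Ei] := rot_to xc.
have ys : y \in s.
  by move: yc; rewrite -(mem_rot i) Ei inE eq_sym (negPf xny).
case/splitPr: ys Ei => s1 s2 Ei.
have s1n : s1 != [::].
  apply: contra yn => /eqP s10; rewrite -(next_rot i) // Ei s10 /= eqxx //.
have s2n : s2 != [::].
  apply: contra xn => /eqP s20; rewrite -(next_rot i) // Ei s20.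
  have us : uniq (rcons (x :: s1) y) by have := rot_uniq i c; rewrite Ei s20 uc cats1.
  have ys1 : y \notin s1 by move: us; rewrite rcons_uniq inE negb_or => /andP[/andP[]].
  rewrite next_nth inE mem_cat inE eqxx !orbT /= (negPf xny) index_cat (negPf ys1) /= eqxx addn0.
  by rewrite nth_default // size_cat addn1.
have countE v : count_mem v c = count_mem v (x :: s1 ++ y :: s2).
  by rewrite -Ei; apply/permP; rewrite perm_sym perm_rot.
have cycr : cycle e (x :: s1 ++ y :: s2) by rewrite -Ei rot_cycle.
have os : odd (size (x :: s1 ++ y :: s2)) by rewrite -Ei size_rot.
have {cycr} [p1 p2 p3] : [/\ path e x (rcons s1 y), path e y s2 & e (last y s2) x].
  move: cycr; rewrite /= -cat_rcons rcons_cat cat_path last_rcons rcons_path.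
  by rewrite [path e y (rcons s2 x)]rcons_path => /andP[-> /andP[-> ->]].
have fin (z c' : seq T) : (forall v, count_mem v c = count_mem v c' + count_mem v z)%N ->
    cycle e c' -> z != [::] -> semi (fun v => count_mem v z) -> semi u.
  move=> cE cyc' zn sz; apply: (semi_reduce (z := fun v => count_mem v z)) => //.
  - by apply: count_sub uc cW => v; rewrite cE leq_addl.
  - by case: (z) zn => // a z' _; exists a; rewrite /= eqxx.
  - apply: eq_qsemi (qsemiD qc (qsemi_cycle cyc')) => v /=.
    by rewrite cE natrD; ring.
have [e1|o1] := boolP (odd (size s1)); last first.
  apply: (fin s1 (x :: y :: s2)) => //.
  - by move=> v; rewrite countE /= count_cat /=; clear; lia.
  - by rewrite /= rcons_path xy p2.
  - case: (s1) s1n p1 o1 => // a t _ /= /andP[_ pt]; rewrite negbK => ot.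
    by apply: semi_path => //; move: pt; rewrite rcons_path => /andP[].
have o2 : ~~ odd (size s2).
  by move: os; rewrite /= size_cat /= oddD e1 /= negbK; case: (odd _).
apply: (fin s2 (x :: rcons s1 y)) => //.
- by move=> v; rewrite countE /= count_cat -cats1 count_cat /=; clear; lia.
- by rewrite /= rcons_path last_rcons p1 erel_sym.
- case: (s2) s2n p2 o2 => // a t _ /= /andP[_ pt]; rewrite negbK => ot.
  exact: semi_path.
Qed.

Lemma semi_small : semi u.
Proof.
apply: NNPP => nsu.
have hsym : ssrbool.symmetric h by apply: erel_sym.
have hirr : irreflexive h by move=> x; apply/negbTE/negP=> /(erel_neq Ecard); rewrite eqxx.
have [W0|W0] := eqVneq usupp set0.
  apply: nsu; exists (fun _ => 0%N) => v; rewrite big1 //; apply/eqP.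
  by have := in_set0 v; rewrite -W0 inE => /negbT; rewrite negbK.
have [c1 [u1 s1 cy1 W1]] := exists_cycle hsym hirr W0 qrel_nb.
have oc1 := qcycle_odd_chordless u1 s1 cy1 W1 nsu.
have cl1 f x : f \in qsupp -> x \in c1 -> x \in E f -> {subset E f <= c1}.
  exact: qcycle_closed.
pose W2 := [set v in usupp | v \notin c1].
(* If a single odd cycle were the whole support, the total would be odd. *)
have [W20|W20] := eqVneq W2 set0.
  case/and3P: oc1 => _ _ o1; move: even_u.
  suff -> : tot u = size c1 by rewrite o1.
  rewrite -(card_uniqP u1) /tot -sum1_card [RHS]big_mkcond; apply: eq_bigr => v _.
  case: (boolP (v \in c1)) => vc; first by rewrite u_eq1 // W1.
  have := in_set0 v; rewrite -W20 !inE vc andbT => /negbT; rewrite negbK => /eqP->.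
  by [].
have nb2 x y : x \in W2 -> exists z, [/\ z \in W2, h x z & z != y].
  rewrite inE => /andP[xu xc]; have [z [zu xz zy]] := qrel_nb y xu; exists z; split=> //.
  rewrite inE zu; apply: contra xc => zc; case/erelP: xz => f fq Ef.
  by apply: (cl1 f z fq zc); rewrite Ef !inE eqxx ?orbT.
have [c2 [u2 s2 cy2 W2s]] := exists_cycle hsym hirr W20 nb2.
have W2u : {subset c2 <= usupp} by move=> v /W2s; rewrite inE => /andP[].
have oc2 := qcycle_odd_chordless u2 s2 cy2 W2u nsu.
have cl2 f x : f \in qsupp -> x \in c2 -> x \in E f -> {subset E f <= c2}.
  exact: qcycle_closed.
have disj v : v \in c2 -> v \notin c1 by move/W2s; rewrite inE => /andP[].
have [/hasP[v v1 v2]|[x [y [xc yc xy]]]] := occ oc1 oc2; first by rewrite (negPf (disj _ v2)) in v1.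
have u12 : uniq (c1 ++ c2).
  by rewrite cat_uniq u1 u2 andbT; apply/hasPn => v /disj.
have W12 : {subset c1 ++ c2 <= usupp}.
  by move=> v; rewrite mem_cat => /orP[/W1|/W2u].
apply: nsu; apply: (semi_reduce (z := fun v => count_mem v (c1 ++ c2))).
- exact: count_le_u.
- by exists x; rewrite count_uniq_mem // mem_cat xc.
(* The edge [xy] covers one vertex of each odd cycle; what remains of each is a path with evenly
   many vertices, hence matched. *)
- have spl c z : graph_cycle e c -> odd (size c) -> z \in c ->
      exists s, [/\ forall v, (count_mem v c = (z == v) + count_mem v s)%N & semi (fun v => count_mem v s)].
    case/and3P=> sc uc cyc oc zc; have [i s Ei] := rot_to zc; exists s; split.
      move=> v; rewrite -[RHS]/(count_mem v (z :: s)) -Ei; apply/permP.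
      by rewrite perm_sym perm_rot.
    have : cycle e (z :: s) by rewrite -Ei rot_cycle.
    have : odd (size (z :: s)) by rewrite -Ei size_rot.
    have : (2 < size (z :: s))%N by rewrite -Ei size_rot.
    case: (s) => // a t _ /= ot /andP[_]; rewrite rcons_path => /andP[pt _].
    by apply: semi_path => //; move: ot; rewrite negbK.
  case/and3P: oc1 => g1 _ o1; case/and3P: oc2 => g2 _ o2.
  have [t1 [E1 S1]] := spl _ _ g1 o1 xc; have [t2 [E2 S2]] := spl _ _ g2 o2 yc.
  apply: eq_semi (semiD (semi_pair xy) (semiD S1 S2)) => v /=.
  by rewrite count_cat E1 E2 (eq_sym x) (eq_sym y) addnACA.
- apply: qsemi_sub => // f z fq; rewrite mem_cat => /orP[zc|zc] zf v vf; rewrite mem_cat.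
    by rewrite (cl1 f z).
  by rewrite (cl2 f z) // orbT.
Qed.

End SmallSupport.

(** The reduction behind Carathéodory's theorem: move [q] along the relation [w] until the first
    coordinate reaches 0, the step being the smallest ratio over the negative coordinates of [w]. *)
Lemma qsupp_shrink (u : T -> nat) (q w : F -> rat) : (forall f, 0 <= q f) ->
  (forall v, (u v)%:R = \sum_(f | v \in E f) q f) ->
  (forall f, f \notin qsupp q -> w f = 0) -> (forall v, \sum_(f | v \in E f) w f = 0) ->
  (exists f, w f < 0) ->
  exists q', [/\ forall f, 0 <= q' f, forall v, (u v)%:R = \sum_(f | v \in E f) q' f &
    (#|qsupp q'| < #|qsupp q|)%N].
Proof.
move=> q0 qu ws w0 [f0 wf0].
case: (@arg_minP _ _ _ f0 (fun f => w f < 0) (fun f => q f / - w f) wf0) => f1 wf1 min.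
pose t := q f1 / - w f1.
have t0 : 0 <= t by rewrite divr_ge0 // oppr_ge0 ltW.
have qf1 : q f1 + t * w f1 = 0.
  by rewrite /t invrN mulrN mulNr divfK ?subrr // lt_eqF.
exists (fun f => q f + t * w f); split.
- move=> f; have [wf|wf] := ltP (w f) 0; last by rewrite addr_ge0 // mulr_ge0.
  have := min f wf; rewrite -/t ler_pdivlMr ?oppr_gt0 // mulrN => le.
  by rewrite -lerBlDr sub0r.
- by move=> v; rewrite qu big_split /= -mulr_sumr w0 mulr0 addr0.
- apply: proper_card; apply/properP; split.
    apply/subsetP=> f; rewrite inE; apply: contraR => fq.
    by rewrite ws // mulr0 addr0; move: fq; rewrite inE negbK.
  exists f1; last by rewrite inE qf1 eqxx.
  by apply: contraTT wf1 => /ws ->; rewrite ltxx.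
Qed.

Theorem semi_saturated (u : T -> nat) : odd_cycle_condition e ->
  qsemi (fun v => (u v)%:R) -> ~~ odd (tot u) -> semi u.
Proof.
move=> occ; have [l] := ubnP (tot u); elim: l u => // l IH u; rewrite ltnS => le [q [q0 qu]] ev.
have smaller u' : (tot u' < tot u)%N -> qsemi (fun v => (u' v)%:R) -> ~~ odd (tot u') -> semi u'.
  by move=> lt; apply: IH; apply: leq_trans le.
(* Inner induction, for fixed [u], on the support of the weights: a weight of at least 1 splits off
   an edge, a relation on the support shrinks it, and otherwise [semi_small] applies. *)
have [k] := ubnP #|qsupp q|; elim: k q q0 qu => // k IHk q q0 qu; rewrite ltnS => lek.
have [/existsP[f qf]|/existsPn q1] := boolP [exists f, 1 <= q f].
  apply: (@semi_reduce u smaller ev (fun v => (v \in E f) : nat)).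
  - move=> v; case: (boolP (v \in E f)) => // vf; rewrite -(ler_nat rat) qu (bigD1 f) //=.
    by apply: le_trans qf _; rewrite lerDl sumr_ge0.
  - have /eqP/cards2P[a [b [_ Eab]]] := Ecard f; exists a.
    by rewrite Eab !inE eqxx.
  - exact: semi_edge.
  - exists (fun g => q g - (g == f)%:R); split=> [g|v].
      by case: eqP => [->|_]; rewrite ?subr0 ?subr_ge0.
    rewrite qu sumrB; congr (_ - _); rewrite big_mkcond (bigD1 f) //= eqxx big1 ?addr0.
      by case: (v \in E f).
    by move=> g /negPf->; case: ifP.
apply: NNPP => nsu; apply: (nsu); apply: (@semi_small u q q0 _ qu _ smaller ev occ).
  by move=> f; have := q1 f; rewrite -ltNge.
move=> w ws w0 f; apply/eqP/negPn/negP=> wf.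
apply: nsu.
have neg : exists2 w' : F -> rat, (forall f, f \notin qsupp q -> w' f = 0) /\
    (forall v, \sum_(f | v \in E f) w' f = 0) & exists f, w' f < 0.
  have [wf0|wf0|wf0] := ltgtP (w f) 0; last by rewrite wf0 eqxx in wf.
    by exists w => //; exists f.
  exists (fun f => - w f); last by exists f; rewrite oppr_lt0.
  by split=> [g /ws ->|v]; rewrite ?oppr0 // sumrN w0 oppr0.
have [w' [ws' w0'] wneg] := neg.
have [q' [q0' qu' lt]] := qsupp_shrink q0 qu ws' w0' wneg.
by apply: (IHk q' q0' qu'); apply: leq_trans lt lek.
Qed.

End EdgeSemigroup.

(** * Iterated polynomials and transcendence bounds *)

Section IteratedPolynomials.
Variable K : fieldType.

Lemma mC_rmorphism n : exists f : {rmorphism K -> Defs.mpoly K n}, f =1 mC K n.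
Proof.
elim: n => [|n [f hf]]; first by exists idfun.
by exists (@polyC (Defs.mpoly K n) \o f) => c /=; rewrite hf.
Qed.

Lemma meval_rmorphism (S : comNzRingType) (cst : {rmorphism K -> S}) a n :
  exists f : {rmorphism Defs.mpoly K n -> S}, f =1 @Defs.meval K S cst a n.
Proof.
elim: n => [|n [f hf]]; first by exists cst.
exists (horner_eval (a n) \o map_poly f) => p /=.
rewrite horner_evalE /map_poly horner_poly; apply: eq_bigr => i _.
by rewrite hf.
Qed.

Lemma rmorphism_mpoly_ext n (S : nzRingType) (f g : {rmorphism Defs.mpoly K n -> S}) :
  (forall c, f (mC K n c) = g (mC K n c)) ->
  (forall k, (k < n)%N -> f (Defs.mX K n k) = g (Defs.mX K n k)) -> f =1 g.
Proof.
elim: n f g => [|n IH] f g hC hX; first exact: hC.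
have hP : f \o polyC =1 g \o polyC.
  apply: IH => [c|k kn]; first exact: hC.
  by have := hX k (ltnW kn); rewrite /= (ltn_eqF kn).
move=> p; elim/poly_ind: p => [|p c IHp]; first by rewrite !rmorph0.
have := hX n (ltnSn n); rewrite /= eqxx => hXn.
by rewrite !rmorphD !rmorphM IHp hXn; congr (_ + _); apply: (hP c).
Qed.

Lemma mC_is_zmod n : zmod_morphism (mC K n).
Proof. by have [f hf] := mC_rmorphism n; move=> x y; rewrite -!hf rmorphB. Qed.
Lemma mC_is_monoid n : monoid_morphism (mC K n).
Proof. by have [f hf] := mC_rmorphism n; split=> [|x y]; rewrite -!hf ?rmorph1 ?rmorphM. Qed.

HB.instance Definition _ n := GRing.isZmodMorphism.Build K (Defs.mpoly K n) (mC K n) (mC_is_zmod n).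
HB.instance Definition _ n := GRing.isMonoidMorphism.Build K (Defs.mpoly K n) (mC K n) (mC_is_monoid n).

Lemma meval_mC (S : comNzRingType) (cst : {rmorphism K -> S}) a n c :
  @Defs.meval K S cst a n (mC K n c) = cst c.
Proof.
elim: n => [|n IH] //=; rewrite size_polyC -IH.
have [f hf] := meval_rmorphism cst a n.
case: eqP => [->|_] /=; last by rewrite big_ord1 coefC mulr1.
by rewrite big_ord0 -hf rmorph0.
Qed.

Lemma meval_mX (S : comNzRingType) (cst : {rmorphism K -> S}) a n k : (k < n)%N ->
  @Defs.meval K S cst a n (Defs.mX K n k) = a k.
Proof.
elim: n => [|n IH] //; rewrite ltnS leq_eqVlt /=.
have [f hf] := meval_rmorphism cst a n.
case: eqP => [-> _|_ /= kn].
  rewrite size_polyX !big_ord_recl big_ord0 /= !coefX /= -!hf rmorph0 rmorph1.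
  by rewrite mul0r add0r mul1r addr0.
rewrite size_polyC; case: eqP => [E|_] /=; last by rewrite big_ord1 coefC mulr1 IH.
by rewrite big_ord0 -(IH kn) E -hf rmorph0.
Qed.

(** An isomorphism from iterated univariate polynomials to polynomials with exponent vectors, where
    supports and leading monomials are available. The value 0 is for indices that are out of
    range. *)
Definition theta n : Defs.mpoly K n -> {mpoly K[n]} :=
  @Defs.meval K {mpoly K[n]} (@mpolyC n K) (fun k => if insub k is Some i then 'X_i else 0) n.

Lemma theta_is_zmod n : zmod_morphism (@theta n).
Proof.
have [f hf] := meval_rmorphism (@mpolyC n K) (fun k => if insub k is Some i then 'X_i else 0) n.
by move=> x y; rewrite /theta -!hf rmorphB.
Qed.
Lemma theta_is_monoid n : monoid_morphism (@theta n).
Proof.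
have [f hf] := meval_rmorphism (@mpolyC n K) (fun k => if insub k is Some i then 'X_i else 0) n.
by split=> [|x y]; rewrite /theta -!hf ?rmorph1 ?rmorphM.
Qed.
HB.instance Definition _ n := GRing.isZmodMorphism.Build (Defs.mpoly K n) {mpoly K[n]} (@theta n) (@theta_is_zmod n).
HB.instance Definition _ n := GRing.isMonoidMorphism.Build (Defs.mpoly K n) {mpoly K[n]} (@theta n) (@theta_is_monoid n).

Lemma theta_mC n c : theta (mC K n c) = c%:MP.
Proof. exact: meval_mC. Qed.

Lemma theta_mX n (i : 'I_n) : theta (Defs.mX K n i) = 'X_i.
Proof. by rewrite /theta meval_mX // insubT // => lt; congr 'X_(_); apply: val_inj. Qed.

Definition theta_inv n : {mpoly K[n]} -> Defs.mpoly K n :=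
  mmap (mC K n) (fun i : 'I_n => Defs.mX K n i).

Lemma thetaK n : cancel (@theta n) (@theta_inv n).
Proof.
move=> p; apply: (@rmorphism_mpoly_ext n _ (mmap (mC K n) (fun i : 'I_n => Defs.mX K n i) \o @theta n) idfun) => [c|k kn] /=.
  by rewrite theta_mC mmapC.
by rewrite (theta_mX (Ordinal kn)) mmapX mmap1U.
Qed.

Lemma theta_invK n : cancel (@theta_inv n) (@theta n).
Proof.
move=> p; rewrite [RHS]mpolyE /theta_inv /mmap raddf_sum; apply: eq_bigr => m _ /=.
rewrite rmorphM /= theta_mC mul_mpolyC; congr (_ *: _).
rewrite /mmap1 rmorph_prod mpolyXE_id; apply: eq_bigr => i _.
by rewrite rmorphXn /= theta_mX.
Qed.

Lemma theta_inj n : injective (@theta n).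
Proof. exact: can_inj (@thetaK n). Qed.

End IteratedPolynomials.

Section DegreeBound.
Variables (K : fieldType) (n : nat).
Implicit Types p q : {mpoly K[n]}.

Definition degle k p := forall z, z \in msupp p -> (mdeg z <= k)%N.

Lemma degle1 k : degle k 1.
Proof. by move=> z; rewrite -mpolyC1 msupp1 inE => /eqP->; rewrite mdeg0. Qed.

Lemma degleM k l p q : degle k p -> degle l q -> degle (k + l) (p * q).
Proof.
move=> hp hq z /msuppM_le/allpairsP[[u v] /= [/hp hu /hq hv ->]].
by rewrite mdegD leq_add.
Qed.

Lemma degleX k i p : degle k p -> degle (k * i) (p ^+ i).
Proof.
move=> hp; elim: i => [|i IH]; first exact: degle1.
by rewrite exprS mulnS; apply: degleM.
Qed.

Lemma degle_prod (I : finType) (k : I -> nat) (F : I -> {mpoly K[n]}) :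
  (forall i, degle (k i) (F i)) -> degle (\sum_i k i) (\prod_i F i).
Proof.
move=> h; apply: (big_ind2 (fun p a => degle a p)) => //; first exact: degle1.
by move=> p a q b hp hq; apply: degleM.
Qed.

End DegreeBound.

(** With [D = (N * d) ^ m] the left side is at most [(N * d) ^ m * D.+1 ^ m = D * D.+1 ^ m], which
    is less than [D.+1 ^ m.+1]. *)
Lemma poly_growth N m d : (m < N)%N -> (0 < d)%N ->
  ((N * (d * (N * d) ^ m)).+1 ^ m < ((N * d) ^ m).+1 ^ N)%N.
Proof.
move=> lt d0; pose D := ((N * d) ^ m)%N; rewrite -/D.
have Nd : (0 < N * d)%N by rewrite muln_gt0 d0 (leq_ltn_trans _ lt).
apply: (@leq_trans (D.+1 ^ m.+1)%N); last by rewrite leq_pexp2l.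
rewrite expnS; apply: (@leq_ltn_trans (D * D.+1 ^ m)%N); last first.
  by rewrite ltn_pmul2r ?expn_gt0.
rewrite /D -expnMn -/D; case: (m) => // m'.
by rewrite leq_exp2r // mulnA mulnS -add1n leq_add2r.
Qed.

(** Dimension count: the monomials in [y] with exponents at most [D] number [D.+1 ^ N], but they
    involve only exponents up to [N * (d * D)] in the [m] variables. By [poly_growth] they are
    linearly dependent if [m < N]. *)
Lemma algebraic_independence_bound (K : fieldType) m N (y : 'I_N -> {mpoly K[m]}) :
  (forall G : {mpoly K[N]}, mmap (@mpolyC m K) y G = 0 -> G = 0) -> (N <= m)%N.
Proof.
move=> inj; rewrite leqNgt; apply/negP=> lt.
pose d := (\max_i msize (y i)).+1.
have yd i : degle d (y i).
  move=> z zy; have := msize_mdeg_lt zy; rewrite /d => h.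
  by apply: leqW; apply: leq_trans (ltnW h) (leq_bigmax i).
pose D := ((N * d) ^ m)%N.
pose X := {ffun 'I_N -> 'I_D.+1}; pose Y := {ffun 'I_m -> 'I_(N * (d * D)).+1}.
pose mon (x : X) : 'X_{1..N} := [multinom (x i : nat) | i < N].
pose box (z : Y) : 'X_{1..m} := [multinom (z i : nat) | i < m].
have moninj : injective mon.
  move=> x x' /mnmP h; apply/ffunP=> i; apply: val_inj.
  by have := h i; rewrite !mnmE.
have ltXY : (#|Y| < #|X|)%N by rewrite !card_ffun !card_ord; apply: poly_growth.
have [c [[x0 cx0] hc]] := linear_dependency (fun x z => (mmap1 y (mon x))@_(box z)) ltXY.
have : \sum_x c x *: 'X_[mon x] = 0 :> {mpoly K[N]}.
  apply: inj; rewrite raddf_sum /=; apply/mpolyP=> z; rewrite mcoeff0 raddf_sum /=.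
  under eq_bigr => x _ do rewrite mmapZ mmapX mul_mpolyC mcoeffZ.
  have [zbox|nz] := boolP [forall i, (z i < (N * (d * D)).+1)%N].
    have zi i : (z i < (N * (d * D)).+1)%N by apply: (forallP zbox).
    pose z' : Y := [ffun i => Ordinal (zi i)].
    have -> : z = box z' by apply/mnmP=> i; rewrite mnmE ffunE.
    exact: hc.
  apply: big1 => x _; rewrite memN_msupp_eq0 ?mulr0 //; apply: contra nz => zs.
  apply/forallP=> i; rewrite ltnS.
  apply: (@leq_trans (mdeg z)); first by rewrite mdegE (bigD1 i) //= leq_addr.
  have h : degle (\sum_(j < N) d * D)%N (mmap1 y (mon x)).
    apply: degle_prod => j u us; apply: (@leq_trans (d * mon x j)%N).
      exact: (@degleX K m d (mon x j) (y j) (yd j) u us).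
    by rewrite leq_mul2l mnmE -ltnS ltn_ord orbT.
  by have := h z zs; rewrite sum_nat_const card_ord.
move/mpolyP/(_ (mon x0)); rewrite mcoeff0 raddf_sum /= (bigD1 x0) //= big1.
  by rewrite mcoeffZ mcoeffX eqxx mulr1 addr0 => /eqP; rewrite (negPf cx0).
by move=> x xx0; rewrite mcoeffZ mcoeffX (inj_eq moninj) (negPf xx0) mulr0.
Qed.

Section PrimeChains.
Variables (K : fieldType) (m : nat).
Local Notation S := (Defs.mpoly K m).

Definition alg_indep (P : S -> Prop) (a : nat -> S) d :=
  forall G : Defs.mpoly K d, P (Defs.meval (mC K m) a G) -> G = 0.

Lemma eq_meval (R : comNzRingType) (cst : {rmorphism K -> R}) a b d (G : Defs.mpoly K d) :
  (forall k, (k < d)%N -> a k = b k) -> Defs.meval cst a G = Defs.meval cst b G.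
Proof.
elim: d G => [|d IH] //= G ab; apply: eq_bigr => i _.
by rewrite (IH _ (fun k h => ab k (ltnW h))) ab.
Qed.

Lemma meval_polyC (R : comNzRingType) (cst : {rmorphism K -> R}) a d (c : Defs.mpoly K d) :
  @Defs.meval K R cst a d.+1 c%:P = Defs.meval cst a c.
Proof.
have [f hf] := meval_rmorphism cst a d.
rewrite /= size_polyC; case: eqP => [->|_] /=; last by rewrite big_ord1 coefC mulr1.
by rewrite big_ord0 -hf rmorph0.
Qed.

(** Write a relation modulo [P] as [p * 'X + c] with ['X] standing for [f]. Modulo [Q] only [c]
    remains, so [c] is zero; then [P], being prime without [f], contains the value of [p], a
    relation of lower degree. *)
Lemma alg_indep_step (P Q : S -> Prop) a d f : is_prime_ideal P -> is_ideal Q ->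
  (forall x, P x -> Q x) -> Q f -> ~ P f -> alg_indep Q a d ->
  alg_indep P (fun k => if k == d then f else a k) d.+1.
Proof.
move=> [_ _ primeP] [Q0 QD QM] PQ Qf nPf ind.
set b := fun k => _.
have [g hg] := @meval_rmorphism K S (mC K m) b d.+1.
have ev p c : Defs.meval (mC K m) b (p * 'X + c%:P : Defs.mpoly K d.+1) =
    Defs.meval (mC K m) b (p : Defs.mpoly K d.+1) * f + Defs.meval (mC K m) a c.
  rewrite -!hg rmorphD rmorphM; congr (_ * _ + _).
    have := @meval_mX K S (mC K m) b d.+1 d (ltnSn d).
    by rewrite -hg [Defs.mX _ _ _]/= eqxx /b eqxx.
  rewrite hg meval_polyC; apply: eq_meval => k kd.
  by rewrite /b (ltn_eqF kd).
move=> G; elim/poly_ind: G => [//|p c IHp]; rewrite ev => h.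
have c0 : c = 0.
  apply: ind; have := QD _ _ (PQ _ h) (QM (- Defs.meval (mC K m) b (p : Defs.mpoly K d.+1)) _ Qf).
  by rewrite addrAC mulNr subrr add0r.
have ev0 : Defs.meval (mC K m) a c = 0.
  by have [g' hg'] := @meval_rmorphism K S (mC K m) a d; rewrite c0 -hg' rmorph0.
rewrite ev0 addr0 in h; case: (primeP _ _ h) => [/IHp ->|//].
by rewrite c0 mul0r add0r.
Qed.

(** Descending the chain from [I] adds one independent element per inclusion. Independence modulo
    the lowest prime implies independence in the polynomial ring, where [m] is the bound. *)
Lemma prime_chain_indep (I : S -> Prop) h a d : prime_chain_to I h -> alg_indep I a d ->
  (d + h <= m)%N.
Proof.
move=> [Q [Qp Qs QI]] indI.
have {}indI : alg_indep (Q h) a d by move=> G /QI/indI.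
have [a' ind0] : exists a', alg_indep (Q 0%N) a' (d + h).
  suff gen j : (j <= h)%N -> exists a', alg_indep (Q (h - j)%N) a' (d + j).
    by have := gen h (leqnn h); rewrite subnn.
  elim: j => [|j IH] jh; first by rewrite subn0 addn0; exists a.
  have [a' ind] := IH (ltnW jh).
  have E : (h - j = (h - j.+1).+1)%N by rewrite -subSn // subSS.
  have lt : (h - j.+1 < h)%N by rewrite -E leq_subr.
  have [sub [f [Qf nf]]] := Qs _ lt; rewrite -E in sub Qf.
  exists (fun k => if k == (d + j)%N then f else a' k); rewrite addnS.
  have [Qid _ _] := Qp (h - j)%N (leq_subr _ _).
  exact: (alg_indep_step (Qp _ (ltnW lt)) Qid sub Qf nf ind).
have [[Q00 _ _] _ _] := Qp 0%N (leq0n _).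
apply: (@algebraic_independence_bound K m (d + h) (fun i => theta (a' i))) => G G0.
have : theta_inv G = 0; last by move/(congr1 (@theta K _)); rewrite theta_invK rmorph0.
apply: ind0; set x := Defs.meval _ _ _; suff -> : x = 0 by [].
apply: (@theta_inj K); rewrite rmorph0 -G0 /x.
have [g hg] := @meval_rmorphism K S (mC K m) a' (d + h).
rewrite -hg -[in RHS](theta_invK G).
apply: (@rmorphism_mpoly_ext K _ _ (@theta K m \o g)
  (mmap (@mpolyC m K) (fun i => theta (a' i)) \o @theta K (d + h))) => [c|k kn] /=.
  by rewrite hg meval_mC !theta_mC mmapC.
by rewrite hg meval_mX // (theta_mX K (Ordinal kn)) mmapX mmap1U.
Qed.

End PrimeChains.

(** * Binomial generators of toric ideals *)

Definition cbool (P : Prop) : bool := if excluded_middle_informative P then true else false.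

Lemma cboolP (P : Prop) : reflect P (cbool P).
Proof. by rewrite /cbool; case: excluded_middle_informative => h; constructor. Qed.

Lemma last_before_failure (P : nat -> Prop) h : P 0%N -> (forall k, P k -> (k <= h)%N) ->
  exists k, P k /\ ~ P k.+1.
Proof.
move=> P0 Ph; apply: NNPP => nex.
have Pall k : P k.
  by elim: k => // k IH; apply: NNPP => nP; apply: nex; exists k.
by have := Ph _ (Pall h.+1); rewrite ltnn.
Qed.

Section CoefficientSums.
Variables (K : fieldType) (n : nat).
Implicit Types (C : pred 'X_{1..n}) (f g : {mpoly K[n]}).

(** A linear functional. If [C] depends only on the degree in the edge semigroup, it factors through
    the toric map and so kills the toric ideal, see [csum_toric]. *)
Definition csum C f : K := \sum_(w <- msupp f | C w) f@_w.

Lemma csumE C f s : uniq s -> {subset msupp f <= s} -> csum C f = \sum_(w <- s | C w) f@_w.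
Proof.
move=> us sub; rewrite /csum [RHS](bigID (mem (msupp f))) /= [X in _ + X]big1 ?addr0; last first.
  by move=> w /andP[_]; rewrite -mcoeff_eq0 => /eqP.
rewrite -big_filter -[RHS]big_filter; apply: perm_big; apply: uniq_perm.
- by rewrite filter_uniq // msupp_uniq.
- by rewrite filter_uniq.
- by move=> w; rewrite !mem_filter -andbA; case: (C w) => //=; case: (boolP (w \in msupp f)) => // /sub ->.
Qed.

Lemma csum_is_linear C a f g : csum C (a *: f + g) = a * csum C f + csum C g.
Proof.
pose s := undup (msupp f ++ msupp g ++ msupp (a *: f + g)).
have us : uniq s by apply: undup_uniq.
have sub p : {subset msupp p <= msupp f ++ msupp g ++ msupp (a *: f + g)} ->
  {subset msupp p <= s} by move=> h w /h; rewrite mem_undup.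
rewrite !(@csumE C _ s) //; try by apply: sub => w; rewrite !mem_cat => ->; rewrite ?orbT.
by rewrite mulr_sumr -big_split /=; apply: eq_bigr => w _; rewrite mcoeffD mcoeffZ.
Qed.

Lemma csum0 C : csum C 0 = 0.
Proof. by rewrite /csum big1 // => w _; rewrite mcoeff0. Qed.

Lemma csumD C f g : csum C (f + g) = csum C f + csum C g.
Proof. by rewrite -[f]scale1r csum_is_linear mul1r scale1r. Qed.

Lemma csumZ C a f : csum C (a *: f) = a * csum C f.
Proof. by rewrite -[a *: f]addr0 csum_is_linear csum0 addr0. Qed.

Lemma csumB C f g : csum C (f - g) = csum C f - csum C g.
Proof. by rewrite csumD -scaleN1r csumZ mulN1r. Qed.

Lemma csum_sum C (I : Type) (r : seq I) (P : pred I) (F : I -> {mpoly K[n]}) :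
  csum C (\sum_(i <- r | P i) F i) = \sum_(i <- r | P i) csum C (F i).
Proof. by elim/big_rec2: _ => [|i y x _ <-]; rewrite ?csum0 ?csumD. Qed.

Lemma csumX C w : csum C 'X_[w] = (C w)%:R.
Proof.
rewrite /csum msuppX big_cons big_nil mcoeffX eqxx.
by case: (C w); rewrite ?addr0.
Qed.

Lemma csumXM C u f : csum C ('X_[u] * f) = csum (fun w => C (u + w)%MM) f.
Proof.
rewrite {1}[f]mpolyE mulr_sumr csum_sum [RHS]/csum [RHS]big_mkcond /=; apply: eq_bigr => w _.
rewrite -scalerAr csumZ -mpolyXD csumX.
by case: (C _); rewrite ?mulr1 ?mulr0.
Qed.

Lemma mcoeff0_split f : f@_0%MM = 0 -> exists F, f = \sum_(l < n) 'X_l * F l.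
Proof.
move=> f0; rewrite [f]mpolyE big_seq.
apply: (big_ind (fun p => exists F, p = \sum_(l < n) 'X_l * F l)).
- by exists (fun _ => 0); rewrite big1 // => l _; rewrite mulr0.
- move=> p q [F ->] [G ->]; exists (fun l => F l + G l).
  by rewrite -big_split; apply: eq_bigr => l _; rewrite mulrDr.
move=> w wf; have : w != 0%MM.
  by apply: contraTneq wf => ->; rewrite mcoeff_msupp f0 eqxx.
rewrite -mdeg_eq0 mdegE sum_nat_eq0 negb_forall => /existsP[l wl].
exists (fun j => if j == l then f@_w *: 'X_[w - U_(l)] else 0).
rewrite (bigD1 l) //= eqxx big1 ?addr0 => [|j /negPf->]; last by rewrite mulr0.
by rewrite -scalerAr -mpolyXD addmC submK // lep1mP.
Qed.

End CoefficientSums.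

Section ToricGeneral.
Variables (K : fieldType) (m n : nat) (em : 'I_m -> 'X_{1..n}).

Definition edeg (w : 'X_{1..m}) : 'X_{1..n} := (\sum_i em i *+ w i)%MM.

Lemma edegE w j : edeg w j = (\sum_i em i j * w i)%N.
Proof. by rewrite mnm_sumE; apply: eq_bigr => i _; rewrite mulmnE. Qed.

Lemma edegD u w : edeg (u + w)%MM = (edeg u + edeg w)%MM.
Proof.
apply/mnmP=> j; rewrite mnmDE !edegE -big_split; apply: eq_bigr => i _.
by rewrite mnmDE mulnDr.
Qed.

Lemma mdeg_edegE w : mdeg (edeg w) = (\sum_i mdeg (em i) * w i)%N.
Proof. by rewrite /edeg mdeg_sum; apply: eq_bigr => i _; rewrite mdegMn. Qed.

Definition toric_image (f : {mpoly K[m]}) : {mpoly K[n]} :=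
  \sum_(w <- msupp f) f@_w *: 'X_[edeg w].

Lemma toric_imageE f : toric_image f = mmap (@mpolyC n K) (fun i => 'X_[em i]) f.
Proof.
rewrite /toric_image /mmap; apply: eq_bigr => w _; rewrite mul_mpolyC; congr (_ *: _).
by rewrite /edeg /mmap1 mprodXnE.
Qed.

Lemma csum_toric (C : pred 'X_{1..n}) f :
  csum C (toric_image f) = csum (fun w => C (edeg w)) f.
Proof.
rewrite csum_sum [RHS]/csum [RHS]big_mkcond; apply: eq_bigr => w _.
by rewrite csumZ csumX; case: (C _); rewrite ?mulr1 ?mulr0.
Qed.

Definition in_toric f := toric_image f = 0.

Lemma in_toricD f g : in_toric f -> in_toric g -> in_toric (f + g).
Proof. by rewrite /in_toric !toric_imageE => h1 h2; rewrite rmorphD /= h1 h2 addr0. Qed.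
Lemma in_toricM f g : in_toric g -> in_toric (f * g).
Proof. by rewrite /in_toric !toric_imageE => h2; rewrite rmorphM /= h2 mulr0. Qed.
Lemma in_toric0 : in_toric 0.
Proof. by rewrite /in_toric toric_imageE rmorph0. Qed.

Definition bin (q : 'X_{1..m} * 'X_{1..m}) : {mpoly K[m]} := 'X_[q.1] - 'X_[q.2].

Lemma in_toric_bin q : edeg q.1 = edeg q.2 -> in_toric (bin q).
Proof.
rewrite /in_toric toric_imageE rmorphB /= -!toric_imageE /toric_image !msuppX !big_seq1.
by rewrite !mcoeffX !eqxx !scale1r => ->; rewrite subrr.
Qed.

(** Membership in the product of the ideal of all variables with the toric ideal. *)
Definition max_times_toric f := exists2 F, (forall j, in_toric (F j)) &
  f = \sum_(j < m) 'X_j * F j.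

Lemma max_times_toricZ a f : max_times_toric f -> max_times_toric (a *: f).
Proof.
move=> [F hF ->]; exists (fun j => a *: F j).
  by move=> j; rewrite -mul_mpolyC; apply: in_toricM.
by rewrite scaler_sumr; apply: eq_bigr => j _; rewrite scalerAr.
Qed.

Definition fiber_pairs k (b : nat -> 'X_{1..m} * 'X_{1..m}) :=
  forall i, (i < k)%N -> edeg (b i).1 = edeg (b i).2.

Definition indep_binomials k (b : nat -> 'X_{1..m} * 'X_{1..m}) :=
  forall c : nat -> K, max_times_toric (\sum_(i < k) c i *: bin (b i)) ->
  forall i, (i < k)%N -> c i = 0.

Lemma indep_binomials_le k b h (g : 'I_h -> {mpoly K[m]}) :
  (forall j, in_toric (g j)) ->
  (forall f, in_toric f -> exists c, f = \sum_j c j * g j) ->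
  fiber_pairs k b -> indep_binomials k b -> (k <= h)%N.
Proof.
move=> gI gen fib ind; rewrite leqNgt; apply/negP=> lt.
have /fin_all_exists[a ha] (i : 'I_k) : exists c, bin (b i) = \sum_j c j * g j.
  by apply: gen; apply: in_toric_bin; apply: fib.
have lt' : (#|'I_h| < #|'I_k|)%N by rewrite !card_ord.
have [c [[i0 ci0] hc]] := linear_dependency (fun i j => (a i j)@_0%MM) lt'.
pose c' i := if insub i is Some i' then c i' else 0.
have c'E (i : 'I_k) : c' i = c i.
  by rewrite /c' insubT // => lti; congr c; apply: val_inj.
suff : max_times_toric (\sum_(i < k) c' i *: bin (b i)).
  by move/ind/(_ i0 (ltn_ord _)); rewrite c'E => /eqP; rewrite (negPf ci0).
have /fin_all_exists[F hF] (j : 'I_h) :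
    exists F, \sum_(i < k) c i *: a i j = \sum_(l < m) 'X_l * F l.
  apply: mcoeff0_split; rewrite raddf_sum /= -[RHS](hc j); apply: eq_bigr => i _.
  by rewrite mcoeffZ.
exists (fun l => \sum_j F j l * g j).
  move=> l; apply: (big_ind in_toric); [exact: in_toric0|exact: in_toricD|].
  by move=> j _; apply: in_toricM.
transitivity (\sum_j (\sum_(i < k) c i *: a i j) * g j).
  under eq_bigr => i _ do rewrite c'E ha scaler_sumr.
  rewrite exchange_big; apply: eq_bigr => j _ /=; rewrite mulr_suml.
  by apply: eq_bigr => i _; rewrite scalerAl.
under eq_bigr => j _ do rewrite hF mulr_suml.
rewrite exchange_big; apply: eq_bigr => l _ /=; rewrite mulr_sumr.
by apply: eq_bigr => j _; rewrite mulrA.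
Qed.

Lemma exists_binomial_basis h (g : 'I_h -> {mpoly K[m]}) :
  (forall j, in_toric (g j)) ->
  (forall f, in_toric f -> exists c, f = \sum_j c j * g j) ->
  exists k b, [/\ (k <= h)%N, fiber_pairs k b, indep_binomials k b &
    forall u v, edeg u = edeg v -> exists c : nat -> K,
      max_times_toric (bin (u, v) - \sum_(i < k) c i *: bin (b i))].
Proof.
move=> gI gen.
have [k [[b [fib ind]] max]] := @last_before_failure
  (fun k => exists b, fiber_pairs k b /\ indep_binomials k b) h
  (ex_intro _ (fun _ => (0, 0)%MM) (conj (fun i (h : (i < 0)%N) => False_ind _ (notF h))
     (fun c _ i (h : (i < 0)%N) => False_ind _ (notF h))))
  (fun k '(ex_intro b (conj fb ib)) => indep_binomials_le gI gen fb ib).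
exists k, b; split=> //; first exact: indep_binomials_le gI gen fib ind.
move=> u v uv; pose b' i := if i == k then (u, v) else b i.
have fib' : fiber_pairs k.+1 b'.
  move=> i; rewrite ltnS leq_eqVlt /b'; case: eqP => //= _; exact: fib.
apply: NNPP => nc; apply: max; exists b'; split=> // c mt.
have b'b (i : 'I_k) : b' i = b i by rewrite /b' (ltn_eqF (ltn_ord i)).
have b'k : b' k = (u, v) by rewrite /b' eqxx.
rewrite big_ord_recr /= b'k in mt.
have bE : \sum_(i < k) c i *: bin (b' i) = \sum_(i < k) c i *: bin (b i).
  by apply: eq_bigr => i _; rewrite b'b.
rewrite bE in mt.
have ck : c k = 0.
  apply/eqP; apply/negPn/negP=> ck; apply: nc; exists (fun i => - (c k)^-1 * c i).
  have := max_times_toricZ (c k)^-1 mt; congr max_times_toric.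
  rewrite scalerDr scalerA mulVf // scale1r addrC; congr (_ + _).
  rewrite scaler_sumr -sumrN; apply: eq_bigr => i _.
  by rewrite scalerA mulNr scaleNr opprK.
rewrite ck scale0r addr0 in mt.
by move=> i; rewrite ltnS leq_eqVlt => /orP[/eqP->//|/(ind _ mt)].
Qed.

End ToricGeneral.

Lemma Posz_sum (I : finType) (F : I -> nat) : (\sum_i F i)%N%:Z = \sum_i (F i)%:Z.
Proof. exact: (big_morph Posz PoszD erefl). Qed.

(** * Connectivity of fibres and domination by the binomial exponents *)

Section Markov.
Variables (K : fieldType) (m n : nat) (em : 'I_m -> 'X_{1..n}).
Hypothesis em2 : forall i, mdeg (em i) = 2.
Variables (k : nat) (b : nat -> 'X_{1..m} * 'X_{1..m}).
Local Notation edeg := (edeg em).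
Hypothesis fib : fiber_pairs em k b.
Hypothesis ind : indep_binomials K em k b.
Hypothesis spans : forall u v, edeg u = edeg v -> exists c : nat -> K,
  max_times_toric em (bin K (u, v) - \sum_(i < k) c i *: bin K (b i)).

Inductive conn : 'X_{1..m} -> 'X_{1..m} -> Prop :=
| conn_refl u : conn u u
| conn_move i w : (i < k)%N -> conn (w + (b i).1)%MM (w + (b i).2)%MM
| conn_sym u v : conn u v -> conn v u
| conn_trans u v w : conn u v -> conn v w -> conn u w.

Lemma conn_edeg u v : conn u v -> edeg u = edeg v.
Proof.
elim=> // [i w ik|u' v' w _ -> _ ->//].
by rewrite !edegD fib.
Qed.

Lemma mdeg_edeg w : mdeg (edeg w) = (2 * mdeg w)%N.
Proof.
rewrite mdeg_edegE mdegE big_distrr; apply: eq_bigr => i _.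
by rewrite em2.
Qed.

Lemma edeg_mdeg u v : edeg u = edeg v -> mdeg u = mdeg v.
Proof. by move/(congr1 (@mdeg n)); rewrite !mdeg_edeg => /eqP; rewrite eqn_mul2l => /eqP. Qed.

Lemma conn_addl t u v : conn u v -> conn (t + u)%MM (t + v)%MM.
Proof.
elim=> [w|i w ik|u' v' _ h|u' v' w _ h1 _ h2]; first exact: conn_refl.
- by rewrite !addmA; apply: conn_move.
- exact: conn_sym.
- exact: conn_trans h1 h2.
Qed.

(* The sum of the coefficients over the class of u vanishes on the binomials of the
   basis and, by induction on the degree, on the maximal ideal times the toric ideal. *)
Lemma markov u v : edeg u = edeg v -> conn u v.
Proof.
have [d] := ubnP (mdeg u); elim: d u v => // d IH u v; rewrite ltnS => du uv.
have [c [F FI hF]] := spans uv.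
pose C w := cbool (conn u w).
suff : csum C (bin K (u, v)) = 0.
  rewrite csumB !csumX; have -> : C u by apply/cboolP; apply: conn_refl.
  by case: (boolP (C v)) => [/cboolP//|_] /eqP; rewrite subr0 oner_eq0.
rewrite -[bin K (u, v)](subrK (\sum_(i < k) c i *: bin K (b i))) hF csumD !csum_sum.
rewrite !big1 ?addr0 // => [i _|j _].
  rewrite csumZ csumB !csumX; suff -> : C (b i).1 = C (b i).2 by rewrite subrr mulr0.
  have h : conn (b i).1 (b i).2.
    by have := conn_move 0%MM (ltn_ord i); rewrite !add0m.
  by apply/cboolP/cboolP => h'; [apply: conn_trans h' h|apply: conn_trans h' (conn_sym h)].
rewrite csumXM.
(* By induction, exponents of equal degree are connected after removal of the variable [j]; so, on
   multiples of that variable, membership in the class of [u] depends on the degree only. *)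
pose C' beta := cbool (exists2 w, edeg w = beta & conn u (U_(j) + w)%MM).
have E w : C (U_(j) + w)%MM = C' (edeg w).
  apply/cboolP/cboolP => [h|[w0 w0w h]]; first by exists w.
  apply: (conn_trans h); apply: conn_addl; apply: IH => //.
  by have := edeg_mdeg (conn_edeg h); rewrite mdegD mdeg1 add1n => <-.
have := csum_toric em C' (F j); rewrite (FI j) csum0 => ->.
by apply: eq_bigl => w; rewrite E.
Qed.

Definition binrow (i : nat) (f : 'I_m) : int := ((b i).1 f)%:Z - ((b i).2 f)%:Z.

Definition edge_relation (w : 'I_m -> int) := forall j : 'I_n, \sum_f (em f j)%:Z * w f = 0.

Lemma relation_mnm (u v : 'X_{1..m}) :
  edeg u = edeg v <-> edge_relation (fun f => (u f)%:Z - (v f)%:Z).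
Proof.
have E j : \sum_f (em f j)%:Z * ((u f)%:Z - (v f)%:Z) = (edeg u j)%:Z - (edeg v j)%:Z.
  rewrite !edegE !Posz_sum -sumrB; by apply: eq_bigr => f _; rewrite mulrBr !PoszM.
split=> [uv j|h]; first by rewrite E uv subrr.
by apply/mnmP=> j; have := h j; rewrite E => /eqP; rewrite subr_eq0 => /eqP[].
Qed.

Lemma row_relation i : (i < k)%N -> edge_relation (binrow i).
Proof. by move=> ik; apply/relation_mnm; apply: fib. Qed.

Definition pos_part (w : 'I_m -> int) : 'X_{1..m} := [multinom `|Num.max (w f) 0|%N | f < m].

Lemma pos_partE w f : (pos_part w f)%:Z = Num.max (w f) 0.
Proof. by rewrite mnmE gez0_abs // le_max lexx orbT. Qed.

Lemma pos_partB w f : (pos_part w f)%:Z - (pos_part (fun f => - w f) f)%:Z = w f.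
Proof. by rewrite !pos_partE; lia. Qed.

Lemma relation_conn w : edge_relation w -> conn (pos_part w) (pos_part (fun f => - w f)).
Proof.
move=> h; apply: markov; apply/relation_mnm => j; rewrite -[RHS](h j).
by apply: eq_bigr => f _; rewrite pos_partB.
Qed.

Local Notation side := (sign_side (fun r : 'I_k => binrow r)).

(** A move by a row mixed on [S] has both ends nonzero on [S], and any other move does not change
    the entries in [S]. Vanishing on [S] is thus invariant along a connection, and such a connection
    uses only rows that are not mixed on [S]. *)
Lemma conn_face (S : {set 'I_m}) :
  (forall r : 'I_k, mixed side r S \/ forall f, f \in S -> binrow r f = 0) ->
  forall u v, conn u v ->
  ((forall f, f \in S -> u f = 0%N) <-> (forall f, f \in S -> v f = 0%N)) /\
  ((forall f, f \in S -> u f = 0%N) -> exists c : 'I_k -> int,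
     (forall r, mixed side r S -> c r = 0) /\
     forall f, (u f)%:Z - (v f)%:Z = \sum_r c r * binrow r f).
Proof.
move=> dich u v; elim=> {u v} [u|i w ik|u v _ [h1 h2]|u v w _ [h1 h2] _ [h3 h4]].
- split=> // _; exists (fun _ => 0); split=> // f; rewrite subrr big1 // => r _; exact: mul0r.
- have [mx|z] := dich (Ordinal ik).
    have /mixedP mx' := mx.
    suff [n1 n2] : ~ (forall f, f \in S -> (w + (b i).1)%MM f = 0%N) /\
        ~ (forall f, f \in S -> (w + (b i).2)%MM f = 0%N) by split.
    split=> h.
      have [f] := mx' true; rewrite inE /binrow /= => fp /h; rewrite mnmDE; move: fp; clear; lia.
    have [f] := mx' false; rewrite inE /binrow /= => fp /h; rewrite mnmDE; move: fp; clear; lia.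
  have eqS f : f \in S -> (w + (b i).1)%MM f = (w + (b i).2)%MM f.
    by move=> /z; rewrite /binrow /= !mnmDE; clear; lia.
  split; first by split=> h f fS; [rewrite -eqS|rewrite eqS] => //; apply: h.
  move=> h; exists (fun r => (r == Ordinal ik)%:R); split=> [r /mixedP mx|f].
    case: eqP => // E; have [f] := mx true; rewrite inE E => + /z.
    by move=> + E0; rewrite E0 ltxx.
  rewrite (bigD1 (Ordinal ik)) //= eqxx mul1r big1 => [|r /negPf->]; last exact: mul0r.
  by rewrite addr0 /binrow !mnmDE; clear; lia.
- split; first by split=> h; apply/h1.
  move=> /h1/h2[c [c1 c2]]; exists (fun r => - c r); split=> [r /c1->|f]; first exact: oppr0.
  rewrite -opprB c2 -sumrN; by apply: eq_bigr => r _; rewrite mulNr.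
- split; first by split=> h; [apply/h3/h1|apply/h1/h3].
  move=> h; have [c [c1 c2]] := h2 h; have [d [d1 d2]] := h4 (h1.1 h).
  exists (fun r => c r + d r); split=> [r mx|f]; first by rewrite c1 // d1 // addr0.
  have -> : (u f)%:Z - (w f)%:Z = ((u f)%:Z - (v f)%:Z) + ((v f)%:Z - (w f)%:Z).
    by clear; lia.
  by rewrite c2 d2 -big_split; apply: eq_bigr => r _; rewrite mulrDl.
Qed.

Definition indep_edges (A : {set 'I_m}) :=
  forall w, edge_relation w -> (forall f, f \notin A -> w f = 0) -> forall f, w f = 0.

Lemma bin_neq i : (i < k)%N -> (b i).1 != (b i).2.
Proof.
move=> ik; apply/eqP=> E; have := ind (c := fun j => (j == i)%:R) _ ik.
rewrite eqxx => /(_ _)/eqP; rewrite oner_eq0 => h; apply: notF; apply: h.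
exists (fun _ => 0); first by move=> j; apply: in_toric0.
rewrite [RHS]big1 => [|j _]; last exact: mulr0.
rewrite big1 // => j _; case: eqP => [->|_]; last by rewrite scale0r.
by rewrite /bin E subrr scaler0.
Qed.

(** Each edge has degree 2, so the entries of a relation sum to zero; a nonzero row must take both
    signs. *)
Lemma row_sides : nonempty_sides setT side.
Proof.
move=> r c _; have rel := row_relation (ltn_ord r).
have sum0 : \sum_f binrow r f = 0.
  have : \sum_(j < n) \sum_f (em f j)%:Z * binrow r f = 0 by apply: big1.
  rewrite exchange_big /=; under eq_bigr => f _ do rewrite -mulr_suml.
  have E f : \sum_(j < n) (em f j)%:Z = 2.
    by rewrite -Posz_sum -mdegE em2.
  under eq_bigr => f _ do rewrite E.
  by rewrite -mulr_sumr => /eqP; rewrite mulf_eq0 => /eqP.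
have nz : exists f, binrow r f != 0.
  have := bin_neq (ltn_ord r) => ne; apply/existsP; apply: contraNT ne => /existsPn h.
  apply/eqP/mnmP=> f; have := h f; rewrite negbK /binrow subr_eq0 => /eqP[].
  by [].
have [/existsP ex|/existsPn no] := boolP [exists f, f \in side r c]; first exact/set0Pn.
exfalso; have [f nf] := nz; case/eqP: nf.
case: c no => no.
  have le0 g : 0 <= - binrow r g by rewrite oppr_ge0 leNgt; have := no g; rewrite inE.
  have s0 : \sum_g - binrow r g = 0 by rewrite sumrN sum0 oppr0.
  have : - binrow r f = 0 by apply: (psumr_eq0P (fun g _ => le0 g) s0).
  by move/eqP; rewrite oppr_eq0 => /eqP.
have le0 g : 0 <= binrow r g by rewrite leNgt; have := no g; rewrite inE.
by apply: (psumr_eq0P (fun g _ => le0 g) sum0).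
Qed.

Hypothesis rank_bound : forall A, indep_edges A -> (#|A| + k <= m)%N.

Lemma max_indep_edges (F : {set 'I_m}) : exists E0 : {set 'I_m}, [/\ E0 \subset F,
  indep_edges E0 & forall f, f \in F -> f \notin E0 -> ~ indep_edges (f |: E0)].
Proof.
pose ok (A : {set 'I_m}) := (A \subset F) && cbool (indep_edges A).
have ok0 : ok set0.
  rewrite /ok sub0set; apply/cboolP => w _ h f; apply: h; by rewrite inE.
have [E0 /andP[sub /cboolP i0] max] := @arg_maxnP _ set0 ok (fun A => #|A|) ok0.
exists E0; split=> // f fF fE i1; have := max (f |: E0); rewrite /ok subUset sub1set fF sub.
have -> : cbool (indep_edges (f |: E0)) by apply/cboolP.
by move/(_ isT); rewrite /= cardsU1 fE add1n ltnn.
Qed.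

(** Let [S] be largest with at least [#|S|] mixed rows. A basis [E0] of the edges off [S] stays
    independent when an edge of [S] is added, so [#|E0|.+1 + k <= m]. But the relations off [S] are
    spanned by the at most [k - #|S|] rows not mixed on [S], so [m <= #|E0| + k]. *)
Lemma row_dominating : dominating setT side.
Proof.
move=> S0 S0n; rewrite ltnNge; apply/negP=> S0mu.
pose ok (S : {set 'I_m}) := (S != set0) && (#|S| <= mu setT side S)%N.
have ok0 : ok S0 by rewrite /ok S0n.
have [S /andP[Sn Smu] max] := @arg_maxnP _ S0 ok (fun A => #|A|) ok0.
(* A row with just one sign on [S] would become mixed after adding to [S] a column of the other
   sign, contradicting maximality. *)
have dich (r : 'I_k) : mixed side r S \/ forall f, f \in S -> binrow r f = 0.
  case: (boolP (mixed side r S)) => [|nm]; [by left|right=> f fS].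
  apply/eqP/negPn/negP=> rf.
  have [c fc] : exists c, f \in side r c.
    by apply/row_suppP; rewrite row_supp_sign.
  have [g gc] : exists g, g \in side r (~~ c) by apply/set0Pn; apply: row_sides.
  have gS : g \notin S.
    apply: contra nm => gS; apply/mixedP=> d; case: (eqVneq d c) => [->|dc]; first by exists f.
    by exists g => //; have -> : d = ~~ c by case: (d) (c) dc => [] [].
  have := max (g |: S); rewrite /= /ok cardsU1 gS add1n ltnn => h.
  have /h : (g |: S != set0) && (#|S| < mu setT side (g |: S))%N; last by [].
  apply/andP; split; first by apply/set0Pn; exists g; rewrite !inE eqxx.
  apply: leq_ltn_trans Smu _; apply: proper_card; apply/properP; split.
    apply/subsetP=> r'; rewrite !inE /=; apply: mixed_mono => d x xd xS.
    by split=> //; rewrite inE xS orbT.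
  exists r; rewrite !inE //=; apply/mixedP=> d; case: (eqVneq d c) => [->|dc].
    by exists f; rewrite // inE fS orbT.
  exists g; last by rewrite !inE eqxx.
  by have -> : d = ~~ c by case: (d) (c) dc => [] [].
have face := conn_face dich.
have supp0 w : (forall f, f \in S -> w f = 0) -> forall f, f \in S -> pos_part w f = 0%N.
  by move=> h f fS; have := pos_partE w f; rewrite h // maxxx => -[].
have [E0 [E0F i0 max0]] := max_indep_edges (~: S).
have [j jS] : exists j, j \in S by apply/set0Pn.
have jE0 : j \notin E0 by apply: contraTN jS => /(subsetP E0F); rewrite inE.
(* In a relation on [j |: E0] with nonzero entry at [j], one of the positive and negative parts
   vanishes on [S] and the other does not, which [conn_face] forbids. *)
have ij : indep_edges (j |: E0).
  move=> w rw sw; have [wj|wj] := eqVneq (w j) 0.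
    apply: i0 => // f fE; case: (eqVneq f j) => [->//|fj]; apply: sw.
    by rewrite !inE negb_or fj.
  exfalso.
  have off f : f \in S -> f != j -> w f = 0.
    move=> fS fj; apply: sw; rewrite !inE negb_or fj /=.
    by apply: contraTN fS => /(subsetP E0F); rewrite inE.
  have [cf _] := face _ _ (relation_conn rw).
  have zero (x : 'I_m -> int) : (forall f, f \in S -> f != j -> x f = 0) -> x j <= 0 ->
      forall f, f \in S -> pos_part x f = 0%N.
    move=> h xj f fS; have := pos_partE x f; case: (eqVneq f j) => [->|fj].
      by rewrite max_r // => -[].
    by rewrite (h _ fS fj) maxxx => -[].
  have nonz (x : 'I_m -> int) : (forall f, f \in S -> pos_part x f = 0%N) -> x j <= 0.
    by move=> h; have := pos_partE x j; rewrite (h _ jS) => /esym/eqP; rewrite eq_maxr.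
  case: (ltgtP (w j) 0) wj => // wj _.
    have h1 : w j <= 0 by apply: ltW.
    have := nonz _ (cf.1 (zero _ off h1)); move: wj; clear; lia.
  have h1 : - w j <= 0 by rewrite oppr_le0 ltW.
  have off' f : f \in S -> f != j -> - w f = 0 by move=> fS fj; rewrite off // oppr0.
  have := nonz _ (cf.2 (zero _ off' h1)); move: wj; clear; lia.
have b1 : (#|E0|.+1 + k <= m)%N by have := rank_bound ij; rewrite cardsU1 jE0 add1n.
pose R := [set r : 'I_k | mixed side r S].
have muR : mu setT side S = #|R| by apply: eq_card => r; rewrite !inE.
(* Each edge off [S] and outside [E0] has a relation supported on it and [E0]. These relations are
   independent and, by [conn_face], combinations of the rows in [~: R]. *)
have b2 : (#|~: S :\: E0| <= #|~: R|)%N.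
  rewrite leqNgt; apply/negP=> lt.
  have /fin_all_exists[w hw] (x : {f | f \in ~: S :\: E0}) : exists w : 'I_m -> int,
      [/\ edge_relation w, (forall f, f \notin val x |: E0 -> w f = 0) & w (val x) != 0].
    case: x => f /= /setDP[fS fE]; apply: NNPP => nex; apply: (max0 f fS fE) => w rw sw.
    apply: i0 => // g gE; case: (eqVneq g f) => [->|gf]; last by apply: sw; rewrite !inE negb_or gf.
    by apply/eqP/negPn/negP=> wf; apply: nex; exists w.
  have /fin_all_exists[c hc] (x : {f | f \in ~: S :\: E0}) : exists c : 'I_k -> int,
      (forall r, r \in R -> c r = 0) /\ forall f, w x f = \sum_r c r * binrow r f.
    have [rw sw _] := hw x.
    have [_ /(_ _)[]] := face _ _ (relation_conn rw).
      apply: supp0 => f fS; apply: sw; rewrite !inE negb_or.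
      have /setDP[xS _] := valP x; apply/andP; split.
        by apply: contraTneq fS => ->; move: xS; rewrite inE.
      by apply: contraTN fS => /(subsetP E0F); rewrite inE.
    move=> c [c1 c2]; exists c; split=> [r|f]; first by rewrite inE => /c1.
    by rewrite -c2 pos_partB.
  have lt' : (#|{: {r | r \in ~: R}}| < #|{: {f | f \in ~: S :\: E0}}|)%N.
    by rewrite !card_sig.
  have [l [[x0 lx0] hl]] := linear_dependency
    (fun (x : {f | f \in ~: S :\: E0}) (r : {r | r \in ~: R}) => ((c x (val r))%:~R : rat)) lt'.
  have hl' r : \sum_x l x * (c x r)%:~R = 0.
    case: (boolP (r \in ~: R)) => rR; first by rewrite -[RHS](hl (Sub r rR)).
    rewrite inE negbK in rR; apply: big1 => x _; have [-> //] := hc x; by rewrite mulr0.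
  have : \sum_x l x * (w x (val x0))%:~R = 0.
    transitivity (\sum_x \sum_r l x * ((c x r)%:~R * (binrow r (val x0))%:~R)).
      apply: eq_bigr => x _; rewrite (hc x).2 rmorph_sum mulr_sumr.
      by apply: eq_bigr => r _; rewrite rmorphM.
    rewrite exchange_big big1 // => r _.
    by under eq_bigr => x _ do rewrite mulrA; rewrite -mulr_suml hl' mul0r.
  rewrite (bigD1 x0) //= big1 => [|x xx0].
    rewrite addr0 => /eqP; rewrite mulf_eq0 (negPf lx0) intr_eq0 /=.
    by have [_ _ /negPf->] := hw x0.
  have [_ sw _] := hw x; rewrite sw ?mulr0 //; rewrite !inE negb_or.
  have /setDP[_ ->] := valP x0; rewrite andbT.
  by apply: contra xx0 => /eqP E; apply/eqP/val_inj.
have b3 : #|~: S| = (#|E0| + #|~: S :\: E0|)%N.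
  by rewrite -(cardsID E0 (~: S)) (setIidPr E0F).
have b4 : (#|S| + #|~: S| = m)%N by rewrite cardsC card_ord.
have b5 : (#|R| + #|~: R| = k)%N by rewrite cardsC card_ord.
move: Smu b1 b2 b3 b4 b5; rewrite muR; clear. move: #|S| #|R| #|~: S| #|~: R| #|E0| #|~: S :\: E0|. lia.
Qed.

Lemma row_generates (w : 'I_m -> int) : edge_relation w ->
  exists c : 'I_k -> int, forall f, w f = \sum_r c r * binrow r f.
Proof.
move=> rw; have dich (r : 'I_k) : mixed side r set0 \/ forall f, f \in set0 -> binrow r f = 0.
  by right=> f; rewrite inE.
have [_ /(_ _)[]] := conn_face dich (relation_conn rw); first by move=> f; rewrite inE.
by move=> c [_ h]; exists c => f; rewrite -h pos_partB.
Qed.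

End Markov.

(** * The edge ideal *)

Section EdgeIdeal.
Variables (K : fieldType) (T : finType) (e : rel T).
Hypothesis simple : simple_graph e.
Local Notation m := #|edge_set e|.
Local Notation n := #|T|.

Definition edge_at (i : 'I_m) : {set T} := enum_val i.

Lemma edge_atP i : exists x y, edge_at i = [set x; y] /\ e x y.
Proof.
have /imset2P[x y _] := enum_valP i; rewrite inE => /andP[_ xy] E.
by exists x, y; rewrite /edge_at E.
Qed.

Lemma edge_at_inj : injective edge_at.
Proof. exact: enum_val_inj. Qed.

Lemma card_edge_at i : #|edge_at i| = 2.
Proof.
have [x [y [-> xy]]] := edge_atP i; rewrite cards2; case: eqP => // E.
by move: xy; rewrite E simple.2.
Qed.

Lemma edge_at_surj x y : e x y -> exists i, edge_at i = [set x; y].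
Proof.
move=> xy; have xyE : [set x; y] \in edge_set e.
  by apply/imset2P; exists x y; rewrite ?inE.
by exists (enum_rank_in xyE [set x; y]); rewrite /edge_at enum_rankK_in.
Qed.

Lemma erel_edge_at x y : erel edge_at setT x y = e x y.
Proof.
apply/erelP/idP => [[f _ E]|/edge_at_surj[i Ei]]; last by exists i.
have [a [b [E' ab]]] := edge_atP f; have xy : x != y.
  by have := card_edge_at f; rewrite E cards2; case: (x != y).
rewrite E in E'; have xi : x \in [set a; b] by rewrite -E' !inE eqxx.
have yi : y \in [set a; b] by rewrite -E' !inE eqxx orbT.
move: xi yi xy; rewrite !inE => /orP[]/eqP-> /orP[]/eqP->; rewrite ?eqxx // => _.
by rewrite simple.1.
Qed.

Definition edge_mnm (i : 'I_m) : 'X_{1..n} := [multinom (enum_val j \in edge_at i : nat) | j < n].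

Lemma mdeg_edge_mnm i : mdeg (edge_mnm i) = 2.
Proof.
rewrite mdegE; under eq_bigr => j _ do rewrite mnmE.
rewrite -[RHS](card_edge_at i) -sum1_card [RHS]big_mkcond /=.
rewrite [RHS](reindex (@enum_val T (mem T))) /=; last first.
  by exists enum_rank => x _; rewrite ?enum_valK ?enum_rankK.
by apply: eq_bigr => j _; case: (_ \in _).
Qed.

Lemma theta_edge_mon (i : 'I_m) : theta (edge_mon K e i) = 'X_[edge_mnm i].
Proof.
have -> : edge_mon K e i = \prod_(v in edge_at i) vvar K v.
  by rewrite /edge_mon /nth_edge valK.
rewrite rmorph_prod /=.
under eq_bigr => v _ do rewrite /vvar theta_mX.
rewrite mprodXE; congr 'X_[_]; apply/mnmP=> j; rewrite mnmE mnm_sumE.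
under eq_bigr => v _ do rewrite mnm1E.
case: (boolP (enum_val j \in edge_at i)) => h.
  rewrite (bigD1 (enum_val j)) //= enum_valK eqxx big1 // => v /andP[_ vj].
  by apply/eqP; rewrite eqb0; apply: contra vj => /eqP <-; rewrite enum_rankK.
apply: big1 => v vi; apply/eqP; rewrite eqb0; apply: contra h => /eqP <-.
by rewrite enum_rankK.
Qed.

Lemma edge_map_rmorphism : exists f : {rmorphism Defs.mpoly K m -> Defs.mpoly K n},
  f =1 edge_map K e.
Proof. exact: (@meval_rmorphism K (Defs.mpoly K n) (mC K n) (edge_mon K e) m). Qed.

Lemma edge_map_mX (i : 'I_m) : edge_map K e (Defs.mX K m i) = edge_mon K e i.
Proof. exact: (@meval_mX K (Defs.mpoly K n) (mC K n) (edge_mon K e) m). Qed.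

Lemma edge_map_mC c : edge_map K e (mC K m c) = mC K n c.
Proof. exact: (@meval_mC K (Defs.mpoly K n) (mC K n) (edge_mon K e) m). Qed.

Lemma theta_edge_map p : theta (edge_map K e p) = toric_image edge_mnm (theta p).
Proof.
have [f hf] := edge_map_rmorphism; rewrite toric_imageE -hf.
apply: (@rmorphism_mpoly_ext K _ _ (@theta K n \o f)
  (mmap (@mpolyC n K) (fun i => 'X_[edge_mnm i]) \o @theta K m)) => [c|k km] /=.
  by rewrite hf edge_map_mC !theta_mC mmapC.
by rewrite hf (edge_map_mX (Ordinal km)) (theta_mX K (Ordinal km)) mmapX mmap1U theta_edge_mon.
Qed.

Lemma toric_idealP p : toric_ideal K e p <-> in_toric edge_mnm (theta p).
Proof.
rewrite /in_toric -theta_edge_map /toric_ideal; split=> [->|h]; first exact: rmorph0.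
by apply: (@theta_inj K); rewrite rmorph0.
Qed.

Lemma toric_ideal_prime : is_prime_ideal (toric_ideal K e).
Proof.
have [f hf] := edge_map_rmorphism; rewrite /toric_ideal; split.
- split; first by rewrite -hf rmorph0.
    by move=> x y; rewrite -!hf rmorphD => -> ->; rewrite addr0.
  by move=> r x; rewrite -!hf rmorphM => ->; rewrite mulr0.
- by rewrite -hf rmorph1 => /eqP; rewrite oner_eq0.
- by move=> x y; rewrite -!hf rmorphM => /eqP; rewrite mulf_eq0 => /orP[]/eqP; [left|right].
Qed.

Lemma csum_pred1 (l : nat) (f : {mpoly K[l]}) w0 : csum (pred1 w0) f = f@_w0.
Proof.
rewrite /csum; have [w0f|w0f] := boolP (w0 \in msupp f).
  rewrite (big_rem w0) //= eqxx big1_seq ?addr0 // => w /andP[/= /eqP->].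
  by rewrite mem_rem_uniq ?msupp_uniq // !inE eqxx.
by rewrite big1_seq ?(memN_msupp_eq0 w0f) // => w /andP[/= /eqP->]; rewrite (negPf w0f).
Qed.

(** For independent edges, distinct monomials in their variables have distinct images under the
    toric map; these variables are thus algebraically independent modulo the toric ideal, and
    [prime_chain_indep] applies. *)
Lemma edge_rank_bound h A : prime_chain_to (toric_ideal K e) h ->
  indep_edges edge_mnm A -> (#|A| + h <= m)%N.
Proof.
move=> chain indA.
pose a k := if insub k is Some i then Defs.mX K m (@enum_val _ (mem A) i) else 0.
apply: (prime_chain_indep (a := a) chain) => G hG.
pose em' (i : 'I_#|A|) := edge_mnm (@enum_val _ (mem A) i).
have [f hf] := edge_map_rmorphism.
have [g hg] := @meval_rmorphism K (Defs.mpoly K m) (mC K m) a #|A|.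
have im0 : toric_image em' (theta G) = 0.
  transitivity (theta (f (g G))); last by rewrite hg hf hG rmorph0.
  rewrite toric_imageE; apply/esym.
  apply: (@rmorphism_mpoly_ext K _ _ (@theta K n \o (f \o g))
    (mmap (@mpolyC n K) (fun i => 'X_[em' i]) \o @theta K #|A|)) => [c|k km] /=.
    by rewrite hg meval_mC hf edge_map_mC !theta_mC mmapC.
  rewrite hg meval_mX // (theta_mX K (Ordinal km)) mmapX mmap1U /a insubT.
  by rewrite hf edge_map_mX theta_edge_mon.
have inj w w' : edeg em' w = edeg em' w' -> w = w'.
  move/relation_mnm => rel.
  pose x f := \sum_(i < #|A|) (enum_val i == f)%:R * ((w i)%:Z - (w' i)%:Z).
  have xE i : x (enum_val i) = (w i)%:Z - (w' i)%:Z.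
    rewrite /x (bigD1 i) //= eqxx mul1r big1 ?addr0 // => j ji.
    by rewrite (inj_eq enum_val_inj) (negPf ji) mul0r.
  have x0 : forall f, x f = 0.
    apply: indA => [j|i iA].
      rewrite -[RHS](rel j) /x; under eq_bigr => i _ do rewrite mulr_sumr.
      rewrite exchange_big /=; apply: eq_bigr => i _; rewrite (bigD1 (enum_val i)) //= eqxx mul1r.
      rewrite big1 ?addr0 // => i' ii'; rewrite eq_sym (negPf ii') mul0r mulr0 //.
    rewrite /x big1 // => j _; case: eqP => [E|]; last by rewrite mul0r.
    by case/negP: iA; rewrite -E; apply: enum_valP.
  apply/mnmP=> i; have := x0 (enum_val i); rewrite xE => /eqP.
  by rewrite subr_eq0 => /eqP[].
apply: (@theta_inj K); rewrite rmorph0; apply/mpolyP=> w0; rewrite mcoeff0 -csum_pred1.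
transitivity (csum (fun w => pred1 (edeg em' w0) (edeg em' w)) (theta G)).
  by apply: eq_bigl => w /=; apply/eqP/eqP => [->//|/inj].
by rewrite -csum_toric im0 csum0.
Qed.

Lemma relation_bd w : edge_relation edge_mnm w <-> forall v, bd edge_at setT w v = 0.
Proof.
have E (j : 'I_n) : \sum_f (edge_mnm f j)%:Z * w f = bd edge_at setT w (enum_val j).
  rewrite /bd big_mkcond [RHS]big_mkcond; apply: eq_bigr => f _; rewrite mnmE inE /=.
  by case: (_ \in _); rewrite ?mul1r ?mul0r.
split=> h; first by move=> v; rewrite -(enum_rankK v) -E.
by move=> j; rewrite E.
Qed.

Lemma generated_toric gs : generated_by (toric_ideal K e) gs ->
  (forall j : 'I_(size gs), in_toric edge_mnm (theta gs`_j)) /\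
  forall f, in_toric edge_mnm f -> exists c, f = \sum_(j < size gs) c j * theta gs`_j.
Proof.
move=> gen; split=> [j|f].
  apply/toric_idealP; apply/gen; exists (mkseq (fun i => (i == j)%:R) (size gs)).
  rewrite size_mkseq; split=> //; rewrite (bigD1 j) //= nth_mkseq // eqxx mul1r big1 ?addr0 // => i ij.
  by rewrite nth_mkseq // -val_eqE in ij *; rewrite (negPf ij) mul0r.
rewrite -[f](theta_invK) => /toric_idealP/gen[cs [_ ->]].
exists (fun j => theta cs`_j); rewrite rmorph_sum; apply: eq_bigr => j _.
by rewrite rmorphM.
Qed.

Lemma walk_avoiding v x y : connect (del_vertex e v) x y -> x != v ->
  exists s, [/\ path e x s, last x s = y & v \notin x :: s].
Proof.
case/connectP=> s ps -> xv; exists s; split=> //.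
  by apply: sub_path ps => a b /and3P[].
elim: s x xv ps => [|z s IH] x xv /=; first by rewrite inE eq_sym.
case/andP=> /and3P[_ _ zv] /(IH _ zv) h; rewrite inE negb_or eq_sym xv.
exact: h.
Qed.

Lemma odd_cycle_condition_of_complete_intersection :
  biconnected e -> complete_intersection_graph K e -> odd_cycle_condition e.
Proof.
move=> [_ nocut] [h [[chain _] [gs [sgs gen]]]] c1 c2.
(* The toric ideal is among the primes containing it, so the height yields a chain ending at the
   ideal itself. *)
have {}chain := chain _ toric_ideal_prime (fun x hx => hx).
have [gI ggen] := generated_toric gen; rewrite sgs in gI ggen.
have [k [b [kh fib ind spans]]] := exists_binomial_basis gI ggen.
have rank_bound A : indep_edges edge_mnm A -> (#|A| + k <= m)%N.
  by move/(edge_rank_bound chain); apply: leq_trans; rewrite leq_add2l.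
case/and3P=> /and3P[s1 u1 cy1] ch1 o1 /and3P[/and3P[s2 u2 cy2] ch2 o2].
have [hh|nh] := boolP (has (mem c2) c1); [by left|right].
have [/existsP[x /existsP[y /and3P[]]]|nex] :=
  boolP [exists x, exists y, [&& x \in c1, y \in c2 & e x y]]; first by exists x, y.
exfalso.
have nocross x y f : x \in c1 -> y \in c2 -> edge_at f <> [set x; y].
  move=> xc yc E; case/negP: nex; apply/existsP; exists x; apply/existsP; exists y.
  by rewrite xc yc -erel_edge_at; apply/erelP; exists f.
have dc x : x \in c1 -> x \in c2 -> False.
  by move=> x1 x2; case/negP: nh; apply/hasP; exists x.
have chE c : chordless e c -> chordless_in edge_at c.
  move=> /forallP ch x y f xc yc E; have /forallP/(_ y)/implyP := ch x.
  rewrite xc yc -erel_edge_at => /(_ _)/orP[|/eqP|/eqP]; [|by left|by right].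
  by apply/erelP; exists f.
have two c v : uniq c -> (2 < size c)%N -> exists2 x : T, x \in c & x != v.
  case: c => [|x [|y c]] //= /andP[]; rewrite inE negb_or => /andP[xy _] _ _.
  have [xv|xv] := eqVneq x v; last by exists x; rewrite ?inE ?eqxx.
  by exists y; rewrite ?inE ?eqxx ?orbT // -xv eq_sym.
have eqe : erel edge_at setT =2 e by move=> x y; apply: erel_edge_at.
apply: (@not_two_linked T _ _ edge_at edge_at_inj card_edge_at (fun r : 'I_k => binrow b r)
  _ _ _ c1 c2 u1 u2 o1 o2 s1 dc (chE _ ch1) (chE _ ch2) nocross setT setT).
- move=> r; apply/relation_bd; exact: (row_relation fib).
- exact: (row_sides mdeg_edge_mnm fib ind).
- exact: (row_dominating mdeg_edge_mnm fib ind spans rank_bound).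
- split=> [r f _|w _ /relation_bd rw]; first by rewrite inE.
  have [c hc] := row_generates mdeg_edge_mnm fib spans rw.
  by exists c => f; rewrite hc; apply: eq_bigl => r; rewrite inE.
- split; [by rewrite (eq_cycle eqe)|by rewrite (eq_cycle eqe)|move=> v].
  have [x xc xv] := two c1 v u1 s1; have [y yc yv] := two c2 v u2 s2.
  have xy : connect (del_vertex e v) x y.
    by apply/negPn/negP=> nxy; apply: (nocut v); exists x, y.
  have [s [ps ls vs]] := walk_avoiding xy xv; exists x, s; split=> //.
    by rewrite (eq_path eqe).
  by rewrite ls.
Qed.

End EdgeIdeal.

(** * Normality of the edge ring *)

Lemma tail_argmin (s : nat -> nat) N : exists i, (N <= i)%N /\ forall j, (N <= j -> s i <= s j)%N.
Proof.
suff gen k : forall i, (N <= i)%N -> (s i < k)%N -> exists i, (N <= i)%N /\ forall j, (N <= j -> s i <= s j)%N.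
  exact: (gen (s N).+1 N).
elim: k => // k IH i Ni; rewrite ltnS => sk.
have [[j [Nj lt]]|no] := excluded_middle_informative (exists j, (N <= j)%N /\ (s j < s i)%N).
  by apply: (IH j Nj); apply: leq_trans lt sk.
exists i; split=> // j Nj; rewrite leqNgt; apply/negP=> lt; apply: no; by exists j.
Qed.

Lemma nondecreasing_subsequence (s : nat -> nat) : exists g : nat -> nat,
  (forall i, g i < g i.+1)%N /\ forall i, (s (g i) <= s (g i.+1))%N.
Proof.
pose pick N := proj1_sig (constructive_indefinite_description _ (tail_argmin s N)).
have pickP N : (N <= pick N)%N /\ forall j, (N <= j -> s (pick N) <= s j)%N.
  exact: proj2_sig (constructive_indefinite_description _ (tail_argmin s N)).
pose g := fix g i := if i is i'.+1 then pick (g i').+1 else pick 0%N.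
have glt i : (g i < g i.+1)%N by have [] := pickP (g i).+1.
exists g; split=> // i; case: i => [|i]; first by apply: (pickP 0%N).2.
by apply: (pickP _).2; exact: ltn_trans (glt i) (glt i.+1).
Qed.

Lemma dickson m (s : nat -> 'X_{1..m}) : exists k k', (k < k')%N /\ forall f, (s k f <= s k' f)%N.
Proof.
suff [g [glt gle]] : exists g : nat -> nat, (forall i, g i < g i.+1)%N /\
    forall f i, f \in enum 'I_m -> (s (g i) f <= s (g i.+1) f)%N.
  by exists (g 0%N), (g 1%N); split=> // f; apply: gle; rewrite mem_enum.
elim: (enum 'I_m) => [|f r [g [glt gle]]]; first by exists id; split.
have [g' [lt' le']] := nondecreasing_subsequence (fun i => s (g i) f).
have gmono : {homo g : i j / (i < j)%N} by apply: homo_ltn => // x y z; apply: ltn_trans.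
have gmono' h i j : h \in r -> (i <= j)%N -> (s (g i) h <= s (g j) h)%N.
  move=> hr; apply: (@homo_leq _ (fun i => s (g i) h) leq) => //; last by move=> k; apply: gle.
  by move=> x y z; apply: leq_trans.
exists (g \o g'); split=> [i|h i] /=; first exact: gmono.
by rewrite inE => /orP[/eqP->//|hr]; apply: gmono' => //; apply: ltnW.
Qed.

Lemma exprM_div (F : fieldType) (A B : F) k : B != 0 -> B ^+ k * (A / B) ^+ k = A ^+ k.
Proof. by move=> B0; rewrite -exprMn mulrC divfK. Qed.

Section Normality.
Variables (K : fieldType) (T : finType) (e : rel T).
Hypothesis simple : simple_graph e.
Hypothesis occ : odd_cycle_condition e.
Local Notation m := #|edge_set e|.
Local Notation n := #|T|.
Local Notation em := (@edge_mnm T e).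

Definition semig (u : 'X_{1..n}) := exists w, u = edeg em w.

Lemma semigD u v : semig u -> semig v -> semig (u + v)%MM.
Proof. by move=> [w ->] [w' ->]; exists (w + w')%MM; rewrite edegD. Qed.

Lemma edeg0 : edeg em 0%MM = 0%MM.
Proof. by apply/mnmP=> j; rewrite edegE mnm0E big1 // => i _; rewrite mnm0E muln0. Qed.

Lemma semig0 : semig 0%MM.
Proof. by exists 0%MM; rewrite edeg0. Qed.

Lemma edegE_edges w v : edeg em w (enum_rank v) = (\sum_(f | v \in @edge_at T e f) w f)%N.
Proof.
rewrite edegE [RHS]big_mkcond; apply: eq_bigr => f _; rewrite mnmE enum_rankK.
by case: (_ \in _); rewrite ?mul1n ?mul0n.
Qed.

Lemma semig_saturated N u : (0 < N)%N -> semig (u *+ N)%MM -> ~~ odd (mdeg u) -> semig u.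
Proof.
move=> N0 [w hw] ev; pose U v := u (enum_rank v).
have UE v : (U v * N = \sum_(f | v \in @edge_at T e f) w f)%N.
  by rewrite -edegE_edges -hw mulmnE.
have eE : erel (@edge_at T e) setT = e.
  by do 2![apply: functional_extensionality => ?]; apply: erel_edge_at.
have [w' hw'] : semi (@edge_at T e) U.
  apply: (semi_saturated (@edge_at_inj T e) (card_edge_at simple)).
  - by rewrite eE.
  - exists (fun f => (w f)%:R / N%:R); split=> [f|v]; first by rewrite divr_ge0.
    rewrite -mulr_suml -natr_sum -UE natrM mulfK // pnatr_eq0 -lt0n //.
  - move: ev; rewrite mdegE; congr (~~ odd _); rewrite /tot.
    rewrite (reindex (@enum_rank T)) //=; exists enum_val => x _;
    by rewrite ?enum_valK ?enum_rankK.
exists [multinom w' f | f < m]; apply/mnmP=> j; rewrite -(enum_valK j) edegE_edges -/(U _) hw'.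
by apply: eq_bigr => f _; rewrite mnmE.
Qed.

Definition inA (a : {mpoly K[n]}) := forall u, u \in msupp a -> semig u.

Lemma inA0 : inA 0.
Proof. by move=> u; rewrite msupp0. Qed.

Lemma inAX u : semig u -> inA 'X_[u].
Proof. by move=> su v; rewrite msuppX inE => /eqP->. Qed.

Lemma inA1 : inA 1.
Proof. by rewrite -mpolyX0; apply: inAX; apply: semig0. Qed.

Lemma inAD a b : inA a -> inA b -> inA (a + b).
Proof. by move=> ha hb u /msuppD_le; rewrite mem_cat => /orP[/ha|/hb]. Qed.

Lemma inAM a b : inA a -> inA b -> inA (a * b).
Proof.
by move=> ha hb u /msuppM_le/allpairsP[[v w] /= [/ha sv /hb sw ->]]; apply: semigD.
Qed.

Lemma inAZ c a : inA a -> inA (c *: a).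
Proof. by move=> ha u /msuppZ_le /ha. Qed.

Lemma inAX_exp a k : inA a -> inA (a ^+ k).
Proof.
by move=> ha; elim: k => [|k IH]; [apply: inA1|rewrite exprS; apply: inAM].
Qed.

Lemma inA_sum (I : Type) (r : seq I) (P : pred I) (F : I -> {mpoly K[n]}) :
  (forall i, P i -> inA (F i)) -> inA (\sum_(i <- r | P i) F i).
Proof. by move=> h; apply: (big_ind inA); [apply: inA0|apply: inAD|apply: h]. Qed.

Lemma edge_ringP a : edge_ring K e a <-> inA (theta a).
Proof.
split=> [[f ->]|h].
  rewrite theta_edge_map //; apply: inA_sum => w _; apply: inAZ; apply: inAX.
  by exists w.
suff [g hg] : exists g, theta a = toric_image em g.
  by exists (theta_inv g); apply: (@theta_inj K); rewrite theta_edge_map // theta_invK.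
rewrite [theta a]mpolyE big_seq.
apply: (big_ind (fun p => exists g, p = toric_image em g)).
- by exists 0; rewrite toric_imageE rmorph0.
- by move=> p q [g ->] [g' ->]; exists (g + g'); rewrite !toric_imageE rmorphD.
- move=> u /h[w ->]; exists ((theta a)@_(edeg em w) *: 'X_[w]).
  rewrite toric_imageE mmapZ -toric_imageE mul_mpolyC; congr (_ *: _).
  by rewrite /toric_image msuppX big_seq1 mcoeffX eqxx scale1r.
Qed.

Lemma semig_mdeg_even u : semig u -> ~~ odd (mdeg u).
Proof.
move=> [w ->]; rewrite mdeg_edeg; last exact: mdeg_edge_mnm.
by rewrite oddM.
Qed.

Lemma lead_quotient (a b c : {mpoly K[n]}) : inA a -> inA b -> a != 0 -> b != 0 -> c != 0 ->
  (forall k, exists r, inA r /\ c * a ^+ k = b ^+ k * r) ->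
  exists u, semig u /\ (mlead a = mlead b + u)%MM.
Proof.
move=> ha hb a0 b0 c0 hk.
have lk k : exists s, (mlead c + mlead a *+ k = mlead b *+ k + edeg em s)%MM.
  have [r [rA E]] := hk k.
  have r0 : r != 0.
    by apply: contra_eq_neq E => ->; rewrite mulr0 mulf_neq0 // expf_neq0.
  have [s Es] := rA _ (mlead_supp r0); exists s; rewrite -Es -!mleadX //.
  by rewrite -!mleadM ?expf_neq0 // E.
pose s k := proj1_sig (constructive_indefinite_description _ (lk k)).
have sP k : (mlead c + mlead a *+ k = mlead b *+ k + edeg em (s k))%MM.
  exact: proj2_sig (constructive_indefinite_description _ (lk k)).
have [k [k' [lt le]]] := dickson s.
have /submK Es : (s k <= s k')%MM by apply/mnm_lepP.
set d := (s k' - s k)%MM in Es.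
have key j : (mlead a j * (k' - k) = mlead b j * (k' - k) + edeg em d j)%N.
  have := congr1 (fun u : 'X_{1..n} => u j) (sP k).
  have := congr1 (fun u : 'X_{1..n} => u j) (sP k').
  rewrite -Es edegD !mnmDE !mulmnE; move: lt; clear => lt.
  by rewrite !mulnBr; have := leq_mul (leqnn (mlead a j)) (ltnW lt);
    have := leq_mul (leqnn (mlead b j)) (ltnW lt); lia.
have kpos : (0 < k' - k)%N by rewrite subn_gt0.
have ba : (mlead b <= mlead a)%MM.
  by apply/mnm_lepP=> j; rewrite -(leq_pmul2r kpos) key leq_addr.
exists (mlead a - mlead b)%MM; split; last by rewrite addmC submK.
apply: (semig_saturated kpos).
  by exists d; apply/mnmP=> j; rewrite mulmnE mnmBE mulnBl key addKn.
have ea := semig_mdeg_even (ha _ (mlead_supp a0)).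
have eb := semig_mdeg_even (hb _ (mlead_supp b0)).
by move: ea; rewrite -{1}(submK ba) mdegD oddD (negPf eb) addbF.
Qed.

(** Division by [b] inside the edge ring, by well-founded induction on the leading monomial of [a];
    [lead_quotient] keeps each quotient term in the ring. *)
Lemma divisible_of_almost_integral (a b c : {mpoly K[n]}) : inA a -> inA b -> b != 0 -> c != 0 ->
  (forall k, exists r, inA r /\ c * a ^+ k = b ^+ k * r) -> exists q, inA q /\ a = b * q.
Proof.
move=> + hb b0 c0; have [M] : exists M, M = mlead a by exists (mlead a).
elim/(well_founded_ind (@ltom_wf n)): M a => M IH a EM ha hk.
have [->|a0] := eqVneq a 0; first by exists 0; rewrite mulr0; split=> //; apply: inA0.
have [u [su lu]] := lead_quotient ha hb a0 b0 c0 hk.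
pose t := (mleadc a / mleadc b) *: 'X_[u].
have tA : inA t by apply: inAZ; apply: inAX.
pose a' := a - t * b.
have a'A : inA a'.
  by apply: inAD => //; rewrite -scaleN1r; apply: inAZ; apply: inAM.
(* The same [c] serves for [a - t * b]: in the binomial expansion the factor [b ^+ i] completes
   [b ^+ (k - i)] to [b ^+ k]. *)
have hk' k : exists r, inA r /\ c * a' ^+ k = b ^+ k * r.
  pose r i := proj1_sig (constructive_indefinite_description _ (hk i)).
  have rP i : inA (r i) /\ c * a ^+ i = b ^+ i * r i.
    exact: proj2_sig (constructive_indefinite_description _ (hk i)).
  exists (\sum_(i < k.+1) (r (k - i)%N * (- t) ^+ i) *+ 'C(k, i)); split.
    apply: inA_sum => i _; rewrite -scaler_nat; apply: inAZ; apply: inAM.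
      by have [] := rP (k - i)%N.
    by apply: inAX_exp; rewrite -scaleN1r; apply: inAZ.
  rewrite /a' -mulNr exprDn !mulr_sumr; apply: eq_bigr => i _.
  rewrite [LHS]mulrnAr [RHS]mulrnAr; congr (_ *+ _).
  rewrite exprMn [c * (_ * _)]mulrA (rP _).2.
  have -> : b ^+ k = b ^+ (k - i) * b ^+ i by rewrite -exprD subnK // -ltnS.
  ring.
have [a'0|a'0] := eqVneq a' 0.
  by exists t; split=> //; move/eqP: a'0; rewrite subr_eq0 mulrC => /eqP.
have lt : (mlead a' < M)%O.
  rewrite EM lt_neqAle; apply/andP; split; last first.
    apply: le_trans (mleadB_le _ _) _; rewrite leUx lexx /=.
    apply: le_trans (mleadM_le _ _) _; rewrite lu addmC lemc_add2r.
    by apply: le_trans (mleadZ_le _ _) _; rewrite mleadXm.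
  apply/eqP=> E; have : a'@_(mlead a') != 0 by rewrite mleadc_eq0.
  rewrite E /a' mcoeffB {2}lu /t -scalerAl mcoeffZ mulrC [('X_[u] * b)]mulrC addmC mcoeffMX.
  by rewrite mulrC divfK ?subrr ?eqxx // mleadc_eq0.
have [q [qA E]] := IH _ lt a' erefl a'A hk'.
exists (q + t); split; first exact: inAD.
by rewrite mulrDr -E /a' [b * t]mulrC subrK.
Qed.

Lemma edge_ring_sub a b : edge_ring K e a -> edge_ring K e b -> edge_ring K e (a - b).
Proof.
have [f hf] := edge_map_rmorphism K e.
by move=> [x ->] [y ->]; exists (x - y); rewrite -!hf rmorphB.
Qed.

Lemma edge_ring_mul a b : edge_ring K e a -> edge_ring K e b -> edge_ring K e (a * b).
Proof.
have [f hf] := edge_map_rmorphism K e.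
by move=> [x ->] [y ->]; exists (x * y); rewrite -!hf rmorphM.
Qed.

Lemma edge_ring1 : edge_ring K e 1.
Proof. by have [f hf] := edge_map_rmorphism K e; exists 1; rewrite -hf rmorph1. Qed.

Lemma edge_ring_exp a k : edge_ring K e a -> edge_ring K e (a ^+ k).
Proof.
by move=> ha; elim: k => [|k IH]; [apply: edge_ring1|rewrite exprS; apply: edge_ring_mul].
Qed.

Theorem edge_ring_normal : normal_subring (edge_ring K e).
Proof.
move=> x [a [b [ha hb b0 Ex]]] [q [qm hq rq]].
pose tf := @FracField.tofrac (Defs.mpoly K n).
have tb0 : tf b != 0 by rewrite /tf tofrac_eq0.
pose N := (size q).-1.
have szq : size q = N.+1 by rewrite prednK // lt0n size_poly_eq0 monic_neq0.
have xN : x ^+ N = - \sum_(i < N) tf q`_i * x ^+ i.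
  move/rootP: rq; rewrite /map_poly horner_poly szq big_ord_recr /=.
  have -> : q`_N = 1 by move/monicP: qm; rewrite lead_coefE.
  by rewrite tofrac1 mul1r addrC => /eqP; rewrite addr_eq0 => /eqP.
(* One denominator for all powers of [x]: up to [N] it clears them directly, and beyond [N] the
   integral equation lowers the exponent. *)
have bx k : exists r, edge_ring K e r /\ tf (b ^+ N) * x ^+ k = tf r.
  have [l] := ubnP k; elim: l k => // l IH k; rewrite ltnS => kl.
  have [kN|kN] := leqP k N.
    exists (b ^+ (N - k) * a ^+ k); split; first by apply: edge_ring_mul; apply: edge_ring_exp.
    rewrite Ex /tf rmorphM !rmorphXn /= -(exprM_div (tf a) k tb0) mulrA -exprD subnK //.
  have := fun i : 'I_N => IH (k - N + i)%N _.
  have lt (i : 'I_N) : (k - N + i < l)%N by move: (ltn_ord i) kN kl; clear; lia.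
  have /fin_all_exists[r hr] (i : 'I_N) : exists r, edge_ring K e r /\ tf (b ^+ N) * x ^+ (k - N + i) = tf r.
    exact: IH (lt i).
  move=> _; exists (0 - \sum_(i < N) q`_i * r i); split.
    have [f hf] := edge_map_rmorphism K e.
    have e0 : edge_ring K e 0 by exists 0; rewrite -hf rmorph0.
    apply: edge_ring_sub => //; apply: (big_ind (edge_ring K e)) => // [y z hy hz|i _].
      by rewrite -[z]opprK -[- z]sub0r; apply: edge_ring_sub => //; apply: edge_ring_sub.
    by apply: edge_ring_mul; [apply: hq|have [] := hr i].
  rewrite -{1}(subnK (ltnW kN)) exprD xN sub0r /tf rmorphN rmorph_sum /= mulrN mulrN.
  congr (- _); rewrite !mulr_sumr; apply: eq_bigr => i _.
  have -> : FracField.tofrac (q`_i * r i) = tf q`_i * (tf (b ^+ N) * x ^+ (k - N + i)).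
    by rewrite rmorphM (hr i).2.
  by rewrite /tf exprD !mulrA; congr (_ * _); rewrite mulrC mulrA.
have hk k : exists r, inA r /\ theta (b ^+ N) * theta a ^+ k = theta b ^+ k * r.
  have [r [rA E]] := bx k; exists (theta r); split; first exact/edge_ringP.
  rewrite -!rmorphXn -!rmorphM; congr theta; apply/eqP; rewrite -tofrac_eq.
  apply/eqP; transitivity (tf b ^+ k * tf r); last by rewrite /tf rmorphM rmorphXn.
  by rewrite -E Ex mulrCA exprM_div // /tf rmorphM !rmorphXn.
have tb : theta b != 0 by rewrite -(rmorph0 (@theta K n)) (inj_eq (@theta_inj K n)).
have tbN : theta (b ^+ N) != 0 by rewrite rmorphXn expf_neq0.
have [Q [QA E]] := divisible_of_almost_integral
  ((edge_ringP a).1 ha) ((edge_ringP b).1 hb) tb tbN hk.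
exists (theta_inv Q); split; first by apply/edge_ringP; rewrite theta_invK.
have aE : a = b * theta_inv Q by apply: (@theta_inj K); rewrite rmorphM /= theta_invK.
by rewrite Ex aE rmorphM /= mulrC mulKf.
Qed.

End Normality.

Theorem theorem6p3 (K : fieldType) (T : finType) (e : rel T) :
  simple_graph e -> biconnected e -> complete_intersection_graph K e ->
  odd_cycle_condition e /\ normal_subring (edge_ring K e).
Proof.
move=> simple bic ci.
have occ := odd_cycle_condition_of_complete_intersection simple bic ci.
by split=> //; apply: edge_ring_normal.
Qed.
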